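(* Let $d\ge 1$, let $b:\mathbb{R}\to\mathbb{R}^d$ be Lipschitz continuous, let $\bar u\in L^1(\mathbb{R}^d)\cap L^\infty(\mathbb{R}^d)$, let $\nu>0$, and let $p$ satisfy $2\le p<\infty$ and $p>d$. For $0<\varepsilon\le 1$ let $u_{\varepsilon\nu}$ be the solution of the nonlocal viscous Cauchy problem $$\partial_t u_{\varepsilon\nu}+\operatorname{div}\big[u_{\varepsilon\nu}\,b(u_{\varepsilon\nu}*\eta_\varepsilon)\big]=\nu\Delta u_{\varepsilon\nu},\qquad u_{\varepsilon\nu}(0,x)=\bar u(x),$$ and let $u_\nu$ be the solution of the local viscous Cauchy problem $$\partial_t u_\nu+\operatorname{div}\big[u_\nu\, b(u_\nu)\big]=\nu\Delta u_\nu,\qquad u_\nu(0,x)=\bar u(x).$$ Then, as $\varepsilon\to0^+$, $u_{\varepsilon\nu}\to u_\nu$ strongly in $L^\infty_{\mathrm{loc}}([0,+\infty[;L^p(\mathbb{R}^d))$; that is, for every $T>0$, $\operatorname{ess\,sup}_{t\in[0,T]}\|u_{\varepsilon\nu}(t,\cdot)-u_\nu(t,\cdot)\|_{L^p(\mathbb{R}^d)}\to0$.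
   Context: The kernel $\eta:\mathbb{R}^d\to\mathbb{R}$ is a fixed function with $\eta\in C_c^\infty(\mathbb{R}^d)$, $\eta(x)=0$ for $|x|\ge1$, $\eta\ge0$, $\int_{\mathbb{R}^d}\eta\,dx=1$ (no symmetry is assumed), and $\eta_\varepsilon(x):=\varepsilon^{-d}\eta(x/\varepsilon)$ for $0<\varepsilon\le1$. Convolution and divergence are with respect to the space variable only. The solution $u_{\varepsilon\nu}$ is the unique distributional solution on $[0,+\infty[\times\mathbb{R}^d$ such that for every $T>0$: $\|u_{\varepsilon\nu}(t,\cdot)\|_{L^1}\le\|\bar u\|_{L^1}$ for $t\in[0,T]$, $u_{\varepsilon\nu}\in L^\infty([0,T]\times\mathbb{R}^d)$, $\partial_t u_{\varepsilon\nu}\in L^2([0,T];H^{-1}(\mathbb{R}^d))$, $u_{\varepsilon\nu}\in L^2([0,T];H^1(\mathbb{R}^d))$; it is identified with its representative in $C^0([0,T];L^2(\mathbb{R}^d))$. The solution $u_\nu$ is the classical bounded solution of the viscous conservation law, identified with its representative that is continuous in time with values in $L^1(\mathbb{R}^d)$. *)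

(* Defs.v *)
From HB Require Import structures.
From mathcomp Require Import all_boot all_order all_algebra.
From mathcomp Require Import all_classical all_reals all_analysis.
From mathcomp Require Import ess_sup_inf.

Set Implicit Arguments.
Unset Strict Implicit.
Unset Printing Implicit Defensive.

Import Order.TTheory GRing.Theory Num.Theory.
Import numFieldNormedType.Exports.

Local Open Scope classical_set_scope.
Local Open Scope ring_scope.

Definition measure_rV_display : measure_display -> measure_display.
Proof. exact. Qed.

Section measurable_rV.
Context {R : realType} (n : nat).

Let coor : 'I_n -> 'rV[R]_n -> R := fun i x => x ord0 i.

Let rV_set0 : g_sigma_preimage coor set0.
Proof. exact: sigma_algebra0. Qed.

Let rV_setC A : g_sigma_preimage coor A -> g_sigma_preimage coor (~` A).
Proof. exact: sigma_algebraC. Qed.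

Let rV_bigcup (F : _^nat) : (forall i, g_sigma_preimage coor (F i)) ->
  g_sigma_preimage coor (\bigcup_i (F i)).
Proof. exact: sigma_algebra_bigcup. Qed.

(* The product sigma-algebra generated by the coordinates, that is, the Borel
   sigma-algebra of R^n. *)
HB.instance Definition _ := @isMeasurable.Build
  (measure_rV_display default_measure_display) 'rV[R]_n
  (g_sigma_preimage coor) rV_set0 rV_setC rV_bigcup.

Lemma measurable_coor (i : 'I_n) :
  measurable_fun [set: 'rV[R]_n] (fun x : 'rV[R]_n => x ord0 i).
Proof.
move=> _ Y mY; rewrite setTI; apply: sub_sigma_algebra => /=.
rewrite -bigcup_seq/=; exists i => /=; first by rewrite mem_index_enum.
by exists Y => //; rewrite setTI.
Qed.

Lemma measurable_fun_rV d (T : measurableType d) (f : T -> 'rV[R]_n) :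
  (forall i, measurable_fun [set: T] (fun t => f t ord0 i)) ->
  measurable_fun [set: T] f.
Proof.
move=> mf.
suff H : g_sigma_preimage (fun i => coor i \o f) `<=` measurable.
  move: H; rewrite g_sigma_preimage_comp => H _ A mA.
  by apply: H; exists A.
apply: smallest_sub; first exact: sigma_algebra_measurable.
rewrite -bigcup_seq; apply: bigcup_sub => i _ A [B mB <-].
exact: mf.
Qed.

End measurable_rV.

Section lebesgue_rV.
Context {R : realType}.

Definition rV_cons n (p : R * 'rV[R]_n) : 'rV[R]_n.+1 :=
  \row_i (if unlift ord0 i is Some j then p.2 ord0 j else p.1).

Definition rV_uncons n (x : 'rV[R]_n.+1) : R * 'rV[R]_n :=
  (x ord0 ord0, \row_j x ord0 (lift ord0 j)).

Lemma rV_consK n : cancel (@rV_cons n) (@rV_uncons n).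
Proof.
move=> [a x]; rewrite /rV_cons /rV_uncons mxE unlift_none; congr pair.
by apply/rowP => j; rewrite !mxE liftK.
Qed.

Lemma measurable_rV_cons n : measurable_fun setT (@rV_cons n).
Proof.
apply: measurable_fun_rV => i.
under eq_fun do rewrite mxE.
case: unliftP => [j|] _; last exact: measurable_fst.
exact: (measurableT_comp (measurable_coor j) measurable_snd).
Qed.

Lemma measurable_rV_uncons n : measurable_fun setT (@rV_uncons n).
Proof.
apply/measurable_fun_pairP; split; first exact: (measurable_coor ord0).
apply: measurable_fun_rV => i; rewrite /comp /=.
under eq_fun do rewrite mxE.
exact: measurable_coor.
Qed.

Section rV_cons_measure.
Variables (n : nat) (mu : {sigma_finite_measure set 'rV[R]_n -> \bar R}).

Definition rV_cons_measure : set 'rV[R]_n.+1 -> \bar R :=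
  pushforward (lebesgue_measure \x mu)%E (@rV_cons n).

Let pm : {measure set 'rV[R]_n.+1 -> \bar R} :=
  measure_function_pushforward__canonical__measure_function_Measure
    (lebesgue_measure \x mu)%E (@measurable_rV_cons n).

Let rV_cons_measure0 : rV_cons_measure set0 = 0%E.
Proof. exact: (measure0 pm). Qed.

Let rV_cons_measure_ge0 A : (0 <= rV_cons_measure A)%E.
Proof. exact: (measure_ge0 pm). Qed.

Let rV_cons_measure_sigma_additive : semi_sigma_additive rV_cons_measure.
Proof. exact: (@measure_semi_sigma_additive _ _ _ pm). Qed.

HB.instance Definition _ := isMeasure.Build _ _ _ rV_cons_measure
  rV_cons_measure0 rV_cons_measure_ge0 rV_cons_measure_sigma_additive.

Let rV_cons_measure_sigma_finite : sigma_finite setT rV_cons_measure.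
Proof.
have [F TF Foo] := @sigma_finiteT _ _ _ (@lebesgue_measure R).
have [G TG Goo] := sigma_finiteT mu.
pose unc := @rV_uncons n.
pose FG (k : nat) : set (R * 'rV[R]_n) :=
  if unpickle k is Some ij then F ij.1 `*` G ij.2 else set0.
have mFG k : measurable (FG k).
  rewrite /FG; case: unpickle => [[i j]|] //=.
  by apply: measurableX; [case: (Foo i)|case: (Goo j)].
exists (fun k => unc @^-1` FG k).
  rewrite -preimage_bigcup; apply/seteqP; split => // x _ /=.
  have [i _ Fi] : (\bigcup_i F i) (unc x).1 by rewrite -TF.
  have [j _ Gj] : (\bigcup_j G j) (unc x).2 by rewrite -TG.
  by exists (pickle (i, j)) => //; rewrite /FG pickleK.
move=> k; split.
  by rewrite -[X in measurable X]setTI; exact: measurable_rV_uncons.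
rewrite /rV_cons_measure /pushforward -comp_preimage.
rewrite (_ : _ \o _ = id) ?preimage_id; last by apply/funext/rV_consK.
rewrite /FG; case: unpickle => [[i j]|] /=; last by rewrite measure0.
have [mF Fi] := Foo i; have [mG Gj] := Goo j.
by rewrite product_measure1E// lte_mul_pinfty// ge0_fin_numE.
Qed.

HB.instance Definition _ := Measure_isSigmaFinite.Build _ _ _ rV_cons_measure
  rV_cons_measure_sigma_finite.

End rV_cons_measure.

(* R^0 is a point of mass 1, and the measure on R^(n+1) = R x R^n is the product
   of the one-dimensional Lebesgue measure with the measure on R^n. *)
Fixpoint lebesgue_rV n : {sigma_finite_measure set 'rV[R]_n -> \bar R} :=
  match n with
  | 0 => \d_(0 : 'rV[R]_0)
  | m.+1 => rV_cons_measure (lebesgue_rV m)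
  end.

End lebesgue_rV.

Lemma lebesgue_rV_box (R : realType) n (A : 'I_n -> set R) :
  (forall i, measurable (A i)) ->
  lebesgue_rV n [set x | forall i, A i (x ord0 i)] =
  (\prod_(i < n) lebesgue_measure (A i))%E.
Proof.
elim: n A => [|n IHn] A mA.
  by rewrite big_ord0 /= diracE mem_set // => -[].
pose B := [set x : 'rV[R]_n | forall i, A (lift ord0 i) (x ord0 i)].
have mB : measurable B.
  rewrite (_ : B = \bigcap_(i in [set: 'I_n])
      ((fun x : 'rV[R]_n => x ord0 i) @^-1` A (lift ord0 i))); last first.
    by apply/seteqP; split => [x h i _|x h i]; [exact: h|exact: (h i Logic.I)].
  apply: fin_bigcap_measurable => // i _.
  by rewrite -[X in measurable X]setTI; exact: measurable_coor.
rewrite big_ord_recl -(IHn (fun i => A (lift ord0 i)))//.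
rewrite -[RHS](product_measure1E lebesgue_measure (lebesgue_rV n))//; last exact: mA.
rewrite /= /rV_cons_measure /pushforward; congr product_measure1.
apply/seteqP; split => -[a x] /=.
  move=> h; split; first by have := h ord0; rewrite mxE unlift_none.
  by move=> i; have := h (lift ord0 i); rewrite mxE liftK.
by move=> [h0 h] i; rewrite mxE; case: unliftP => [j|] -> //; exact: h.
Qed.

Section smooth.
Context {R : realType} {V : normedModType R}.
Implicit Type f : V -> R.

(* On a finite-dimensional V this is C^infty. *)
Definition smooth f :=
  forall (vs : seq V) (x : V),
    differentiable (foldr (fun v g => 'D_v g) f vs : V -> R) x.

Definition tsupport f : set V := closure [set x | f x != 0].

Definition Cc_infty (U : set V) f :=
  [/\ smooth f, compact (tsupport f) & tsupport f `<=` U].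

End smooth.

Section function_spaces.
Context {R : realType} {d : nat}.
Implicit Types (f g phi : 'rV[R]_d -> R) (u : R -> 'rV[R]_d -> R) (T : R).

Local Notation lambda := (lebesgue_rV d : {measure set 'rV[R]_d -> \bar R}).
Local Notation lambda1 := (@lebesgue_measure R).
Local Notation tlambda := (lambda1 \x lebesgue_rV d)%E.

Definition basis_vec (i : 'I_d) : 'rV[R]_d := delta_mx ord0 i.

(* The norm of the library on 'rV[R]_d is the sup norm. *)
Definition enorm (x : 'rV[R]_d) : R := Num.sqrt (\sum_(i < d) x ord0 i ^+ 2).

Definition partial (i : 'I_d) f : 'rV[R]_d -> R := 'D_(basis_vec i) f.

Definition cylinder (I : set R) : set (R * 'rV[R]_d) := I `*` setT.

Definition Linfty_on (I : set R) u :=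
  exists M : R, {ae tlambda, forall z, cylinder I z -> `|u z.1 z.2| <= M}.

Definition weak_partial (i : 'I_d) f g :=
  forall phi, Cc_infty setT phi ->
    \int[lambda]_x (f x * partial i phi x) = - (\int[lambda]_x (g x * phi x)).

(* u belongs to L^2([0,T]; H^1(R^d)): g i is the i-th component of the weak
   spatial gradient of u. *)
Definition L2_H1 T u :=
  exists g : 'I_d -> R -> 'rV[R]_d -> R,
    [/\ forall i, measurable_fun (cylinder `[0, T]) (fun z => g i z.1 z.2),
        forall i, {ae lambda1, forall t, `[0, T]%classic t ->
          weak_partial i (u t) (g i t)} &
        (\int[tlambda]_(z in cylinder `[0%R, T])
          (u z.1 z.2 ^+ 2 + \sum_(i < d) g i z.1 z.2 ^+ 2)%:E < +oo)%E].

Definition H1_norm phi : R :=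
  Num.sqrt ((\int[lambda]_x (phi x ^+ 2))
            + \sum_(i < d) (\int[lambda]_x (partial i phi x ^+ 2))).

(* F belongs to H^-1(R^d), the dual of H^1(R^d), and has norm at most C. As
   C_c^infty(R^d) is dense in H^1(R^d), F is given by its values there. *)
Definition Hm1_le (C : R) (F : ('rV[R]_d -> R) -> R) :=
  (forall (a : R) phi psi, Cc_infty setT phi -> Cc_infty setT psi ->
     F (fun x => a * phi x + psi x) = a * F phi + F psi) /\
  (forall phi, Cc_infty setT phi -> `|F phi| <= C * H1_norm phi).

(* The distributional time derivative of u on ]0,T[ x R^d is the family
   F in L^2([0,T]; H^-1(R^d)). As H^-1(R^d) is separable, strong measurability
   of F amounts to the measurability of each F ^~ phi. *)
Definition dt_L2_Hm1 T u :=
  exists (F : R -> ('rV[R]_d -> R) -> R) (C : R -> R),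
    [/\ measurable_fun `[0, T] C /\
        (\int[lambda1]_(t in `[0%R, T]) (C t ^+ 2)%:E < +oo)%E,
        {ae lambda1, forall t, `[0, T]%classic t -> Hm1_le (C t) (F t)},
        forall phi, Cc_infty setT phi ->
          measurable_fun `[0, T] (fun t => F t phi) &
        forall (psi : R -> R) phi,
          Cc_infty `]0, T[ psi -> Cc_infty setT phi ->
          - (\int[lambda1]_(t in `[0, T])
               (derive1 psi t * \int[lambda]_x (u t x * phi x))) =
          \int[lambda1]_(t in `[0, T]) (psi t * F t phi)].

Definition C0_Lp T (p : \bar R) u :=
  (forall t, `[0, T]%classic t -> u t \in Lfun lambda p) /\
  (forall s, `[0, T]%classic s ->
     'N[lambda]_p[EFin \o (u t \- u s)%R]%E @[t --> within `[0, T] (nbhs s)]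
       --> 0%E).

Definition Linfty_Lp_norm T (p : R) u : \bar R :=
  ess_sup (mrestr lambda1 (measurable_itv `[0, T]))
    (fun t => 'N[lambda]_(p%:E)[EFin \o u t]%E).

End function_spaces.

Section cauchy_problems.
Context {R : realType} {d : nat}.
Variables (eta : 'rV[R]_d -> R) (b : R -> 'rV[R]_d) (nu : R).
Variable ubar : 'rV[R]_d -> R.
Implicit Types (u : R -> 'rV[R]_d -> R) (v : R -> 'rV[R]_d -> 'rV[R]_d).
Implicit Types (phi : R * 'rV[R]_d -> R) (eps : R).

Local Notation lambda := (lebesgue_rV d : {measure set 'rV[R]_d -> \bar R}).
Local Notation tlambda := (@lebesgue_measure R \x lebesgue_rV d)%E.

Definition kernel_axioms :=
  [/\ Cc_infty setT eta,
      forall x, 1 <= enorm x -> eta x = 0,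
      forall x, 0 <= eta x &
      \int[lambda]_x eta x = 1].

Definition eta_ eps (x : 'rV[R]_d) : R := eps ^- d * eta (eps^-1 *: x).

Definition convolution (f g : 'rV[R]_d -> R) (x : 'rV[R]_d) : R :=
  \int[lambda]_y (f y * g (x - y)).

Definition dt phi : R * 'rV[R]_d -> R := 'D_(1, 0) phi.

Definition dx (i : 'I_d) phi : R * 'rV[R]_d -> R := 'D_(0, basis_vec i) phi.

(* Distributional solution on [0,+oo[ x R^d of
   d_t u + div (u v) = nu Delta u, u(0, .) = ubar.
   Test functions do not vanish at t = 0, which encodes the initial datum. *)
Definition distributional_solution v u :=
  forall phi, Cc_infty setT phi ->
    (\int[tlambda]_(z in cylinder `[0, +oo[)
       (u z.1 z.2 * (dt phi z + (\sum_(i < d) v z.1 z.2 ord0 i * dx i phi z)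
                     + nu * \sum_(i < d) dx i (dx i phi) z)))
    + (\int[lambda]_x (ubar x * phi (0, x))) = 0.

Definition nonlocal_solution eps u :=
  [/\ measurable_fun (cylinder `[0, +oo[) (fun z => u z.1 z.2),
      distributional_solution (fun t x => b (convolution (u t) (eta_ eps) x)) u &
      forall T : R, 0 < T ->
        [/\ forall t, 0 <= t <= T ->
              ('N[lambda]_1[EFin \o u t] <= 'N[lambda]_1[EFin \o ubar])%E,
            Linfty_on `[0, T] u,
            dt_L2_Hm1 T u,
            L2_H1 T u &
            C0_Lp T 2%:E u]].

(* For b merely Lipschitz the flux r |-> r b(r) need not be differentiable and
   the solution need not be C^2 in space, so the equation is understood in the
   sense of distributions. The solution is unique in this class. *)
Definition local_solution u :=
  [/\ measurable_fun (cylinder `[0, +oo[) (fun z => u z.1 z.2),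
      distributional_solution (fun t x => b (u t x)) u,
      Linfty_on `[0, +oo[ u &
      forall T : R, 0 < T -> C0_Lp T 1%:E u].

End cauchy_problems.

(* Main.v *)
(* Write u for the nonlocal and w for the local solution, z = u - w, and let F and G be
   their fluxes.  Testing both equations with the backward heat kernel gives, for every
   t, x and delta > 0, the mild identity
     (z(t) * Gauss_delta)(x) = sum_i int_0^t int (F_i - G_i)(s,y) d_i Gauss_(t+delta-s)(x-y) dy ds.
   As |d_i Gauss_tau| <= C tau^(-1/2) Gauss_(2 tau), and F - G is bounded by a multiple of
   |z|, of its convolution with the kernel, and of |w * eta_eps - w|, this yields
   |z(t,x)| <= E exp(l t), where E is small with eps: the weight exp(l s) makes the
   singular time kernel integrate to O(l^(-1/2)), and the term |w * eta_eps - w| tends to 0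
   in L^1(]0,T[ x R^d).  The bound is propagated in time steps that are short depending on
   eps, the L^oo bound on u being at first known only for each fixed eps.  Finally
   ||z||_p^p <= ||z||_oo^(p-1) ||z||_1, and ||z(t)||_1 is bounded. *)
From HB Require Import structures.
Require Import Defs.
From mathcomp Require Import all_boot all_order all_algebra.
From mathcomp Require Import all_classical all_reals all_analysis.
From mathcomp Require Import ess_sup_inf measurable_realfun.
From mathcomp Require Import lra ring.

Set Implicit Arguments.
Unset Strict Implicit.
Unset Printing Implicit Defensive.

Import Order.TTheory GRing.Theory Num.Theory.
Import numFieldNormedType.Exports.

Local Open Scope classical_set_scope.
Local Open Scope ring_scope.

(** * Integration on R^n *)

(** Both weak formulations carry the same initial term, so it cancels in the difference and the way
    in which the datum is attained never has to be studied. The backward heat kernel is not a test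
    function: it is singular at its pole and has no compact support in space or time. Placing the
    pole at [t + delta] removes the singularity, a cut-off in space and a plateau in time remove the
    rest, and both are manufactured from [eta], the smooth compactly supported function at hand. The
    parameter [delta] disappears only at the level of bounds: a uniform bound on the Gaussian
    mollifications of a function bounds the function almost everywhere. The delicate point is
    uniformity in [eps]. The constants in the bound of F - G depend on the size of u, which is under
    control only while |z| <= 1. Each time step returns the very bound E exp(l t) that it started
    from, with the same E and l, so the number of steps, although it depends on [eps], costs
    nothing. *)

Section affine1.
Context {R : realType}.
Local Notation mu := (@lebesgue_measure R).
Local Notation RR := (measurableTypeR R).

(** By uniqueness of Lebesgue measure: [|c|] times the pushforward by the affine map agrees with it
    on half-open intervals. For negative [c] the preimage of []x, y]] is closed on the left instead,
    with the same length. *)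
Lemma ge0_integral_affine1 (a c : R) (f : R -> \bar R) : c != 0 ->
  measurable_fun setT f -> (forall x, 0 <= f x)%E ->
  (\int[mu]_x f x = `|c|%:E * \int[mu]_x f (a + c * x)%R)%E.
Proof.
move=> c0 mf f0.
have mA : measurable_fun (setT : set (measurableTypeR R))
    ((fun x : R => a + c * x) : measurableTypeR R -> measurableTypeR R).
  by apply: measurable_funD => //; apply: measurable_funM.
pose pm : {measure set (measurableTypeR R) -> \bar R} :=
  measure_function_pushforward__canonical__measure_function_Measure mu mA.
pose nu := mscale (NngNum (normr_ge0 c)) pm.
have nuE X : ocitv X -> mu X = nu X.
  move=> [[x y] /= xy <-].
  rewrite /nu /mscale /= /pushforward.
  have [cp|cn|/eqP] := ltgtP 0 c; last by rewrite eq_sym (negbTE c0).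
    rewrite (_ : _ @^-1` _ = `](x - a) / c, (y - a) / c]%classic); last first.
      by apply/seteqP; split => t /=; rewrite !in_itv /= ltr_pdivrMr// ler_pdivlMr// => /andP[h1 h2]; apply/andP; split; lra.
    rewrite !lebesgue_measure_itv /= !lte_fin ltr_pM2r ?invr_gt0// ltrD2r.
    case: ifP => // _; last by rewrite mule0.
    by rewrite -!EFinB -EFinM gtr0_norm//; congr EFin; field.
  rewrite (_ : _ @^-1` _ = `[(y - a) / c, (x - a) / c[%classic); last first.
    by apply/seteqP; split => t /=; rewrite !in_itv /= ltr_ndivlMr// ler_ndivrMr// => /andP[h1 h2]; apply/andP; split; lra.
  rewrite !lebesgue_measure_itv /= !lte_fin ltr_nM2r ?invr_lt0// ltrD2r.
  case: ifP => // _; last by rewrite mule0.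
  by rewrite -!EFinB -EFinM ltr0_norm//; congr EFin; field.
have E : (\int[mu]_x f x = \int[nu]_x f x)%E.
  by apply: eq_measure_integral => A mAA _; exact: (lebesgue_measure_unique nuE).
rewrite E ge0_integral_mscale//; congr (_ * _)%E.
by rewrite [LHS](ge0_integral_pushforward mA)//.
Qed.

Lemma measurable_rVcons n :
  measurable_fun (setT : set (RR * 'rV[R]_n)) (@rV_cons R n).
Proof. exact: measurable_rV_cons. Qed.

(** Tonelli applied to one level of the recursion that defines [lebesgue_rV]; the inductions on the
    dimension rest on it. *)
Lemma ge0_integral_rVS n (f : 'rV[R]_n.+1 -> \bar R) :
  measurable_fun setT f -> (forall x, 0 <= f x)%E ->
  (\int[lebesgue_rV n.+1]_x f x =
   \int[mu]_r \int[lebesgue_rV n]_x f (rV_cons (r, x)))%E.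
Proof.
move=> mf f0.
have mfc : measurable_fun (setT : set (RR * 'rV[R]_n)) (f \o @rV_cons R n).
  by apply: measurableT_comp => //; exact: measurable_rVcons.
rewrite -[RHS](@fubini_tonelli1 _ _ _ _ _ mu (lebesgue_rV n) _ mfc)//; last by move=> z; exact: f0.
pose pm : {measure set 'rV[R]_n.+1 -> \bar R} :=
  measure_function_pushforward__canonical__measure_function_Measure
    (mu \x lebesgue_rV n)%E (@measurable_rV_cons R n).
transitivity (\int[pm]_x f x)%E; first exact: eq_measure_integral.
have := @ge0_integral_pushforward _ _ _ _ R _ (@measurable_rVcons n)
   (mu \x lebesgue_rV n)%E setT f measurableT mf (fun y _ => f0 y).
by rewrite preimage_setT.
Qed.

Lemma measurable_rVD n d (T : measurableType d) (f g : T -> 'rV[R]_n) :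
  measurable_fun setT f -> measurable_fun setT g ->
  measurable_fun setT (fun t => f t + g t).
Proof.
move=> mf mg; apply: measurable_fun_rV => i.
under eq_fun do rewrite mxE.
by apply: measurable_funD; apply: (measurableT_comp (measurable_coor i)).
Qed.

Lemma measurable_rVZ n d (T : measurableType d) (c : T -> R) (g : T -> 'rV[R]_n) :
  measurable_fun setT c -> measurable_fun setT g ->
  measurable_fun setT (fun t => c t *: g t).
Proof.
move=> mf mg; apply: measurable_fun_rV => i.
under eq_fun do rewrite mxE.
by apply: measurable_funM => //; apply: (measurableT_comp (measurable_coor i)).
Qed.

Lemma measurable_rVN n d (T : measurableType d) (f : T -> 'rV[R]_n) :
  measurable_fun setT f -> measurable_fun setT (fun t => - f t).
Proof.
move=> mf; apply: measurable_fun_rV => i.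
under eq_fun do rewrite mxE.
by apply: measurableT_comp => //; apply: (measurableT_comp (measurable_coor i)).
Qed.

(** Induction on the dimension, each coordinate contributing one factor [|c|]. *)
Lemma ge0_integral_affine n (a : 'rV[R]_n) (c : R) (f : 'rV[R]_n -> \bar R) :
  c != 0 -> measurable_fun setT f -> (forall x, 0 <= f x)%E ->
  (\int[lebesgue_rV n]_x f x =
   (`|c| ^+ n)%:E * \int[lebesgue_rV n]_x f (a + c *: x)%R)%E.
Proof.
move=> c0; elim: n a f => [|n IHn] a f mf f0.
  rewrite expr0 mul1e; apply: eq_integral => x _; congr f.
  by apply/rowP => -[].
have mac : measurable_fun setT (fun x : 'rV[R]_n.+1 => f (a + c *: x)).
  apply: measurableT_comp => //; apply: measurable_rVD => //; exact: measurable_rVZ.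
pose a' : 'rV[R]_n := \row_j a ord0 (lift ord0 j).
have consE r x : a + c *: rV_cons (r, x) = rV_cons (a ord0 ord0 + c * r, a' + c *: x).
  apply/rowP => i; rewrite !mxE; case: unliftP => [j|] -> //=.
  by rewrite !mxE.
have mf2 : measurable_fun setT (fun z : RR * 'rV[R]_n => f (rV_cons z)).
  by apply: measurableT_comp => //; exact: measurable_rVcons.
pose g r := (\int[lebesgue_rV n]_x f (rV_cons (r, x)))%E.
have mg : measurable_fun setT g.
  exact: (@measurable_fun_fubini_tonelli_F _ _ _ _ _ _ _ mf2).
have g0 r : (0 <= g r)%E by apply: integral_ge0.
have mf3 r : measurable_fun setT (fun x : 'rV[R]_n => f (rV_cons (r, x))).
  exact: (measurableT_comp mf2 (pair1_measurable r)).
have mh : measurable_fun (setT : set RR)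
    (fun r => \int[lebesgue_rV n]_x f (rV_cons (a ord0 ord0 + c * r, a' + c *: x)%R))%E.
  under eq_fun do under eq_integral do rewrite -consE.
  have mac2 : measurable_fun (setT : set (RR * 'rV[R]_n)) (fun z => f (a + c *: rV_cons z)).
    by apply: (measurableT_comp mac); exact: measurable_rVcons.
  exact: (@measurable_fun_fubini_tonelli_F _ _ _ _ _ _ _ mac2).
rewrite !ge0_integral_rVS//.
rewrite (ge0_integral_affine1 (a ord0 ord0) c0 mg g0).
under eq_integral do rewrite /g (IHn a')//.
rewrite ge0_integralZl//; last by move=> r _; apply: integral_ge0.
rewrite exprS EFinM muleA; congr (_ * _)%E.
by apply: eq_integral => r _; apply: eq_integral => x _; rewrite consE.
Qed.

Definition grid_round n (k : nat) (x : 'rV[R]_n) : 'rV[int]_n :=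
  \row_i Num.floor (k.+1%:R * x ord0 i).

(** The sigma-algebra is generated by the coordinates, not by the open sets, so [f] is obtained as
    the pointwise limit of its values at grid points of mesh 1/(k+1). Each approximation is constant
    on countably many half-open cubes, which are measurable boxes. *)
Lemma continuous_measurable_rV n (f : 'rV[R]_n -> R) :
  continuous f -> measurable_fun setT f.
Proof.
move=> cf.
pose g k (x : 'rV[R]_n) : 'rV[R]_n := \row_i ((grid_round k x ord0 i)%:~R / k.+1%:R).
apply: (@measurable_fun_cvg _ _ _ _ (fun k => f \o g k)); last first.
  move=> x _; apply: (cvg_comp (g^~ x) f); last exact: cf.
  apply/cvgrPdist_le => e e0.
  have [N _ HN] := near_infty_natSinv_lt (PosNum e0).
  near=> k.
  rewrite /Num.norm/= mx_normrE; apply: bigmax_le => [|[i j] _]; first exact: ltW.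
  rewrite !mxE /= ord1.
  have k0 : 0 < k.+1%:R :> R by [].
  have /andP[h1 h2] := floor_itv (k.+1%:R * x ord0 j).
  have -> : x ord0 j - (Num.floor (k.+1%:R * x ord0 j))%:~R / k.+1%:R =
    (k.+1%:R * x ord0 j - (Num.floor (k.+1%:R * x ord0 j))%:~R) / k.+1%:R by field.
  rewrite normrM ger0_norm ?subr_ge0// ger0_norm ?invr_ge0//.
  apply: (@le_trans _ _ k.+1%:R^-1).
    rewrite ler_piMl// ?invr_ge0// lerBlDl addrC.
    by move: h2; rewrite intrD => /ltW; rewrite addrC.
  by apply/ltW/HN; near: k; exact: nbhs_infty_ge.
move=> k _ Y mY; rewrite setTI.
pose A (m : 'rV[int]_n) : set 'rV[R]_n := 
  if `[< Y (f (\row_i ((m ord0 i)%:~R / k.+1%:R))) >] then grid_round k @^-1` [set m] else set0.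
rewrite (_ : _ @^-1` _ = \bigcup_m A m); last first.
  apply/seteqP; split => x /=.
    by move=> Yx; exists (grid_round k x) => //; rewrite /A asboolT.
  by move=> [m _]; rewrite /A; case: asboolP => // + /= mx; rewrite -mx.
apply: countable_bigcupT_measurable; first exact: countableP.
move=> m; rewrite /A; case: asboolP => // _.
rewrite (_ : _ @^-1` _ = \bigcap_(i in [set: 'I_n]) 
  ((fun x : 'rV[R]_n => x ord0 i) @^-1` [set r | Num.floor (k.+1%:R * r) = m ord0 i])); last first.
  apply/seteqP; split => x /=.
    by move=> <- i _ /=; rewrite mxE.
  by move=> h; apply/rowP => i; rewrite mxE; exact: (h i Logic.I).
apply: fin_bigcap_measurable => // i _.
rewrite -[X in measurable X]setTI; apply: measurable_coor => //.
rewrite (_ : [set r | _] = `[(m ord0 i)%:~R / k.+1%:R, (m ord0 i + 1)%:~R / k.+1%:R[%classic) //.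
apply/seteqP; split => r /=; rewrite in_itv /= ler_pdivrMr// ltr_pdivlMr// mulrC.
  by move=> <-; exact: floor_itv.
exact: floor_def.
Unshelve. all: by end_near.
Qed.

(** Tonelli gives the measurability of partial integrals of nonnegative functions, hence the split
    into positive and negative parts. *)
Lemma measurable_Rintegral_rV d (T : measurableType d) n (k : T * 'rV[R]_n -> R) :
  measurable_fun setT k ->
  measurable_fun setT (fun t => \int[lebesgue_rV n]_y k (t, y)).
Proof.
move=> mk; rewrite /Rintegral.
apply: (measurableT_comp (fine_measurable measurableT)).
under eq_fun do rewrite integralE.
have mEk : measurable_fun setT (fun z => (k z)%:E) by exact/measurable_EFinP.
have F (h : T * 'rV[R]_n -> \bar R) : measurable_fun setT h -> (forall z, 0 <= h z)%E ->
    measurable_fun setT (fun t : T => \int[lebesgue_rV n]_y h (t, y))%E.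
  by move=> mh h0; exact: (@measurable_fun_fubini_tonelli_F _ _ _ _ _ (lebesgue_rV n) _ mh h0).
apply: emeasurable_funB.
  under eq_fun do under eq_integral do rewrite funeposE.
  apply: (F (fun z => Order.max (k z)%:E 0%E)) => [|z]; last by rewrite le_max lexx orbT.
  exact: measurable_maxe.
under eq_fun do under eq_integral do rewrite funenegE.
apply: (F (fun z => Order.max (- (k z)%:E)%E 0%E)) => [|z]; last by rewrite le_max lexx orbT.
by apply: measurable_maxe => //; exact: measurableT_comp.
Qed.

Definition sqn n (x : 'rV[R]_n) : R := \sum_(i < n) x ord0 i ^+ 2.

Lemma measurable_sqn n : measurable_fun setT (@sqn n).
Proof.
apply: measurable_sum => i; apply: measurable_funX; exact: measurable_coor.
Qed.

Lemma integral_expsqn n :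
  (\int[lebesgue_rV n]_x (expR (- sqn x))%:E = (Num.sqrt pi ^+ n)%:E)%E.
Proof.
have m n' : measurable_fun setT (fun x : 'rV[R]_n' => (expR (- sqn x))%:E).
  apply/measurable_EFinP; apply: measurableT_comp => //; apply: measurableT_comp => //; exact: measurable_sqn.
elim: n => [|n IHn].
  rewrite /= integral_dirac//; last exact: (m 0%N).
  by rewrite diracT mul1e /sqn big_ord0 oppr0 expR0.
rewrite ge0_integral_rVS//.
transitivity (\int[mu]_r ((gauss_fun r)%:E * (Num.sqrt pi ^+ n)%:E))%E.
  apply: eq_integral => r _.
  rewrite -IHn -ge0_integralZl//; last 2 first.
    exact: m.
    by rewrite lee_fin expR_ge0.
  apply: eq_integral => x _; rewrite -EFinM -expRD /sqn big_ord_recl.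
  congr (expR _)%:E; rewrite mxE unlift_none /= opprD; congr (_ - _).
  by apply: eq_bigr => i _; rewrite mxE liftK.
rewrite ge0_integralZr//; last first.
  by move=> r _; rewrite lee_fin gauss_fun_ge0.
  apply/measurable_EFinP; exact: measurable_gauss_fun.
by rewrite integralT_gauss -EFinM exprS.
Qed.
End affine1.

(** * Continuity of translations in L^1 *)

Section translation.
Context {R : realType} {d : nat}.
Local Notation RR := (measurableTypeR R).
Local Notation lam := (lebesgue_rV d).
Local Notation V := 'rV[R]_d.
Implicit Types (f g : V -> R) (h : V).

Lemma ge0_integral_shift (f : V -> \bar R) h :
  measurable_fun setT f -> (forall x, 0 <= f x)%E ->
  (\int[lam]_x f (x - h)%R = \int[lam]_x f x)%E.
Proof.
move=> mf f0; rewrite [RHS](ge0_integral_affine (- h) (oner_neq0 _) mf f0).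
rewrite normr1 expr1n mul1e; apply: eq_integral => x _.
by rewrite scale1r addrC.
Qed.

Lemma measurable_shift (f : V -> R) h :
  measurable_fun setT f -> measurable_fun setT (fun x : V => f (x - h)).
Proof.
move=> mf; apply: (measurableT_comp mf); exact: measurable_rVD.
Qed.

Definition L1norm f : \bar R := (\int[lam]_x `|f x|%:E)%E.

Definition trans_mod f h : \bar R := L1norm (fun x => f (x - h) - f x).

Lemma measurable_absE (f : V -> R) : measurable_fun setT f ->
  measurable_fun setT (fun x => `|f x|%:E).
Proof. by move=> mf; apply/measurable_EFinP; exact: measurableT_comp. Qed.

Lemma L1norm_ge0 f : (0 <= L1norm f)%E.
Proof. by apply: integral_ge0 => x _; rewrite lee_fin. Qed.

Lemma L1normD_le f g (k : V -> R) : measurable_fun setT f -> measurable_fun setT g ->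
  measurable_fun setT k -> (forall x, `|f x| <= `|g x| + `|k x|) ->
  (L1norm f <= L1norm g + L1norm k)%E.
Proof.
move=> mf mg mk fgk.
rewrite /L1norm -ge0_integralD//; last 2 first.
exact: measurable_absE.
exact: measurable_absE.
apply: ge0_le_integral => //; first exact: measurable_absE.
  by apply: emeasurable_funD; exact: measurable_absE.
by move=> x _; rewrite -EFinD lee_fin.
Qed.

Lemma L1norm_shift f h : measurable_fun setT f -> L1norm (fun x => f (x - h)) = L1norm f.
Proof.
move=> mf; rewrite /L1norm.
have := @ge0_integral_shift (fun x => `|f x|%:E) h (measurable_absE mf).
by apply => x; rewrite lee_fin.
Qed.

Lemma trans_mod_le f h : measurable_fun setT f ->
  (trans_mod f h <= L1norm f + L1norm f)%E.
Proof.
move=> mf; rewrite /trans_mod -[X in (_ <= X + _)%E](L1norm_shift h mf).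
apply: L1normD_le => //; first (apply: measurable_funB => //; exact: measurable_shift).
  exact: measurable_shift.
by move=> x; exact: ler_normB.
Qed.

Lemma trans_modD_le f g (k : V -> R) h : measurable_fun setT f -> measurable_fun setT g ->
  measurable_fun setT k -> (forall x, f x = g x + k x) ->
  (trans_mod f h <= trans_mod g h + trans_mod k h)%E.
Proof.
move=> mf mg mk fgk; apply: L1normD_le.
- by apply: measurable_funB => //; exact: measurable_shift.
- by apply: measurable_funB => //; exact: measurable_shift.
- by apply: measurable_funB => //; exact: measurable_shift.
by move=> x; rewrite !fgk opprD addrACA; exact: ler_normD.
Qed.

(** This class is stable under linear combinations and L^1 limits. Continuity of translations
    therefore passes from boxes to measurable subsets of a cube, then to simple functions, then to
    integrable functions. *)
Definition L1cont f := measurable_fun setT f /\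
  forall e, 0 < e -> exists2 r, 0 < r & forall h, `|h| <= r -> (trans_mod f h <= e%:E)%E.

Lemma L1contD f g : L1cont f -> L1cont g -> L1cont (fun x => f x + g x).
Proof.
move=> [mf cf] [mg cg]; split; first exact: measurable_funD.
move=> e e0; have [r r0 H] := cf _ (divr_gt0 e0 (@ltr0n _ 2)).
have [s s0 K] := cg _ (divr_gt0 e0 (@ltr0n _ 2)).
exists (Num.min r s); first by rewrite lt_min r0.
move=> h; rewrite le_min => /andP[hr hs].
apply: (le_trans (@trans_modD_le _ f g h _ _ _ _)) => //.
  exact: measurable_funD.
rewrite [e]splitr EFinD; apply: leeD; [exact: H|exact: K].
Qed.

Lemma L1contZ (c : R) f : L1cont f -> L1cont (fun x => c * f x).
Proof.
move=> [mf cf]; split; first exact: measurable_funM.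
have mfh h : measurable_fun setT (fun x : V => f (x - h) - f x).
  by apply: measurable_funB => //; exact: measurable_shift.
move=> e e0; have c1 : 0 < `|c| + 1 by rewrite ltr_wpDl.
have [r r0 H] := cf _ (divr_gt0 e0 c1).
exists r => // h /H {}H; rewrite /trans_mod.
have -> : L1norm (fun x => c * f (x - h) - c * f x) = (`|c|%:E * trans_mod f h)%E.
  rewrite /trans_mod /L1norm -ge0_integralZl//; last exact: measurable_absE.
  by apply: eq_integral => x _; rewrite -mulrBr normrM EFinM.
apply: (@le_trans _ _ (`|c|%:E * (e / (`|c| + 1))%:E)%E).
  by apply: lee_pmul => //; exact: L1norm_ge0.
by rewrite -EFinM lee_fin mulrCA ler_piMr ?(ltW e0)// ler_pdivrMr// mul1r lerDl.
Qed.

Lemma L1cont_lim f : measurable_fun setT f ->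
  (forall e, 0 < e -> exists2 g, L1cont g & (L1norm (fun x => f x - g x)%R <= e%:E)%E) ->
  L1cont f.
Proof.
move=> mf H; split=> // e e0.
have e4 : 0 < e / 4 by rewrite divr_gt0.
have e2 : 0 < e / 2 by rewrite divr_gt0.
have [g [mg cg] fg] := H _ e4.
have [r r0 K] := cg _ e2.
exists r => // h /K {}K.
have mfg : measurable_fun setT (fun x => f x - g x) by exact: measurable_funB.
apply: (le_trans (@trans_modD_le _ (fun x => f x - g x) g h _ _ _ _)) => //.
  by move=> x; rewrite subrK.
have -> : e = (e / 4 + e / 4) + e / 2 by field.
rewrite !EFinD; apply: leeD => //.
by apply: (le_trans (trans_mod_le _ _)) => //; exact: leeD.
Qed.


Lemma measurable_box (A : 'I_d -> set R) : (forall i, measurable (A i)) ->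
  measurable [set x : V | forall i, A i (x ord0 i)].
Proof.
move=> mA.
rewrite (_ : [set x | _] = \bigcap_(i in [set: 'I_d])
    ((fun x : V => x ord0 i) @^-1` A i)); last first.
  by apply/seteqP; split => [x h i _|x h i]; [exact: h|exact: (h i Logic.I)].
apply: fin_bigcap_measurable => // i _.
by rewrite -[X in measurable X]setTI; exact: measurable_coor.
Qed.

Definition ocbox (a b : 'I_d -> R) : set V :=
  [set x | forall i, `](a i), (b i)]%classic (x ord0 i)].

Lemma measurable_ocbox a b : measurable (ocbox a b).
Proof. by apply: (@measurable_box (fun i => `](a i), (b i)]%classic)). Qed.

Lemma lebesgue_ocbox a b :
  lam (ocbox a b) = (\prod_(i < d) Num.max (b i - a i) 0)%:E.
Proof.
rewrite [LHS](@lebesgue_rV_box R d (fun i => `](a i), (b i)]%classic))//.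
transitivity (\prod_(i < d) (Num.max (b i - a i) 0)%:E)%E; last first.
  by rewrite prodEFin.
apply: eq_bigr => i _; rewrite lebesgue_measure_itv /= lte_fin.
have [ab|ab] := ltP (a i) (b i).
  by rewrite -EFinB max_l// subr_ge0 ltW.
by rewrite max_r// subr_le0.
Qed.

Lemma cvg_maxr0 (T : Type) (F : set_system T) (FF : Filter F) (f : T -> R) (l : R) :
  f x @[x --> F] --> l -> Num.max (f x) 0 @[x --> F] --> Num.max l 0.
Proof.
move=> fl; apply/cvgrPdist_le => e e0.
move/cvgrPdist_le : fl => /(_ _ e0); apply: filterS => x.
apply: le_trans; rewrite /Num.max; case: ifP => h1; case: ifP => h2; rewrite ?subrr ?normr0//.
  move/negbT: h2; rewrite -leNgt => h2.
  by rewrite sub0r normrN ger0_norm// ler0_norm; lra.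
move/negbT: h1; rewrite -leNgt => h1.
by rewrite subr0 ger0_norm// ger0_norm; lra.
Qed.

(** The box [D], shrunk by [r / 2] on each side, lies in the box [C] and in its translate by [h], so
    the two differ by at most twice the volume of [C] minus [D]. This is small because the volume
    [v] of the shrunk box is continuous in the shrinking parameter. *)
Lemma L1cont_ocbox a b : L1cont (\1_(ocbox a b) : V -> R).
Proof.
have m1 a' b' : measurable_fun setT (\1_(ocbox a' b') : V -> R).
  by apply: measurable_indic; exact: measurable_ocbox.
split; first exact: m1.
move=> e e0.
pose v r := \prod_(i < d) Num.max ((b i - r) - (a i + r)) 0.
have cv : v r @[r --> 0] --> v 0.
  apply: cvg_big => [|i _]; first exact: mul_continuous.
  have c : b i - r - (a i + r) @[r --> 0] --> b i - 0 - (a i + 0).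
    apply: cvgB; first by apply: cvgB => //; exact: cvg_cst.
    by apply: cvgD => //; exact: cvg_cst.
  exact: cvg_maxr0 c.
have e2 : 0 < e / 2 by rewrite divr_gt0.
move/cvgrPdist_le : cv => /(_ _ e2) /nbhs_ballP[r /= r0 H].
have {}H : v 0 - v (r / 2) <= e / 2.
  apply: le_trans (H (r / 2) _); first exact: ler_norm.
  by rewrite /ball /= sub0r normrN gtr0_norm ?divr_gt0// ltr_pdivrMr// ltr_pMr// ltr1n.
exists (r / 2); first by rewrite divr_gt0.
move=> h hr.
set C := ocbox a b; pose D := ocbox (fun i => a i + r / 2) (fun i => b i - r / 2).
have hi i : `|h ord0 i| <= r / 2.
  apply: le_trans hr; rewrite [leRHS]/Num.norm/= mx_normrE.
  by apply: (le_bigmax _ (fun i => `|h i.1 i.2|) (ord0, i)).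
have DC x : D x -> C x.
  move=> Dx i; have := Dx i; have := hi i; rewrite /= !in_itv /= ler_norml => /andP[? ?] /andP[? ?].
  by apply/andP; split; lra.
have DCh x : D x -> C (x - h).
  move=> Dx i; have := Dx i; have := hi i; rewrite /= !in_itv /= ler_norml !mxE => /andP[? ?] /andP[? ?].
  by apply/andP; split; lra.
(* Stated with sums on both sides, so that it follows from a pointwise inequality between
   nonnegative functions, without subtracting integrals. *)
have P : (trans_mod \1_C h + (L1norm \1_D + L1norm \1_D) <= L1norm \1_C + L1norm \1_C)%E.
  rewrite /trans_mod -[X in (_ <= X + _)%E](L1norm_shift h (m1 a b)).
  rewrite /L1norm -!ge0_integralD//; last first.
    all: try by move=> *; rewrite ?adde_ge0.
    all: try (apply: emeasurable_funD).
    all: try (apply: measurable_absE).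
    all: try (by exact: m1).
    all: try (by apply: measurable_shift; exact: m1).
    all: try (by apply: measurable_funB; [apply: measurable_shift|]; exact: m1).
  apply: ge0_le_integral => //.
    by move=> *; rewrite ?adde_ge0.
    all: try (do ?apply: emeasurable_funD).
    all: try (apply: measurable_absE).
    all: try (by exact: m1).
    all: try (by apply: measurable_shift; exact: m1).
    all: try (by apply: measurable_funB; [apply: measurable_shift|]; exact: m1).
  move=> x _; rewrite -!EFinD lee_fin !indicE.
  have [Dx|Dx] := boolP (x \in D).
    have -> : x \in C by apply/mem_set/DC/set_mem.
    have -> : x - h \in C by apply/mem_set/DCh/set_mem.
    by rewrite subrr normr0 add0r !normr1.
  by rewrite normr0 !addr0; case: (x \in C); case: (x - h \in C);
    rewrite /= ?subrr ?subr0 ?sub0r ?normrN ?normr1 ?normr0 ?addr0 ?add0r.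
have LE a' b' : L1norm \1_(ocbox a' b') = (\prod_(i < d) Num.max (b' i - a' i) 0)%:E.
  rewrite -lebesgue_ocbox -[X in lam X]setIT -integral_indic//; last exact: measurable_ocbox.
  by apply: eq_integral => x _; rewrite ger0_norm.
move: P; rewrite !LE -!EFinD => P.
move: P; rewrite -leeBrDr// -EFinB => /le_trans; apply; rewrite lee_fin.
move: H; rewrite /v.
under eq_bigr do rewrite subr0 addr0.
by move=> H; lra.
Qed.


Definition rayset : set (set R) :=
  [set A | A = setT \/ exists x : R, A = `]x, +oo[%classic].

Definition raybox : set (set V) := [set A : set V | exists B : 'I_d -> set R,
  (forall i, rayset (B i)) /\ A = [set x : V | forall i, B i (x ord0 i)]].

Lemma measurable_raybox A : raybox A -> measurable A.
Proof.
move=> [B [rB ->]]; apply: measurable_box => i.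
by have [->|[x ->]] := rB i.
Qed.

Lemma measurable_rVE : (measurable : set (set V)) = <<s raybox >>.
Proof.
apply/seteqP; split; last first.
  apply: smallest_sub; [exact: sigma_algebra_measurable|exact: measurable_raybox].
apply: smallest_sub; first exact: smallest_sigma_algebra.
rewrite -bigcup_seq; apply: bigcup_sub => i _ A [B mB <-]; rewrite setTI.
pose S := [set B : set R | <<s raybox >> ((fun x : V => x ord0 i) @^-1` B)].
suff : S B by [].
have sS : sigma_algebra setT S.
  have [s0 sC sU] := smallest_sigma_algebra (setT : set V) raybox.
  split; rewrite /S /=.
  - by rewrite preimage_set0.
  - move=> C SC; rewrite setTD preimage_setC -setTD; exact: sC.
  - by move=> F SF; rewrite preimage_bigcup; exact: sU.
have {}mB : (RGenOInfty.G (R:=R)).-sigma.-measurable B.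
  by rewrite -RGenOInfty.measurableE.
move: B mB.
apply: smallest_sub => // _ [x ->].
apply: sub_sigma_algebra.
exists (fun j => if j == i then `]x, +oo[%classic else setT); split.
  by move=> j; case: ifP => _; [right; exists x|left].
apply/seteqP; split => y /=.
  by move=> yx j; case: eqP => [->|].
by move=> /(_ i); rewrite eqxx.
Qed.

Lemma setI_closed_raybox : setI_closed raybox.
Proof.
move=> _ _ [B [rB ->]] [C [rC ->]]; exists (fun i => B i `&` C i); split.
  move=> i; have [->|[x ->]] := rB i; first by rewrite setTI; exact: rC.
  have [->|[y ->]] := rC i; first by rewrite setIT; right; exists x.
  right; exists (Num.max x y); apply/seteqP; split => z /=; rewrite !in_itv /= !andbT gt_max.
    by move=> [-> ->].
  by move=> /andP[].
apply/seteqP; split => x /=; first by move=> [h1 h2] i; split.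
by move=> h; split => i; have [] := h i.
Qed.

Definition cube (N : nat) : set V := ocbox (fun=> - N%:R) (fun=> N%:R).

Lemma raybox_cube A N : raybox A -> exists a b, A `&` cube N = ocbox a b.
Proof.
move=> [B [rB ->]].
exists (fun i => if pselect (exists x : R, B i = `]x, +oo[%classic) is left e then
   Num.max (projT1 (cid e)) (- N%:R) else - N%:R), (fun=> N%:R).
apply/seteqP; split => x /=.
  move=> [Bx cx] i; have := cx i; rewrite /= !in_itv /= => /andP[c1 c2].
  rewrite c2 andbT; case: pselect => // e.
  case: cid => y /= By; have := Bx i; rewrite By /= in_itv /= andbT => yx.
  by rewrite gt_max yx.
move=> h; split => i; have := h i; rewrite /= !in_itv /= => /andP[h1 h2].
  case: pselect h1 => [e|ne].
    case: cid => y /= By; rewrite gt_max => /andP[yx _].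
    by rewrite By /= in_itv /= andbT.
  by have [->//|/ne] := rB i.
rewrite h2 andbT; case: pselect h1 => // e.
by rewrite gt_max => /andP[].
Qed.

Lemma L1norm_indicD (A B : set V) : measurable A -> measurable B -> B `<=` A ->
  L1norm (fun x => \1_A x - \1_B x) = lam (A `\` B).
Proof.
move=> mA mB BA.
rewrite -[RHS]/(lam _) -[X in lam X]setIT -integral_indic//; last exact: measurableD.
apply: eq_integral => x _; congr EFin; rewrite !indicE in_setD.
have [xB|xB] := boolP (x \in B).
  by rewrite (mem_set (BA _ (set_mem xB))) subrr normr0.
by rewrite subr0 andbT; case: (x \in A); rewrite ?normr1 ?normr0.
Qed.

Lemma lebesgue_cube_lty A N : measurable A -> (lam (A `&` cube N) < +oo)%E.
Proof.
move=> mA; apply: (@le_lt_trans _ _ (lam (cube N))).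
  by apply: le_measure; rewrite ?inE//; [apply: measurableI => //|]; exact: measurable_ocbox.
by rewrite lebesgue_ocbox ltry.
Qed.

(** Dynkin's pi-lambda argument starting from [raybox]. The intersection with a cube keeps every
    measure finite and turns a ray box into a bounded box. *)
Lemma L1cont_indic_cube A N : measurable A -> L1cont (\1_(A `&` cube N) : V -> R).
Proof.
have mc : measurable (cube N) by exact: measurable_ocbox.
move=> mA; have mA' := mA; move: mA; rewrite measurable_rVE => sA; move: N mc.
pose P (A : set V) := forall N, measurable (cube N) -> L1cont (\1_(A `&` cube N) : V -> R).
suff : P A by [].
have GP : raybox `<=` P.
  move=> B rB N _; have [a [b ->]] := raybox_cube N rB; exact: L1cont_ocbox.
have PT : P setT.
  by apply: GP; exists (fun=> setT); split; [left|apply/seteqP; split].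
apply: (dynkin_induction measurable_rVE setI_closed_raybox PT GP _ _ sA).
  move=> B mB PB N mc.
  have -> : (\1_(~` B `&` cube N) : V -> R) = (fun x => \1_(setT `&` cube N) x + (-1) * \1_(B `&` cube N) x).
    apply/funext => x; rewrite !indicE !in_setI in_setC in_setT.
    by case: (x \in B); case: (x \in cube N); rewrite /= ?mulr0 ?mulr1 ?addr0 ?subrr.
  by apply: L1contD; [exact: PT|apply: L1contZ; exact: PB].
(* Countable disjoint unions: the indicator of a finite partial union is a sum of indicators, and by
   continuity of the measure from below the partial unions converge in L^1. *)
move=> F mF tF PF N mc.
pose U n := \big[setU/set0]_(k < n) F k `&` cube N.
have mFc k : measurable (F k `&` cube N) by exact: measurableI.
have mU n : measurable (U n).
  by apply: measurableI => //; exact: bigsetU_measurable.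
have cU n : L1cont (\1_(U n) : V -> R).
  elim: n => [|n IH].
    rewrite /U big_ord0 set0I.
    have -> : (\1_set0 : V -> R) = (fun x => 0 * \1_(setT `&` cube N) x).
      by apply/funext => x; rewrite indicE in_set0 mul0r.
    by apply: L1contZ; exact: PT.
  have -> : (\1_(U n.+1) : V -> R) = (fun x => \1_(U n) x + \1_(F n `&` cube N) x).
    apply/funext => x; rewrite /U big_ord_recr /= !indicE !in_setI in_setU.
    have [xF|_] := boolP (x \in F n); last by rewrite orbF addr0.
    rewrite orbT; suff -> : x \in \big[setU/set0]_(k < n) F k = false by rewrite add0r.
    apply/negbTE/negP => /set_mem; rewrite -bigcup_mkord => -[k /= kn Fk].
    have := tF _ _ Logic.I Logic.I (ex_intro _ x (conj Fk (set_mem xF))).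
    by move=> kn'; rewrite kn' ltnn in kn.
  by apply: L1contD => //; exact: PF.
set A' := \bigcup_k F k.
have mA2 : measurable A' by exact: bigcup_measurable.
have UA n : U n `<=` A' `&` cube N.
  by move=> x [] Ux cx; split => //; move: Ux; rewrite -bigcup_mkord => -[k _ Fk]; exists k.
apply: L1cont_lim; first by apply: measurable_indic; exact: measurableI.
move=> e e0.
have cvU : (lam \o U) n @[n --> \oo] --> lam (\bigcup_n U n).
  apply: nondecreasing_cvg_mu => //; first exact: bigcup_measurable.
  by move=> m n mn; apply/subsetPset; apply: setSI; exact: subset_bigsetU.
have UE : \bigcup_n U n = A' `&` cube N.
  apply/seteqP; split; first by apply: bigcup_sub => n _; exact: UA.
  move=> x [[k _ Fk] cx]; exists k.+1 => //; split => //.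
  by rewrite -bigcup_mkord; exists k => /=.
rewrite UE in cvU.
have fA : lam (A' `&` cube N) \is a fin_num.
  by rewrite ge0_fin_numE//; exact: lebesgue_cube_lty.
have := cvU; rewrite -(fineK fA) => /fine_cvgP[_ /cvgrPdist_le/(_ _ e0)[n _ /(_ n)]].
move=> /(_ (leqnn _)) /= H.
exists (\1_(U n)); first exact: cU.
rewrite L1norm_indicD//; last exact: measurableI.
have fU : lam (U n) \is a fin_num.
  rewrite ge0_fin_numE//; apply: le_lt_trans (lebesgue_cube_lty N mA2).
  by apply: le_measure; rewrite ?inE//; exact: measurableI.
rewrite measureD//; last 2 first.
- exact: measurableI.
- exact: lebesgue_cube_lty.
have G (p q : \bar R) : p \is a fin_num -> q \is a fin_num ->
    `|fine p - fine q| <= e -> (p - q <= e%:E)%E.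
  case: p => // p; case: q => // q _ _ /=; rewrite -EFinB lee_fin.
  exact/le_trans/ler_norm.
by rewrite (setIidr (UA n)); apply: G.
Qed.

End translation.

(** * Convolution with an approximate identity *)

Import HBNNSimple.


Lemma cvge0P (R : realType) (T : Type) (F : set_system T) (FF : Filter F)
  (u : T -> \bar R) : (forall x, 0 <= u x)%E ->
  (u x @[x --> F] --> 0%E) <->
  (forall e : R, 0 < e -> \forall x \near F, (u x <= e%:E)%E).
Proof.
move=> u0; split=> [/fine_cvgP[fu /cvgrPdist_le cu] e e0|H].
  have := cu e e0; move: fu; apply: filterS2 => x fx.
  by rewrite sub0r normrN ger0_norm ?fine_ge0//= -lee_fin fineK.
apply/fine_cvgP; split.
  have := H 1 ltr01; apply: filterS => x ux.
  by rewrite ge0_fin_numE//; apply: le_lt_trans ux _; rewrite ltry.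
apply/cvgrPdist_le => e e0; have := H e e0; apply: filterS => x ux.
rewrite sub0r normrN ger0_norm ?fine_ge0//= -lee_fin fineK//.
by rewrite ge0_fin_numE//; apply: le_lt_trans ux _; rewrite ltry.
Qed.

Section approximation.
Context {R : realType} {d : nat}.
Local Notation RR := (measurableTypeR R).
Local Notation lam := (lebesgue_rV d).
Local Notation V := 'rV[R]_d.
Implicit Types (f g : V -> R).

Lemma L1cont_sum (I : Type) (s : seq I) (F : I -> V -> R) :
  (forall i, L1cont (F i)) -> L1cont (fun x => \sum_(i <- s) F i x).
Proof.
move=> cF; elim: s => [|i s IH].
  under eq_fun do rewrite big_nil.
  have -> : (fun=> 0) = (fun x => 0 * \1_(setT `&` cube 0) x) :> (V -> R).
    by apply/funext => x; rewrite mul0r.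
  by apply: L1contZ; exact: L1cont_indic_cube.
under eq_fun do rewrite big_cons.
exact: L1contD.
Qed.

Lemma cube_near (x : V) : \forall n \near \oo, cube n x.
Proof.
near=> n => i /=; rewrite in_itv /=.
have xi : `|x ord0 i| <= `|x|.
  rewrite [leRHS]/Num.norm/= mx_normrE.
  by apply: (le_bigmax _ (fun i => `|x i.1 i.2|) (ord0, i)).
have xn : `|x| < n%:R by near: n; exact: nbhs_infty_gtr.
have := le_lt_trans xi xn; rewrite ltr_norml => /andP[-> /ltW ->] //.
Unshelve. all: by end_near.
Qed.

Lemma L1norm_integrable f : measurable_fun setT f -> (L1norm f < +oo)%E ->
  lam.-integrable setT (EFin \o f).
Proof. by move=> mf foo; apply/integrableP; split => //; exact/measurable_EFinP. Qed.

(** The approximating simple functions are truncated to growing cubes, which makes them finite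
    combinations of the indicators already treated; they converge in L^1 by domination by [f]
    itself. *)
Lemma ge0_L1cont f : measurable_fun setT f -> (forall x, 0 <= f x) ->
  (L1norm f < +oo)%E -> L1cont f.
Proof.
move=> mf f0 foo.
have mEf : measurable_fun setT (EFin \o f) by apply/measurable_EFinP.
have Ef0 x : setT x -> (0 <= (EFin \o f) x)%E by rewrite lee_fin.
pose s n := nnsfun_approx measurableT mEf n.
have cs x : (s n x)%:E @[n --> \oo] --> (f x)%:E.
  exact: (cvg_nnsfun_approx measurableT mEf Ef0 (x := x)).
have cs' x : s n x @[n --> \oo] --> f x by have /fine_cvgP[] := cs x.
have sf n x : s n x <= f x.
  rewrite -(cvg_lim (@Rhausdorff R) (cs' x)).
  apply: (@nondecreasing_cvgn_le _ (fun n => s n x)); last by apply/cvg_ex; exists (f x).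
  by move=> a b ab; have /lefP := nd_nnsfun_approx measurableT mEf ab; exact.
pose g n x : R := s n x * \1_(cube n) x.
have cg n : L1cont (g n).
  rewrite /g; under eq_fun do rewrite fimfunEord big_distrl /=.
  apply: L1cont_sum => i.
  under eq_fun do rewrite -mulrA.
  apply: L1contZ.
  have -> : (fun x => \1_(s n @^-1` [set (finmap.enum_fset (fset_set (range (s n))))`_i]) x * \1_(cube n) x) =
    \1_(s n @^-1` [set (finmap.enum_fset (fset_set (range (s n))))`_i] `&` cube n) :> (V -> R).
    by apply/funext => x; rewrite !indicE in_setI; case: (x \in _ @^-1` _); case: (x \in cube n); rewrite ?mulr0 ?mulr1.
  by apply: L1cont_indic_cube.
have g0 n x : 0 <= g n x by rewrite mulr_ge0.
have gf n x : g n x <= f x.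
  by apply: le_trans (sf n x); rewrite ler_piMr// indicE; case: (_ \in _).
have cvg_g x : g n x @[n --> \oo] --> f x.
  apply: cvg_trans (cs' x); apply: near_eq_cvg.
  have := cube_near x; apply: filterS => n cx.
  by rewrite /g indicE mem_set// mulr1.
apply: L1cont_lim => // e e0.
have ifoo : lam.-integrable setT (EFin \o f).
  exact: L1norm_integrable.
have [] := @dominated_convergence _ _ _ lam setT measurableT (fun n => EFin \o g n) (EFin \o f) (EFin \o f) _ mEf _ ifoo _.
- by move=> n; apply/measurable_EFinP; exact: (cg n).1.
- apply: aeW => x _; apply: cvg_EFin; [exact: nearW|exact: cvg_g].
- by apply: aeW => x n _ /=; rewrite lee_fin ger0_norm.
move=> _ + _ => /fine_cvgP[fn] /cvgrPdist_le/(_ _ e0) cg0.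
near \oo => n.
exists (g n) => //.
have : (\int[lam]_x `|((EFin \o g n) x - (EFin \o f) x)%E|)%E \is a fin_num by near: n.
have : `|0 - fine (\int[lam]_x `|((EFin \o g n) x - (EFin \o f) x)%E|)%E| <= e by near: n.
rewrite sub0r normrN => /(le_trans (ler_norm _)) H /fineK fK.
rewrite -lee_fin fK in H; apply: le_trans H.
apply: ge0_le_integral => //.
- by apply: measurable_absE; apply: measurable_funB => //; exact: (cg n).1.
- apply: measurableT_comp => //; apply: emeasurable_funB => //.
  by apply/measurable_EFinP; exact: (cg n).1.
- by move=> x _ /=; rewrite lee_fin distrC.
Unshelve. all: by end_near.
Qed.

Lemma L1cont_integrable f : measurable_fun setT f -> (L1norm f < +oo)%E -> L1cont f.
Proof.
move=> mf foo.
have H (s : R) : `|s| = 1 -> L1cont (fun x => Num.max (s * f x) 0).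
  move=> s1.
  have ms : measurable_fun setT (fun x => Num.max (s * f x) 0).
    by apply: measurable_maxr => //; exact: measurable_funM.
  apply: ge0_L1cont => //; first by move=> x; rewrite le_max lexx orbT.
  apply: le_lt_trans foo; apply: ge0_le_integral => //; try exact: measurable_absE.
  move=> x _; rewrite lee_fin ger0_norm ?le_max ?lexx ?orbT// ge_max normr_ge0 andbT.
  by apply: le_trans (ler_norm _) _; rewrite normrM s1 mul1r.
have -> : f = (fun x => Num.max (1 * f x) 0 + (-1) * Num.max (-1 * f x) 0).
  apply/funext => x; rewrite mul1r !mulN1r /Num.max.
  by case: ifPn; case: ifPn; lra.
by apply: L1contD; [|apply: L1contZ]; apply: H; rewrite ?normrN normr1.
Qed.

(** * Mollification by a bounded probability density, used both for [eta] and for the Gaussian *)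

Section kernel.
Variables (k : V -> R) (B : R).
Hypotheses (mk : measurable_fun setT k) (k0 : forall x, 0 <= k x)
  (kB : forall x, k x <= B) (k1 : (\int[lam]_x (k x)%:E = 1)%E).

Lemma measurable_eta_ eps : measurable_fun setT (eta_ k eps).
Proof.
by apply: measurable_funM => //; apply: (measurableT_comp mk); exact: measurable_rVZ.
Qed.

Lemma measurable_eta_sub dT (T : measurableType dT) eps (f g : T -> V) :
  measurable_fun setT f -> measurable_fun setT g ->
  measurable_fun setT (fun t => eta_ k eps (f t - g t)).
Proof.
move=> mf mg; apply: (measurableT_comp (measurable_eta_ eps)).
by apply: measurable_rVD => //; exact: measurable_rVN.
Qed.

Lemma eta_ge0 eps x : 0 < eps -> 0 <= eta_ k eps x.
Proof. by move=> e0; rewrite mulr_ge0// invr_ge0 exprn_ge0// ltW. Qed.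

Lemma eta_le eps x : 0 < eps -> eta_ k eps x <= eps ^- d * B.
Proof. by move=> e0; apply: ler_wpM2l => //; rewrite invr_ge0 exprn_ge0// ltW. Qed.

Lemma integral_eta_subst eps x (F : V -> \bar R) : 0 < eps ->
  measurable_fun setT F -> (forall x, 0 <= F x)%E ->
  (\int[lam]_y (F y * (eta_ k eps (x - y))%:E) =
   \int[lam]_h (F (x - eps *: h)%R * (k h)%:E))%E.
Proof.
move=> e0 mF F0.
have mFx : measurable_fun setT (fun h : V => F (x - eps *: h)).
  apply: (measurableT_comp mF); apply: measurable_rVD => //; apply: measurable_rVN; exact: measurable_rVZ.
rewrite (@ge0_integral_affine _ _ x (- eps)); last 3 first.
- by rewrite oppr_eq0 gt_eqF.
- by apply: emeasurable_funM => //; apply/measurable_EFinP; exact: measurable_eta_sub.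
- by move=> y; rewrite mule_ge0// lee_fin eta_ge0.
rewrite normrN gtr0_norm// -ge0_integralZl//; last 3 first.
- apply: emeasurable_funM; last first.
    apply/measurable_EFinP; apply: measurable_eta_sub => //.
    by apply: measurable_rVD => //; exact: measurable_rVZ.
  apply: (measurableT_comp mF); apply: measurable_rVD => //; exact: measurable_rVZ.
- by move=> y _; rewrite mule_ge0// lee_fin eta_ge0.
- by rewrite lee_fin exprn_ge0// ltW.
apply: eq_integral => h _; rewrite muleCA scaleNr -EFinM.
congr (_ * (_)%:E)%E; rewrite /eta_ opprB addrC subrK scalerA mulVf ?gt_eqF// scale1r.
by rewrite mulrA divff ?mul1r// gt_eqF// exprn_gt0.
Qed.

Lemma kernel_mass eps x : 0 < eps -> (\int[lam]_y (eta_ k eps (x - y))%:E = 1)%E.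
Proof.
move=> e0; have := @integral_eta_subst eps x (cst 1%E) e0 (measurable_cst _) (fun=> lee01).
under eq_integral do rewrite mul1e.
by move=> ->; under eq_integral do rewrite mul1e.
Qed.

Lemma integrable_conv f eps x : 0 < eps -> measurable_fun setT f -> (L1norm f < +oo)%E ->
  lam.-integrable setT (fun y => (f y * eta_ k eps (x - y))%:E).
Proof.
move=> e0 mf foo; have mfk : measurable_fun setT (fun y => f y * eta_ k eps (x - y)).
  by apply: measurable_funM => //; exact: measurable_eta_sub.
apply/integrableP; split; first exact/measurable_EFinP.
have B0 : 0 <= B by exact: le_trans (k0 0) (kB 0).
apply: (@le_lt_trans _ _ (\int[lam]_y ((eps ^- d * B)%:E * `|f y|%:E))%E).
  apply: ge0_le_integral => //; first exact: measurable_absE.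
    by apply: emeasurable_funM => //; exact: measurable_absE.
  move=> y _; rewrite -EFinM lee_fin normrM mulrC (ger0_norm (eta_ge0 _ e0)).
  by apply: ler_wpM2r => //; exact: eta_le.
rewrite ge0_integralZl//; last 2 first.
- exact: measurable_absE.
- by rewrite lee_fin mulr_ge0// invr_ge0 exprn_ge0// ltW.
by rewrite lte_mul_pinfty// lee_fin mulr_ge0// invr_ge0 exprn_ge0// ltW.
Qed.

(** As the kernel has mass one, [f x] can be brought under the integral sign. *)
Lemma conv_dist f eps x : 0 < eps -> measurable_fun setT f -> (L1norm f < +oo)%E ->
  (`|convolution f (eta_ k eps) x - f x|%:E <=
   \int[lam]_h (`|f (x - eps *: h) - f x|%:E * (k h)%:E))%E.
Proof.
move=> e0 mf foo.
have ic := integrable_conv x e0 mf foo.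
have mK : measurable_fun setT (fun y : V => eta_ k eps (x - y)) by exact: measurable_eta_sub.
have iK : lam.-integrable setT (fun y => (eta_ k eps (x - y))%:E).
  apply/integrableP; split; first exact/measurable_EFinP.
  under eq_integral => y _ do rewrite gee0_abs ?lee_fin ?eta_ge0//.
  by rewrite kernel_mass// ltry.
have iK2 : lam.-integrable setT (fun y => (f x)%:E * (eta_ k eps (x - y))%:E)%E.
  exact: integrableZl.
have E : (convolution f (eta_ k eps) x - f x)%:E = 
    (\int[lam]_y ((f y - f x) * eta_ k eps (x - y))%:E)%E.
  under eq_integral do rewrite mulrBl EFinB.
  rewrite integralB//.
  rewrite EFinB; congr (_ - _)%E.
    by rewrite /convolution /Rintegral fineK//; exact: integrable_fin_num ic.
  under eq_integral do rewrite EFinM.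
  by rewrite integralZl// kernel_mass// mule1.
rewrite -abse_EFin E.
apply: (le_trans (le_abse_integral _ _ _)) => //.
  by apply/measurable_EFinP; apply: measurable_funM => //; exact: measurable_funB.
rewrite -(@integral_eta_subst eps x (fun y => `|f y - f x|%:E))//; last first.
  by apply: measurable_absE; exact: measurable_funB.
rewrite le_eqVlt; apply/orP; left; apply/eqP.
by apply: eq_integral => y _; rewrite abse_EFin normrM EFinM (ger0_norm (eta_ge0 _ e0)).
Qed.

Lemma measurable_conv f eps : measurable_fun setT f ->
  measurable_fun setT (convolution f (eta_ k eps)).
Proof.
move=> mf.
apply: (@measurable_Rintegral_rV _ _ _ _ (fun z : V * V => f z.2 * eta_ k eps (z.1 - z.2))).
apply: measurable_funM; first exact: (measurableT_comp mf).
exact: measurable_eta_sub.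
Qed.

Lemma conv_ub f eps x (M : R) : 0 < eps -> 0 <= M -> measurable_fun setT f -> (L1norm f < +oo)%E ->
  {ae lam, forall y, `|f y| <= M} -> `|convolution f (eta_ k eps) x| <= M.
Proof.
move=> e0 M0 mf foo fM.
have ic := integrable_conv x e0 mf foo.
rewrite -lee_fin -abse_EFin {1}/convolution /Rintegral fineK; last exact: integrable_fin_num ic.
apply: (le_trans (le_abse_integral _ _ _)) => //.
  by apply/measurable_EFinP; apply: measurable_funM => //; exact: measurable_eta_sub.
have mK : measurable_fun setT (fun y : V => (eta_ k eps (x - y))%:E).
  by apply/measurable_EFinP; exact: measurable_eta_sub.
apply: (@le_trans _ _ (\int[lam]_y (M%:E * (eta_ k eps (x - y))%:E))%E).
  apply: ae_ge0_le_integral => //.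
  - apply: measurableT_comp => //; apply/measurable_EFinP.
    by apply: measurable_funM => //; exact: measurable_eta_sub.
  - by move=> y _; rewrite mule_ge0// lee_fin ?eta_ge0.
  - exact: emeasurable_funM.
  move: fM; apply: filterS => y fy _.
  by rewrite -EFinM /= lee_fin normrM (ger0_norm (eta_ge0 _ e0)) ler_wpM2r// eta_ge0.
rewrite ge0_integralZl//; last by move=> y _; rewrite lee_fin eta_ge0.
by rewrite kernel_mass// mule1.
Qed.

Lemma measurable_mul_trans_mod f eps : measurable_fun setT f ->
  measurable_fun setT (fun h => (k h)%:E * trans_mod f (eps *: h))%E.
Proof.
move=> mf; apply: emeasurable_funM; first exact/measurable_EFinP.
rewrite /trans_mod /L1norm.
apply: (@measurable_fun_fubini_tonelli_G _ _ _ _ _ lam (fun z : V * V => `|f (z.1 - eps *: z.2) - f z.1|%:E)) => //.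
apply/measurable_EFinP; apply: measurableT_comp => //.
apply: measurable_funB; last exact: (measurableT_comp mf).
apply: (measurableT_comp mf); apply: measurable_rVD => //; apply: measurable_rVN.
exact: measurable_rVZ.
Qed.

(** Minkowski's integral inequality for L^1: integrate [conv_dist] in x and exchange the
    integrals. *)
Lemma conv_L1_dist f eps : 0 < eps -> measurable_fun setT f -> (L1norm f < +oo)%E ->
  (L1norm (fun x => convolution f (eta_ k eps) x - f x)%R <=
   \int[lam]_h ((k h)%:E * trans_mod f (eps *: h)))%E.
Proof.
move=> e0 mf foo.
have mfsub : measurable_fun setT (fun z : V * V => f (z.1 - eps *: z.2) - f z.1).
  apply: measurable_funB; last exact: (measurableT_comp mf).
  apply: (measurableT_comp mf); apply: measurable_rVD => //; apply: measurable_rVN.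
  exact: measurable_rVZ.
have mfk : measurable_fun setT
    (fun z : V * V => `|f (z.1 - eps *: z.2) - f z.1|%:E * (k z.2)%:E)%E.
  apply: emeasurable_funM; apply/measurable_EFinP; first exact: measurableT_comp.
  exact: (measurableT_comp mk).
have F0 (z : V * V) : (0 <= `|f (z.1 - eps *: z.2) - f z.1|%:E * (k z.2)%:E)%E.
  by rewrite mule_ge0// lee_fin.
have <- : (\int[lam]_x \int[lam]_h (`|f (x - eps *: h) - f x|%:E * (k h)%:E) =
    \int[lam]_h ((k h)%:E * trans_mod f (eps *: h)))%E.
  rewrite (@fubini_tonelli _ _ _ _ _ lam lam _ mfk)//.
  apply: eq_integral => h _; rewrite muleC /= ge0_integralZr//; last by rewrite lee_fin.
  apply: measurable_absE.
  by apply: measurable_funB => //; exact: measurable_shift.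
apply: ge0_le_integral => //.
- by apply: measurable_absE; apply: measurable_funB => //; exact: measurable_conv.
- exact: (@measurable_fun_fubini_tonelli_F _ _ _ _ _ lam _ mfk F0).
- by move=> x _; exact: conv_dist.
Qed.

Lemma conv_L1_le f eps : 0 < eps -> measurable_fun setT f -> (L1norm f < +oo)%E ->
  (L1norm (fun x => convolution f (eta_ k eps) x - f x)%R <= L1norm f + L1norm f)%E.
Proof.
move=> e0 mf foo; apply: le_trans (conv_L1_dist e0 mf foo) _.
have Nf : (L1norm f + L1norm f)%E \is a fin_num.
  by rewrite ge0_fin_numE; [exact: lte_add_pinfty|rewrite adde_ge0// L1norm_ge0].
apply: (@le_trans _ _ (\int[lam]_h ((L1norm f + L1norm f) * (k h)%:E))%E).
  apply: ge0_le_integral => //.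
  - by move=> h _; rewrite mule_ge0// ?lee_fin// L1norm_ge0.
  - exact: measurable_mul_trans_mod.
  - by apply: measurable_funeM; exact/measurable_EFinP.
  move=> h _; rewrite muleC; apply: lee_wpmul2r; rewrite ?lee_fin//.
  exact: trans_mod_le.
rewrite -(fineK Nf) ge0_integralZl//; last 3 first.
- exact/measurable_EFinP.
- by move=> h _; rewrite lee_fin.
- by rewrite fineK// adde_ge0// L1norm_ge0.
by rewrite k1 mule1.
Qed.

(** Dominated convergence in the variable h of [conv_L1_dist]: the integrand tends to 0 by
    continuity of translations and is at most [k h] times twice the L^1 norm of [f]. *)
Lemma approx_identity f (e_ : R^nat) : measurable_fun setT f -> (L1norm f < +oo)%E ->
  (forall n, 0 < e_ n) -> e_ n @[n --> \oo] --> 0 ->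
  L1norm (fun x => convolution f (eta_ k (e_ n)) x - f x) @[n --> \oo] --> 0%E.
Proof.
move=> mf foo e0 ce.
have [_ fc] := L1cont_integrable mf foo.
pose w n h := ((k h)%:E * trans_mod f (e_ n *: h))%E.
have mw n : measurable_fun setT (w n) by exact: measurable_mul_trans_mod.
have le n : (L1norm (fun x => convolution f (eta_ k (e_ n)) x - f x)%R <= \int[lam]_h w n h)%E.
  exact: conv_L1_dist.
have tm_ge0 h : (0 <= trans_mod f h)%E by exact: L1norm_ge0.
have tmf h : trans_mod f h \is a fin_num.
  rewrite ge0_fin_numE//; apply: (le_lt_trans (trans_mod_le _ mf)).
  by rewrite lte_add_pinfty.
have ct h : trans_mod f (e_ n *: h) @[n --> \oo] --> 0%E.
  apply/cvge0P => // e e1.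
  have [r r0 H] := fc e e1.
  have ceh : e_ n * `|h| @[n --> \oo] --> 0 * `|h| by apply: cvgMl.
  rewrite mul0r in ceh; move/cvgrPdist_le : ceh => /(_ r r0).
  apply: filterS => n; rewrite sub0r normrN => nr; apply: H.
  by rewrite normrZ; apply: le_trans nr; rewrite normrM normr_id.
have cw h : w n h @[n --> \oo] --> 0%E.
  rewrite -[X in _ --> X](mule0 (k h)%:E); exact: cvgeZl.
have N0 : (0 <= L1norm f + L1norm f)%E by rewrite adde_ge0// L1norm_ge0.
have Nf : (L1norm f + L1norm f)%E \is a fin_num.
  by rewrite ge0_fin_numE// lte_add_pinfty.
have ik : lam.-integrable setT (EFin \o k).
  apply/integrableP; split; first exact/measurable_EFinP.
  under eq_integral => y _ do rewrite gee0_abs ?lee_fin//.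
  by rewrite k1 ltry.
have ig : lam.-integrable setT (fun h => (fine (L1norm f + L1norm f))%:E * (k h)%:E)%E.
  exact: integrableZl.
have [] := @dominated_convergence _ _ _ lam setT measurableT w (cst 0%E) _ mw (measurable_cst _) _ ig _.
- by apply: aeW => x _; exact: cw.
- apply: aeW => x n _ /=; rewrite gee0_abs ?mule_ge0 ?lee_fin// fineK// muleC.
  by apply: lee_wpmul2l; [rewrite lee_fin|exact: trans_mod_le].
move=> _ _; rewrite integral_cst// mul0e => c0.
apply/cvge0P; first by move=> n; exact: L1norm_ge0.
move=> e e1.
have wge n : (0 <= \int[lam]_h w n h)%E by apply: integral_ge0 => h _; rewrite mule_ge0// lee_fin.
have [n0 _ Hn] := (cvge0P _ wge).1 c0 e e1.
by exists n0 => // n /= nn0; apply: (le_trans (le n)); exact: Hn.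
Qed.

(** The excess of [|f|] over [M] is at most the distance from [f] to its mollification, which tends
    to 0 in L^1. Used with the Gaussian to let [delta] tend to 0 in the mild identity. *)
Lemma conv_criterion f (e_ : R^nat) (M : R) : measurable_fun setT f -> (L1norm f < +oo)%E ->
  (forall n, 0 < e_ n) -> e_ n @[n --> \oo] --> 0 ->
  (forall n x, `|convolution f (eta_ k (e_ n)) x| <= M) ->
  {ae lam, forall x, `|f x| <= M}.
Proof.
move=> mf foo e0 ce H.
pose g x := Num.max (`|f x| - M) 0.
have mg : measurable_fun setT g.
  by apply: measurable_maxr => //; apply: measurable_funB => //; exact: measurableT_comp.
have ga x : `|g x| = g x by rewrite ger0_norm// le_max lexx orbT.
have I0 : (\int[lam]_x `|(g x)%:E| = 0)%E.
  apply/eqP; rewrite eq_le integral_ge0// andbT.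
  apply/lee_addgt0Pr => e e1; rewrite add0e.
  have := approx_identity mf foo e0 ce.
  move=> /cvge0P => /(_ (fun n => L1norm_ge0 _) e e1)[n _ /(_ n (leqnn n))].
  apply: le_trans; apply: ge0_le_integral => //.
  - by apply: measurableT_comp => //; exact/measurable_EFinP.
  - by apply: measurable_absE; apply: measurable_funB => //; exact: measurable_conv.
  move=> x _; rewrite abse_EFin ga lee_fin ge_max normr_ge0 andbT lerBlDl.
  have -> : f x = convolution f (eta_ k (e_ n)) x - (convolution f (eta_ k (e_ n)) x - f x) by rewrite subKr.
  apply: le_trans (ler_normB _ _) _; rewrite subKr.
  by rewrite lerD2r; exact: H.
have mEg : measurable_fun setT (fun x => (g x)%:E) by exact/measurable_EFinP.
have /(_ I0) := (ae_eq_integral_abs lam measurableT mEg).1.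
apply: filterS => x /(_ Logic.I) [gx].
by rewrite -subr_le0 -gx le_max lexx.
Qed.
End kernel.
End approximation.

(** * A calculus of smooth functions *)

Section smooth_calculus.
Context {R : realType} {V : normedModType R}.
Implicit Types (f g : V -> R) (U : set V) (v x : V).

Lemma near_eq_differentiable (W : normedModType R) (f g : V -> W) x :
  (\near x, f x = g x) -> differentiable f x -> differentiable g x.
Proof.
move=> fg df; have fgx : f x = g x by exact: nbhs_singleton fg.
have H : g \o shift x = cst (g x) + 'd f x +o_ (0 : V) id.
  move/diff_locallyP : (df) => [_ /eqaddoP Hf].
  apply/eqaddoP => e e0; have := Hf e e0.
  have : \forall y \near (0 : V), f (y + x) = g (y + x).
    by move: fg; rewrite (near_shift 0) /= subr0.
  apply: filterS2 => y fgy.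
  by rewrite -![(_ - _) y]/(_ y - _ y) -![(_ + _) y]/(_ y + _ y) /= -fgy -fgx.
apply/diff_locallyP; rewrite (diff_unique (diff_continuous df) H); split => //.
exact: diff_continuous.
Qed.

(** Differentiability and the value of the derivative are bundled, so that one application of the
    rules below yields both. *)
Definition hasD f x v (l : R) := differentiable f x /\ 'D_v f x = l.

Lemma hasD_near f g x v l : (\near x, f x = g x) -> hasD f x v l -> hasD g x v l.
Proof.
move=> fg [df dl]; split; first exact: near_eq_differentiable fg df.
rewrite -dl; case: (pselect (v = 0)) => [->|/eqP v0].
  by rewrite !derive0.
by apply/esym/near_eq_derive.
Qed.

Lemma hasD_cst (c : R) x v : hasD (fun=> c) x v 0.
Proof. by split; [exact: differentiable_cst|exact: derive_cst]. Qed.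

Lemma hasDD f g x v a b : hasD f x v a -> hasD g x v b ->
  hasD (fun x => f x + g x) x v (a + b).
Proof.
move=> [df <-] [dg <-]; split; first exact: differentiableD.
by apply: deriveD; exact: diff_derivable.
Qed.

Lemma hasDM f g x v a b : hasD f x v a -> hasD g x v b ->
  hasD (fun x => f x * g x) x v (a * g x + f x * b).
Proof.
move=> [df <-] [dg <-]; split; first exact: differentiableM.
rewrite [LHS]deriveM; [|exact: diff_derivable|exact: diff_derivable].
by rewrite addrC mulrC.
Qed.

Lemma hasDZ (c : R) f x v a : hasD f x v a -> hasD (fun x => c * f x) x v (c * a).
Proof. by move=> Df; have := hasDM (hasD_cst c x v) Df; rewrite mul0r add0r. Qed.

Lemma hasD_sum (I : Type) (s : seq I) (F : I -> V -> R) (a : I -> R) x v :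
  (forall i, hasD (F i) x v (a i)) ->
  hasD (fun x => \sum_(i <- s) F i x) x v (\sum_(i <- s) a i).
Proof.
move=> H; elim: s => [|i s IH].
  under eq_fun do rewrite big_nil.
  by rewrite big_nil; exact: hasD_cst.
under eq_fun do rewrite big_cons.
by rewrite big_cons; exact: hasDD.
Qed.

Lemma hasD_comp1 (g : R -> R) (g' : R) f x v a :
  is_derive (f x) 1 g g' -> hasD f x v a -> hasD (fun x => g (f x)) x v (g' * a).
Proof.
move=> [dg <-] [df <-].
have Dg : differentiable g (f x) by apply/derivable1_diffP.
split; first exact: differentiable_comp.
rewrite deriveE; last exact: differentiable_comp.
rewrite [in LHS](_ : (fun x => g (f x)) = g \o f)// diff_comp//=.
rewrite deriv1E// -deriveE// derive1E mulrC.
by [].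
Qed.

Lemma hasD_lin (L : {linear V -> R}) x v : continuous L -> hasD L x v (L v).
Proof.
move=> cL; split; first exact: linear_differentiable.
by rewrite deriveE; [rewrite diff_lin|exact: linear_differentiable].
Qed.

(** A graded and local form of [smooth]. The index [n] makes induction possible, and the restriction
    to [U] is needed because the backward Gaussian is smooth only before its pole. *)
Fixpoint snear (n : nat) U f : Prop :=
  (forall x, U x -> differentiable f x) /\
  if n is n'.+1 then forall v, snear n' U ('D_v f) else True.

Lemma snear_diff n U f x : snear n U f -> U x -> differentiable f x.
Proof. by case: n => [|n] [H _]; exact: H. Qed.

Lemma snear_hasD n U f x v : snear n U f -> U x -> hasD f x v ('D_v f x).
Proof. by move=> sf Ux; split => //; exact: snear_diff sf Ux. Qed.

Lemma snearW n U f : snear n.+1 U f -> snear n U f.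
Proof.
elim: n f => [|n IH] f; first by case.
by move=> [df sf]; split => // v; apply: IH; exact: sf.
Qed.

Lemma snear_ext n U f g : open U -> (forall x, U x -> f x = g x) ->
  snear n U f -> snear n U g.
Proof.
move=> oU; elim: n f g => [|n IH] f g fg.
  move=> [df _]; split => // x Ux; apply: near_eq_differentiable (df x Ux).
  by have := open_nbhs_nbhs (conj oU Ux); apply: filterS => y /fg.
move=> [df sf]; split.
  move=> x Ux; apply: near_eq_differentiable (df x Ux).
  by have := open_nbhs_nbhs (conj oU Ux); apply: filterS => y /fg.
move=> v; apply: IH (sf v) => x Ux.
have fgx : \near x, f x = g x.
  by have := open_nbhs_nbhs (conj oU Ux); apply: filterS => y /fg.
by have [_ ->] := hasD_near fgx (conj (df x Ux) (erefl ('D_v f x))).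
Qed.

(** It suffices to exhibit a formula for the directional derivatives and to show that the formula
    has one degree of smoothness less; the closure properties are inductions built on this. *)
Lemma snear_step n U f (F : V -> V -> R) : open U ->
  (forall x v, U x -> hasD f x v (F v x)) -> (forall v, snear n U (F v)) ->
  snear n.+1 U f.
Proof.
move=> oU Hf sF; split; first by move=> x Ux; have [] := Hf x 0 Ux.
by move=> v; apply: (snear_ext oU _ (sF v)) => x Ux; have [_ ->] := Hf x v Ux.
Qed.

Lemma snear0 U f (F : V -> V -> R) :
  (forall x v, U x -> hasD f x v (F v x)) -> snear 0 U f.
Proof. by move=> Hf; split => // x Ux; have [] := Hf x 0 Ux. Qed.

Lemma snear_cst n U c : open U -> snear n U (fun=> c).
Proof.
move=> oU; elim: n c => [|n IH] c.
  by apply: (@snear0 _ _ (fun _ _ => 0)) => x v _; exact: hasD_cst.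
by apply: (@snear_step _ _ _ (fun _ _ => 0)) => // x v _; exact: hasD_cst.
Qed.

Lemma snearD n U f g : open U -> snear n U f -> snear n U g ->
  snear n U (fun x => f x + g x).
Proof.
move=> oU; elim: n f g => [|n IH] f g sf sg.
  apply: (@snear0 _ _ (fun v x => 'D_v f x + 'D_v g x)) => x v Ux.
  by apply: hasDD; [exact: snear_hasD sf Ux|exact: snear_hasD sg Ux].
apply: (@snear_step _ _ _ (fun v x => 'D_v f x + 'D_v g x)) => // [x v Ux|v].
  by apply: hasDD; [exact: snear_hasD sf Ux|exact: snear_hasD sg Ux].
by apply: IH; [exact: sf.2|exact: sg.2].
Qed.

Lemma snearM n U f g : open U -> snear n U f -> snear n U g ->
  snear n U (fun x => f x * g x).
Proof.
move=> oU; elim: n f g => [|n IH] f g sf sg.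
  apply: (@snear0 _ _ (fun v x => 'D_v f x * g x + f x * 'D_v g x)) => x v Ux.
  by apply: hasDM; [exact: snear_hasD sf Ux|exact: snear_hasD sg Ux].
apply: (@snear_step _ _ _ (fun v x => 'D_v f x * g x + f x * 'D_v g x)) => // [x v Ux|v].
  by apply: hasDM; [exact: snear_hasD sf Ux|exact: snear_hasD sg Ux].
by apply: snearD => //; apply: IH; first [exact: sf.2|exact: sg.2|exact: snearW].
Qed.

Lemma snear_sum n U (I : Type) (s : seq I) (F : I -> V -> R) : open U ->
  (forall i, snear n U (F i)) -> snear n U (fun x => \sum_(i <- s) F i x).
Proof.
move=> oU H; elim: s => [|i s IH].
  by under eq_fun do rewrite big_nil; exact: snear_cst.
by under eq_fun do rewrite big_cons; exact: snearD.
Qed.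

Lemma snear_exp n U f : open U -> snear n U f -> snear n U (fun x => expR (f x)).
Proof.
move=> oU; elim: n f => [|n IH] f sf.
  apply: (@snear0 _ _ (fun v x => expR (f x) * 'D_v f x)) => x v Ux.
  by apply: hasD_comp1; exact: snear_hasD sf Ux.
apply: (@snear_step _ _ _ (fun v x => expR (f x) * 'D_v f x)) => // [x v Ux|v].
  by apply: hasD_comp1; exact: snear_hasD sf Ux.
by apply: snearM => //; [apply: IH; exact: snearW|exact: sf.2].
Qed.

Lemma is_derive_inv (y : R) : y != 0 -> is_derive y 1 (@GRing.inv R) (- 1 * (y^-1 * y^-1)).
Proof.
move=> y0; have := @is_deriveV R id y 1 1 y0 (is_derive_id _ _).
have -> : - (id y) ^- 2 *: 1 = - 1 * (y^-1 * y^-1) :> R.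
  by rewrite mulN1r -exprVn expr2 /GRing.scale /= mulr1.
by [].
Qed.

Lemma snear_inv n U f : open U -> (forall x, U x -> f x != 0) -> snear n U f ->
  snear n U (fun x => (f x)^-1).
Proof.
move=> oU f0; elim: n f f0 => [|n IH] f f0 sf.
  apply: (@snear0 _ _ (fun v x => (- 1 * ((f x)^-1 * (f x)^-1)) * 'D_v f x)) => x v Ux.
  apply: (@hasD_comp1 (@GRing.inv _)); last exact: snear_hasD sf Ux.
  exact/is_derive_inv/f0.
apply: (@snear_step _ _ _ (fun v x => (- 1) * ((f x)^-1 * (f x)^-1) * 'D_v f x)) => // [x v Ux|v].
  apply: (@hasD_comp1 (@GRing.inv _)); last exact: snear_hasD sf Ux.
  exact/is_derive_inv/f0.
apply: snearM => //; last exact: sf.2.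
apply: snearM => //; first exact: snear_cst.
by apply: snearM => //; apply: IH => //; exact: snearW.
Qed.

Lemma snear_ln n U f : open U -> (forall x, U x -> 0 < f x) -> snear n U f ->
  snear n U (fun x => ln (f x)).
Proof.
move=> oU f0 sf.
have H x v : U x -> hasD (fun x => ln (f x)) x v ((f x)^-1 * 'D_v f x).
  move=> Ux; apply: hasD_comp1; last exact: snear_hasD sf Ux.
  by apply: is_derive1_ln; exact: f0.
case: n sf H => [|n] sf H.
  by apply: (@snear0 _ _ (fun v x => (f x)^-1 * 'D_v f x)).
apply: (@snear_step _ _ _ (fun v x => (f x)^-1 * 'D_v f x)) => // v.
apply: snearM => //; last exact: sf.2.
by apply: snear_inv => //; [move=> x /f0 /gt_eqF ->|exact: snearW].
Qed.

Lemma snear_lin n U (L : {linear V -> R}) : open U -> continuous L -> snear n U L.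
Proof.
move=> oU cL; case: n => [|n].
  by apply: (@snear0 _ _ (fun v _ => L v)) => x v _; exact: hasD_lin.
apply: (@snear_step _ _ _ (fun v _ => L v)) => // [x v _|v]; first exact: hasD_lin.
exact: snear_cst.
Qed.

Lemma snearU n U U' f : snear n U f -> snear n U' f -> snear n (U `|` U') f.
Proof.
elim: n f => [|n IH] f [df sf] [df' sf']; split => //.
- by move=> x [/df|/df'].
- by move=> x [/df|/df'].
by move=> v; exact: (IH _ (sf v) (sf' v)).
Qed.

Lemma smoothP f : smooth f <-> forall n, snear n setT f.
Proof.
split=> [sf n|sf vs].
  elim: n f sf => [|n IH] f sf; split => //; try by move=> x _; exact: (sf [::]).
  (* In [smooth], [foldr] takes the last direction of the list as the first derivative, whereas
     [snear] peels off the first derivative first; hence [rcons]. *)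
  by move=> v; apply: IH => vs x; have := sf (rcons vs v) x; rewrite foldr_rcons.
elim/last_ind: vs f sf => [|vs v IH] f sf x; first exact: snear_diff (sf 0%N) _.
by rewrite foldr_rcons; apply: IH => n; exact: (sf n.+1).2.
Qed.

End smooth_calculus.


Section affine.
Context {R : realType} {V W : normedModType R}.

Lemma hasD_affine (f : W -> R) (L : {linear V -> W}) (a : W) x v :
  continuous L -> differentiable f (a + L x) ->
  hasD (fun x => f (a + L x)) x v ('D_(L v) f (a + L x)).
Proof.
move=> cL df.
have dA : differentiable (fun x => a + L x) x.
  apply: (@differentiableD _ _ _ (fun=> a) L); first exact: differentiable_cst.
  exact: linear_differentiable.
have dc : differentiable (f \o (fun x => a + L x)) x by exact: differentiable_comp.
split => //; rewrite (deriveE _ dc) (deriveE _ df) (diff_comp dA df) /=.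
congr ('d f _ _).
rewrite (_ : (fun x => a + L x) = cst a + L :> (V -> W))// diffD//.
  by rewrite diff_cst diff_lin//= add0r.
exact: linear_differentiable.
Qed.

Lemma snear_affine n (f : W -> R) (L : {linear V -> W}) (a : W) :
  continuous L -> snear n setT f -> snear n setT (fun x => f (a + L x)).
Proof.
move=> cL; elim: n f => [|n IH] f sf.
  apply: (@snear0 _ _ _ _ (fun v x => 'D_(L v) f (a + L x))) => x v _.
  by apply: hasD_affine => //; exact: snear_diff sf _.
apply: (@snear_step _ _ _ _ _ (fun v x => 'D_(L v) f (a + L x))).
- exact: openT.
- by move=> x v _; apply: hasD_affine => //; exact: snear_diff sf _.
by move=> v; exact: (IH ('D_(L v) f) (sf.2 (L v))).
Qed.
End affine.

(** * The Gaussian kernel *)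

Section spacetime_coordinates.
Context {R : realType} {d : nat}.
Local Notation V := 'rV[R]_d.

Definition tcoor (z : R * V) : R := z.1.
Definition xcoor (i : 'I_d) (z : R * V) : R := z.2 ord0 i.

Lemma tcoor_scalar : scalar tcoor. Proof. by []. Qed.
Lemma xcoor_scalar i : scalar (xcoor i).
Proof. by move=> a x y; rewrite /xcoor /= !mxE. Qed.
HB.instance Definition _ := GRing.isLinear.Build R (R * V)%type R _ tcoor tcoor_scalar.
HB.instance Definition _ i := GRing.isLinear.Build R (R * V)%type R _ (xcoor i) (xcoor_scalar i).

Lemma continuous_tcoor : continuous tcoor.
Proof. by move=> z; exact: cvg_fst. Qed.
Lemma continuous_xcoor i : continuous (xcoor i).
Proof.
move=> z; apply: (cvg_comp snd (fun y : V => y ord0 i)); first exact: cvg_snd.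
exact: coord_continuous.
Qed.

Lemma hasD_tcoor z v : hasD (fun z : R * V => z.1) z v v.1.
Proof. exact: (hasD_lin z v continuous_tcoor). Qed.
Lemma hasD_xcoor i z v : hasD (fun z : R * V => z.2 ord0 i) z v (v.2 ord0 i).
Proof. exact: (hasD_lin z v (continuous_xcoor (i := i))). Qed.
Lemma snear_tcoor n (U : set (R * V)) : open U -> snear n U (fun z : R * V => z.1).
Proof. by move=> oU; exact: (snear_lin n oU continuous_tcoor). Qed.
Lemma snear_xcoor i n (U : set (R * V)) : open U -> snear n U (fun z : R * V => z.2 ord0 i).
Proof. by move=> oU; exact: (snear_lin n oU (continuous_xcoor (i := i))). Qed.
End spacetime_coordinates.

Section gaussian.
Context {R : realType} {d : nat}.
Variable nu : R.
Hypothesis nu0 : 0 < nu.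
Local Notation V := 'rV[R]_d.
Local Notation lam := (lebesgue_rV d).

(** The normalisation (4 pi nu)^(-d/2) of the heat kernel at time 1. *)
Definition gK : R := (Num.sqrt (4 * nu) ^+ d * Num.sqrt pi ^+ d)^-1.

(** The heat kernel (4 pi nu tau)^(-d/2) exp(-|x|^2 / (4 nu tau)), with Euclidean |x|. The power of
    tau is moved into the exponential, so that a single application of the chain rule differentiates
    everything. *)
Definition gauss (tau : R) (x : V) : R :=
  gK * expR (- (d%:R / 2) * ln tau - (4 * nu)^-1 * sqn x * tau^-1).

Lemma gK_gt0 : 0 < gK.
Proof. by rewrite invr_gt0 mulr_gt0// exprn_gt0// sqrtr_gt0 ?pi_gt0// mulr_gt0. Qed.

Lemma gauss_gt0 tau x : 0 < gauss tau x.
Proof. by rewrite mulr_gt0 ?gK_gt0 ?expR_gt0. Qed.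

Lemma sqn_ge0 (x : V) : 0 <= sqn x.
Proof. by apply: sumr_ge0 => i _; exact: sqr_ge0. Qed.

Lemma sqnZ c (x : V) : sqn (c *: x) = c ^+ 2 * sqn x.
Proof. by rewrite /sqn big_distrr /=; apply: eq_bigr => i _; rewrite mxE exprMn. Qed.

Lemma coor_sqn (x : V) i : x ord0 i ^+ 2 <= sqn x.
Proof. by rewrite /sqn (bigD1 i)//= lerDl; apply: sumr_ge0 => j _; exact: sqr_ge0. Qed.

Lemma measurable_gauss tau : measurable_fun setT (gauss tau).
Proof.
apply: measurable_funM => //; apply: measurableT_comp => //.
apply: measurable_funB => //; apply: measurable_funM => //; apply: measurable_funM => //.
exact: measurable_sqn.
Qed.

Lemma gauss1_le x : gauss 1 x <= gK.
Proof.
rewrite /gauss ln1 mulr0 sub0r invr1 mulr1 ler_piMr ?(ltW gK_gt0)// -expR0 ler_expR.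
by rewrite oppr_le0 mulr_ge0 ?sqn_ge0// invr_ge0 mulr_ge0// ltW.
Qed.

Lemma gauss1_mass : (\int[lam]_x (gauss 1 x)%:E = 1)%E.
Proof.
have n4 : 0 < 4 * nu by rewrite mulr_gt0.
rewrite (@ge0_integral_affine _ _ 0 (Num.sqrt (4 * nu))); last 3 first.
- by rewrite gt_eqF// sqrtr_gt0.
- by apply/measurable_EFinP; exact: measurable_gauss.
- by move=> x; rewrite lee_fin ltW// gauss_gt0.
rewrite ger0_norm ?sqrtr_ge0//.
transitivity ((Num.sqrt (4 * nu) ^+ d)%:E * \int[lam]_x (gK%:E * (expR (- sqn x))%:E))%E.
  congr (_ * _)%E; apply: eq_integral => x _.
  rewrite /gauss add0r sqnZ sqr_sqrtr ?(ltW n4)// ln1 mulr0 sub0r invr1 mulr1.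
  by rewrite mulKf// gt_eqF.
rewrite ge0_integralZl//; last 2 first.
- apply/measurable_EFinP; apply: measurableT_comp => //; apply: measurableT_comp => //.
  exact: measurable_sqn.
- by rewrite lee_fin ltW// gK_gt0.
rewrite integral_expsqn -!EFinM; congr EFin.
rewrite mulrCA /gK mulVf// gt_eqF// mulr_gt0// exprn_gt0// sqrtr_gt0//.
exact: pi_gt0.
Qed.

Lemma expR_half_ln (tau : R) : 0 < tau -> expR (- (d%:R / 2) * ln tau) = Num.sqrt tau ^- d.
Proof.
move=> t0.
have -> : Num.sqrt tau = expR (ln tau / 2).
  rewrite -[in LHS](lnK (x := tau)) ?posrE//.
  have {1}-> : ln tau = 2%:R * (ln tau / 2) by field.
  by rewrite expRM_natl sqrtr_sqr ger0_norm// expR_ge0.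
by rewrite -expRM_natr -expRN; congr expR; field.
Qed.

(** Parabolic scaling. It makes the Gaussians an approximate identity in the sense of [eta_], so
    that the mollification results apply to them. *)
Lemma gauss_eta tau x : 0 < tau -> gauss tau x = eta_ (gauss 1) (Num.sqrt tau) x.
Proof.
move=> t0; rewrite /eta_ /gauss ln1 mulr0 sub0r invr1 mulr1 expRD expR_half_ln//.
rewrite mulrCA; congr (_ * (_ * expR _)).
by rewrite sqnZ exprVn sqr_sqrtr ?ltW// mulrCA mulrC mulrA.
Qed.

Lemma gauss_mass tau x : 0 < tau -> (\int[lam]_y (gauss tau (x - y))%:E = 1)%E.
Proof.
move=> t0; under eq_integral do rewrite gauss_eta//.
apply: (@kernel_mass _ _ _ (measurable_gauss 1)) => //.
- by move=> y; rewrite ltW// gauss_gt0.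
- exact: gauss1_mass.
- by rewrite sqrtr_gt0.
Qed.

(** The number 2^(d/2), the price of doubling the time in the prefactor of the Gaussian. *)
Definition c2 : R := expR (d%:R / 2 * ln 2).

Lemma c2_gt0 : 0 < c2. Proof. exact: expR_gt0. Qed.

Lemma gauss_double tau x : 0 < tau ->
  gauss tau x = c2 * expR (- ((8 * nu)^-1 * sqn x * tau^-1)) * gauss (2 * tau) x.
Proof.
move=> t0; rewrite /gauss /c2 mulrCA; congr (_ * _); rewrite -!expRD; congr expR.
rewrite lnM ?posrE// invfM; field.
by rewrite (gt_eqF t0) (gt_eqF nu0).
Qed.

(** Minus the i-th derivative of [gauss tau]: the sign is that of the derivative of
    [gauss tau (x - y)] in y. *)
Definition dgauss (i : 'I_d) (tau : R) (x : V) : R :=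
  x ord0 i / (2 * nu * tau) * gauss tau x.

(** Half of the Gaussian exponent absorbs the factor x_i / tau. With q = |x|^2 / (8 nu tau), the
    square of x_i / (2 nu tau) is at most 2q / (nu tau), and 2q <= exp(2q); what remains of the
    exponent is the Gaussian at time 2 tau. *)
Lemma dgauss_le i tau x : 0 < tau ->
  `|dgauss i tau x| <= c2 * (Num.sqrt (nu * tau))^-1 * gauss (2 * tau) x.
Proof.
move=> t0; rewrite /dgauss normrM (ger0_norm (ltW (gauss_gt0 _ _))) gauss_double//.
set q := (8 * nu)^-1 * sqn x * tau^-1.
have g0 := ltW (gauss_gt0 (2 * tau) x).
rewrite -[c2 * _ * _]mulrA mulrCA -[leRHS]mulrA; apply: ler_wpM2l; first exact/ltW/c2_gt0.
rewrite mulrA; apply: ler_wpM2r => //.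
rewrite expRN ler_pdivrMr ?expR_gt0//.
have nt : 0 < nu * tau by rewrite mulr_gt0.
have s0 : 0 < Num.sqrt (nu * tau) by rewrite sqrtr_gt0.
rewrite -ler_sqr ?nnegrE ?normr_ge0 ?mulr_ge0 ?expR_ge0 ?invr_ge0 ?(ltW s0)//.
rewrite real_normK ?num_real// !exprMn [X in _ <= X * _]exprVn sqr_sqrtr ?(ltW nt)//.
have -> : expR q ^+ 2 = expR (2 * q) by rewrite -expRM_natl mulr_natl.
apply: (@le_trans _ _ ((nu * tau)^-1 * (2 * q))).
  apply: (@le_trans _ _ (sqn x * (2 * nu * tau)^-1 ^+ 2)).
    by apply: ler_wpM2r; [exact: sqr_ge0|exact: coor_sqn].
  rewrite /q le_eqVlt; apply/orP; left; apply/eqP; field.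
  by rewrite (gt_eqF t0) (gt_eqF nu0).
apply: ler_wpM2l; first by rewrite invr_ge0 ltW.
by apply: le_trans (expR_ge1Dx _); rewrite lerDr.
Qed.

(** Replaces a whole range of times by one fixed Gaussian, which can then serve as an integrable
    majorant. *)
Lemma gauss_le_between a b tau x : 0 < a -> a <= tau -> tau <= b ->
  gauss tau x <= expR (d%:R / 2 * (ln b - ln a)) * gauss b x.
Proof.
move=> a0 at_ tb; have t0 := lt_le_trans a0 at_; have b0 := lt_le_trans t0 tb.
rewrite /gauss mulrCA; apply: ler_wpM2l; first exact/ltW/gK_gt0.
rewrite -expRD ler_expR.
have h1 : ln a <= ln tau by rewrite ler_ln ?posrE.
have h2 : (4 * nu)^-1 * sqn x * b^-1 <= (4 * nu)^-1 * sqn x * tau^-1.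
  apply: ler_wpM2l; last by rewrite lef_pV2 ?posrE.
  by rewrite mulr_ge0 ?sqn_ge0// invr_ge0 mulr_ge0// ltW.
have h3 : d%:R / 2 * ln a <= d%:R / 2 * ln tau by apply: ler_wpM2l => //; rewrite divr_ge0.
rewrite mulrBr; lra.
Qed.

Lemma gauss_ub r tau x : 0 < r -> r <= tau -> gauss tau x <= gK * expR (- (d%:R / 2) * ln r).
Proof.
move=> r0 rt; apply: ler_wpM2l; first exact/ltW/gK_gt0.
have t0 := lt_le_trans r0 rt.
rewrite ler_expR.
have h1 : ln r <= ln tau by rewrite ler_ln ?posrE.
have h3 : d%:R / 2 * ln r <= d%:R / 2 * ln tau by apply: ler_wpM2l => //; rewrite divr_ge0.
have h2 : 0 <= (4 * nu)^-1 * sqn x * tau^-1.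
  by rewrite mulr_ge0 ?mulr_ge0 ?sqn_ge0// ?invr_ge0 ?mulr_ge0// ltW.
lra.
Qed.

End gaussian.

(** * The backward heat kernel as a test function *)

Section backward_kernel.
Context {R : realType} {d : nat}.
Variable nu : R.
Hypothesis nu0 : 0 < nu.
Local Notation V := 'rV[R]_d.
Variables (t0 : R) (x : V).

Definition bgauss (z : R * V) : R := gauss nu (t0 - z.1) (x - z.2).

Definition bdgauss (i : 'I_d) (z : R * V) : R := dgauss nu i (t0 - z.1) (x - z.2).

Lemma hasDN (W : normedModType R) (f : W -> R) (y v : W) a :
  hasD f y v a -> hasD (fun z => - f z) y v (- a).
Proof.
move=> /(hasDZ (-1)); rewrite mulN1r.
by under eq_fun do rewrite mulN1r.
Qed.

Lemma hasDB (W : normedModType R) (f g : W -> R) (y v : W) a b :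
  hasD f y v a -> hasD g y v b -> hasD (fun z => f z - g z) y v (a - b).
Proof. by move=> hf /hasDN; exact: hasDD. Qed.

Lemma snearN n (W : normedModType R) (U : set W) (f : W -> R) : open U ->
  snear n U f -> snear n U (fun z => - f z).
Proof.
move=> oU sf; have -> : (fun z => - f z) = (fun z => -1 * f z).
  by apply/funext => z; rewrite mulN1r.
by apply: snearM => //; exact: snear_cst.
Qed.

Lemma snearS n (W : normedModType R) (U U' : set W) (f : W -> R) :
  U' `<=` U -> snear n U f -> snear n U' f.
Proof.
move=> UU; elim: n f => [|n IH] f [df sf]; split => //; try by move=> y /UU /df.
by move=> v; exact: (IH _ (sf v)).
Qed.

Lemma hasD_tau (z v : R * V) : hasD (fun z : R * V => t0 - z.1) z v (- v.1).
Proof. by rewrite -[- v.1]add0r; apply: hasDB; [exact: hasD_cst|exact: hasD_tcoor]. Qed.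

Lemma hasD_xi i (z v : R * V) : hasD (fun z : R * V => (x - z.2) ord0 i) z v (- v.2 ord0 i).
Proof.
have -> : (fun z : R * V => (x - z.2) ord0 i) = (fun z => x ord0 i - z.2 ord0 i).
  by apply/funext => y; rewrite !mxE.
by rewrite -[- v.2 ord0 i]add0r; apply: hasDB; [exact: hasD_cst|exact: hasD_xcoor].
Qed.

Lemma hasD_sqn (z v : R * V) : hasD (fun z : R * V => sqn (x - z.2)) z v
  (\sum_(i < d) - (2 * (x - z.2) ord0 i * v.2 ord0 i)).
Proof.
apply: hasD_sum => i.
under eq_fun do rewrite expr2.
have -> : - (2 * (x - z.2) ord0 i * v.2 ord0 i) =
  - v.2 ord0 i * (x - z.2) ord0 i + (x - z.2) ord0 i * - v.2 ord0 i by ring.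
by apply: hasDM; exact: hasD_xi.
Qed.

Lemma hasD_inv_tau (z v : R * V) : z.1 < t0 ->
  hasD (fun z : R * V => (t0 - z.1)^-1) z v ((t0 - z.1)^-1 * (t0 - z.1)^-1 * v.1).
Proof.
move=> zt.
have -> : (t0 - z.1)^-1 * (t0 - z.1)^-1 * v.1 = -1 * ((t0 - z.1)^-1 * (t0 - z.1)^-1) * - v.1 by ring.
apply: (hasD_comp1 (g := @GRing.inv R) _ (hasD_tau z v)).
by apply: is_derive_inv; rewrite gt_eqF// subr_gt0.
Qed.

Lemma hasD_bgauss (z v : R * V) : z.1 < t0 -> hasD bgauss z v (bgauss z *
  (d%:R / 2 * (t0 - z.1)^-1 * v.1
   + \sum_(i < d) ((x - z.2) ord0 i / (2 * nu * (t0 - z.1)) * v.2 ord0 i)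
   - (4 * nu)^-1 * sqn (x - z.2) * ((t0 - z.1)^-1 * (t0 - z.1)^-1 * v.1))).
Proof.
move=> zt; have tz : 0 < t0 - z.1 by rewrite subr_gt0.
set E := _ - _.
have -> : bgauss z * E = @gK R d nu * (expR (- (d%:R / 2) * ln (t0 - z.1) -
   (4 * nu)^-1 * sqn (x - z.2) * (t0 - z.1)^-1) * E).
  rewrite /bgauss.
  rewrite /gauss.
  by rewrite -mulrA.
apply: hasDZ; apply: hasD_comp1.
have -> : E = - (d%:R / 2) * ((t0 - z.1)^-1 * - v.1) -
   (((4 * nu)^-1 * \sum_(i < d) - (2 * (x - z.2) ord0 i * v.2 ord0 i)) * (t0 - z.1)^-1
    + (4 * nu)^-1 * sqn (x - z.2) * ((t0 - z.1)^-1 * (t0 - z.1)^-1 * v.1)).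
  rewrite /E opprD addrA; congr (_ - _); congr (_ + _); first by ring.
  rewrite sumrN mulrN mulNr opprK mulr_sumr mulr_suml; apply: eq_bigr => i _.
  by field; rewrite (gt_eqF tz) (gt_eqF nu0).
apply: hasDB.
  apply: hasDZ; apply: hasD_comp1; last exact: hasD_tau.
  exact: is_derive1_ln.
apply: hasDM; last exact: hasD_inv_tau.
by apply: hasDZ; exact: hasD_sqn.
Qed.

Lemma open_past : open [set z : R * V | z.1 < t0].
Proof.
rewrite (_ : [set z | _] = fst @^-1` `]-oo, t0[%classic); last first.
  by apply/seteqP; split => z /=; rewrite in_itv.
apply: open_comp; last exact: interval_open.
by move=> z _; exact: cvg_fst.
Qed.

Lemma snear_bgauss n : snear n [set z : R * V | z.1 < t0] bgauss.
Proof.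
have oU := open_past.
have stau : snear n [set z : R * V | z.1 < t0] (fun z : R * V => t0 - z.1).
  apply: snearD => //; first exact: snear_cst.
  by apply: snearN => //; exact: snear_tcoor.
apply: snearM => //; first exact: snear_cst.
apply: snear_exp => //; apply: snearD => //.
  apply: snearM => //; first exact: snear_cst.
  by apply: snear_ln => // z /=; rewrite subr_gt0.
apply: snearN => //.
apply: snearM => //; last first.
  by apply: snear_inv => // z /= zt; rewrite gt_eqF// subr_gt0.
apply: snearM => //; first exact: snear_cst.
apply: snear_sum => // i.
have sx : snear n [set z : R * V | z.1 < t0] (fun z : R * V => (x - z.2) ord0 i).
  have -> : (fun z : R * V => (x - z.2) ord0 i) = (fun z => x ord0 i + -1 * z.2 ord0 i).
    by apply/funext => y; rewrite !mxE mulN1r.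
  apply: snearD => //; first exact: snear_cst.
  by apply: snearM => //; [exact: snear_cst|exact: snear_xcoor].
rewrite [X in snear _ _ X](_ : _ = fun z : R * V => (x - z.2) ord0 i * (x - z.2) ord0 i).
  exact: snearM.
by apply/funext => z; rewrite expr2.
Qed.

Variables (Th Th' : R -> R) (t1 : R).
Hypotheses (t10 : t1 < t0) (sTh : forall n, snear n setT Th)
  (dTh : forall s : R, is_derive s 1 Th (Th' s)) (Th0 : forall s, t1 < s -> Th s = 0).

Lemma Th'0 s : t1 < s -> Th' s = 0.
Proof.
move=> ts; have [_ <-] := dTh s.
have [] := @hasD_near _ _ (fun=> 0) Th s 1 0; last by move=> _ ->.
  have : `]t1, +oo[%classic s by rewrite /= in_itv/= andbT.
  have o : open (`]t1, +oo[%classic : set R) by exact: interval_open.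
  move=> h; have := open_nbhs_nbhs (conj o h).
  by apply: filterS => r /=; rewrite in_itv/= andbT => /Th0 ->.
exact: hasD_cst.
Qed.

(** Since [Th] vanishes after [t1 < t0], the meaningless values of [bgauss] at and after its pole
    [t0] are multiplied by zero. *)
Definition ptest (z : R * V) : R := Th z.1 * bgauss z.

Lemma open_future : open [set z : R * V | t1 < z.1].
Proof.
rewrite (_ : [set z | _] = fst @^-1` `]t1, +oo[%classic); last first.
  by apply/seteqP; split => z /=; rewrite in_itv /= andbT.
apply: open_comp; last exact: interval_open.
by move=> z _; exact: cvg_fst.
Qed.

Lemma hasD_Th (z v : R * V) : hasD (fun z : R * V => Th z.1) z v (Th' z.1 * v.1).
Proof. by apply: hasD_comp1; exact: hasD_tcoor. Qed.

Lemma hasD_future (f : R * V -> R) (z v : R * V) : t1 < z.1 ->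
  (forall y : R * V, t1 < y.1 -> f y = 0) -> hasD f z v 0.
Proof.
move=> tz f0; apply: (@hasD_near _ _ (fun=> 0)); last exact: hasD_cst.
have := open_nbhs_nbhs (conj open_future (tz : [set z : R * V | t1 < z.1] z)).
by apply: filterS => y /f0.
Qed.

Lemma hasD_ptest (z v : R * V) : hasD ptest z v (Th' z.1 * v.1 * bgauss z + ptest z *
  (d%:R / 2 * (t0 - z.1)^-1 * v.1
   + \sum_(i < d) ((x - z.2) ord0 i / (2 * nu * (t0 - z.1)) * v.2 ord0 i)
   - (4 * nu)^-1 * sqn (x - z.2) * ((t0 - z.1)^-1 * (t0 - z.1)^-1 * v.1))).
Proof.
have [zt|zt] := ltP z.1 t0.
  rewrite /ptest -[Th z.1 * _ * _]mulrA.
  by apply: hasDM; [exact: hasD_Th|exact: hasD_bgauss].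
have tz := lt_le_trans t10 zt.
rewrite Th'0// /ptest Th0// !mul0r addr0.
by apply: hasD_future => // y ty; rewrite Th0// mul0r.
Qed.

(** Two overlapping open half-spaces cover everything: before [t0] both factors are smooth, and
    after [t1] the product is identically zero. *)
Lemma snear_ptest n : snear n setT ptest.
Proof.
have -> : [set: R * V] = [set z : R * V | z.1 < t0] `|` [set z : R * V | t1 < z.1].
  apply/seteqP; split => // z _ /=; have [zt|zt] := ltP z.1 t0; first by left.
  by right; exact: lt_le_trans zt.
apply: snearU.
  apply: snearM; [exact: open_past| |exact: snear_bgauss].
  have sl := @snear_affine _ (R * V)%type R n Th (@tcoor R d) 0 continuous_tcoor (sTh n).
  apply: (@snearS _ _ setT) => //.
  rewrite [X in snear _ _ X](_ : _ = (fun z : R * V => Th (0 + tcoor z)))//.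
  by apply/funext => z; rewrite add0r.
apply: (@snear_ext _ _ _ _ (fun=> 0)); [exact: open_future| |exact: snear_cst open_future].
by move=> z /= tz; rewrite /ptest Th0// mul0r.
Qed.

Lemma basis_vecE (i j : 'I_d) : basis_vec i ord0 j = (j == i)%:R :> R.
Proof. by rewrite /basis_vec mxE eqxx. Qed.

Lemma dx_ptest i (z : R * V) : dx i ptest z = Th z.1 * bdgauss i z.
Proof.
rewrite /dx; have [_ ->] := hasD_ptest z (0, basis_vec i).
rewrite /= !mulr0 mul0r subr0 !add0r (bigD1 i)//= big1 => [|j ji]; last first.
  by rewrite basis_vecE (negbTE ji) mulr0.
by rewrite addr0 basis_vecE eqxx mulr1 /bdgauss /dgauss /ptest /bgauss -mulrA; congr (_ * _); rewrite mulrC.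
Qed.

Lemma dxdx_ptest i (z : R * V) : dx i (dx i ptest) z =
  ptest z * (((x - z.2) ord0 i / (2 * nu * (t0 - z.1))) ^+ 2 - (2 * nu * (t0 - z.1))^-1).
Proof.
have -> : dx i ptest = (fun z => ptest z * ((x - z.2) ord0 i * ((2 * nu)^-1 * (t0 - z.1)^-1))).
  apply/funext => y; rewrite dx_ptest /bdgauss /dgauss /ptest /bgauss invfM.
  by ring.
have [zt|zt] := ltP z.1 t0; last first.
  have tz := lt_le_trans t10 zt.
  rewrite /dx; have [_ ->] := @hasD_future (fun z => ptest z * ((x - z.2) ord0 i * ((2 * nu)^-1 * (t0 - z.1)^-1))) z (0, basis_vec i) tz
    (fun y ty => ltac:(by rewrite /ptest Th0// !mul0r)).
  by rewrite /ptest Th0// !mul0r.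
have P1 := hasD_ptest z (0, basis_vec i).
have P2 := hasDM (hasD_xi i z (0, basis_vec i)) (hasDZ (2 * nu)^-1 (hasD_inv_tau (0, basis_vec i) zt)).
rewrite /dx; have [_ ->] := hasDM P1 P2.
rewrite /= !mulr0 mul0r subr0 !add0r (bigD1 i)//= big1 => [|j ji]; last first.
  by rewrite basis_vecE (negbTE ji) mulr0.
rewrite !basis_vecE !eqxx /=; field.
by rewrite (gt_eqF nu0) subr_eq0 (gt_eqF zt).
Qed.

(** The Gaussian solves the backward heat equation, so only the derivative of the time cut-off
    survives. At and after [t0] both sides vanish. *)
Lemma heat_ptest (z : R * V) :
  dt ptest z + nu * \sum_(i < d) dx i (dx i ptest) z = Th' z.1 * bgauss z.
Proof.
rewrite /dt; have [_ ->] := hasD_ptest z (1, 0).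
have [zt|zt] := ltP z.1 t0; last first.
  have tz := lt_le_trans t10 zt.
  rewrite /ptest Th0// !mul0r addr0 big1 ?mulr0 ?addr0 ?mulr1// => i _.
  by rewrite dxdx_ptest /ptest Th0// !mul0r.
under [X in nu * X]eq_bigr => i _ do rewrite dxdx_ptest.
rewrite -mulr_sumr /= !mulr1 big1 => [|i _]; last by rewrite [X in _ * X]mxE mulr0.
rewrite -addrA -[RHS]addr0; congr (_ + _).
rewrite addr0 sumrB sumr_const card_ord.
under eq_bigr do rewrite exprMn.
rewrite -mulr_suml -/(sqn _) -[_ *+ d]mulr_natl; field.
by rewrite (gt_eqF nu0) subr_eq0 (gt_eqF zt).
Qed.

End backward_kernel.

(** * Cut-off functions *)

Section compactly_supported.
Context {R : realType} {V : normedModType R}.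
Implicit Types f : V -> R.

Lemma smooth_deriv f v : smooth f -> smooth ('D_v f).
Proof. by move=> sf vs x; have := sf (rcons vs v) x; rewrite foldr_rcons. Qed.

Lemma smooth_continuous f : smooth f -> continuous f.
Proof. by move=> sf x; apply: differentiable_continuous; exact: (sf [::]). Qed.

Lemma tsupport_deriv f v : smooth f -> tsupport ('D_v f) `<=` tsupport f.
Proof.
move=> sf; rewrite [X in _ `<=` X](proj1 (closure_id _) (@closed_closure _ _)).
apply: closure_subset => x /= Dx; apply: contrapT => nx.
have oC : open (~` tsupport f) by apply: closed_openC; exact: closed_closure.
have [] := @hasD_near _ _ (fun=> 0) f x v 0.
- have := open_nbhs_nbhs (conj oC nx); apply: filterS => y ny.
  apply: contrapT => h; apply: ny; apply: subset_closure => /=.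
  by apply/eqP => fy; apply: h.
- exact: hasD_cst.
by move=> _ D0; rewrite D0 eqxx in Dx.
Qed.

Lemma Cc_infty_deriv f v : Cc_infty setT f -> Cc_infty setT ('D_v f).
Proof.
move=> [sf cf _]; split => //; first exact: smooth_deriv.
by apply: subclosed_compact cf _; [exact: closed_closure|exact: tsupport_deriv].
Qed.

Lemma Cc_infty_bounded f : Cc_infty setT f -> exists B, forall x, `|f x| <= B.
Proof.
move=> [sf cf _].
have cnf : continuous (fun x => `|f x|).
  by move=> x; apply: continuous_comp; [exact: smooth_continuous|exact: norm_continuous].
have out x : ~ tsupport f x -> f x = 0.
  by move=> nx; apply: contrapT => /eqP fx; apply: nx; exact: subset_closure.
have [[x0 tx0]|/forallNP ne] := pselect (exists x, tsupport f x); last first.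
  by exists 0 => x; rewrite out ?normr0//; exact: ne.
have [||c _ H] := @compact_EVT_max V R (fun x => `|f x|) (tsupport f) _ cf.
- by exists x0.
- exact: continuous_subspaceT.
exists `|f c| => x.
have [tx|/out ->] := pselect (tsupport f x); last by rewrite normr0.
by apply: H; rewrite inE.
Qed.
End compactly_supported.

Section bumps.
Context {R : realType} {d : nat}.
Local Notation V := 'rV[R]_d.
Local Notation mu := (@lebesgue_measure R).
Variable eta : V -> R.
Hypotheses (hd : (1 <= d)%N) (heta : kernel_axioms eta).

Lemma eta_pt : exists y0, 0 < eta y0.
Proof.
have [_ _ e0 e1] := heta; apply: contrapT => /forallNP H.
have E y : eta y = 0.
  by apply/eqP; rewrite eq_le e0 andbT leNgt; apply/negP; exact: H.
move: e1; under eq_Rintegral do rewrite E.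
rewrite /Rintegral integral_cst// mul0e /= => /eqP.
by rewrite eq_sym oner_eq0.
Qed.

Lemma ge0_integral_pos (f : R -> R) x : continuous f -> (forall r, 0 <= f r) ->
  0 < f x -> (0 < \int[mu]_r (f r)%:E)%E.
Proof.
move=> cf f0 fx.
have fx2 : 0 < f x / 2 by rewrite divr_gt0.
have := cf x => /cvgrPdist_lt /(_ _ fx2) /nbhs_ballP[e /= e0 H].
pose J : set R := `]x - e, x + e[%classic.
have He r : J r -> f x / 2 <= f r.
  rewrite /J /= in_itv /= => /andP[r1 r2].
  have : `|f x - f r| < f x / 2 by apply: H; rewrite /ball /= ltr_distl; apply/andP; split; lra.
  by rewrite ltr_norml => /andP[_]; lra.
have mf : measurable_fun setT f by exact: continuous_measurable_fun.
apply: (@lt_le_trans _ _ (\int[mu]_(r in J) (f x / 2)%:E)%E).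
  have mJ : mu J = (x + e - (x - e))%:E.
    by rewrite /J lebesgue_measure_itv /= lte_fin; have -> : x - e < x + e by lra.
  have mmJ : measurable J by exact: measurable_itv.
  rewrite (integral_cst mu mmJ) [X in (_ * X)%E]mJ.
  by rewrite -EFinM lte_fin mulr_gt0//; lra.
apply: (@le_trans _ _ (\int[mu]_(r in J) (f r)%:E)%E).
  apply: ge0_le_integral => //.
  - exact: measurable_itv.
  - by move=> r _; rewrite lee_fin ltW.
  - by apply/measurable_EFinP; exact: measurable_funS mf.
apply: ge0_subset_integral => //.
- exact: measurable_itv.
- exact/measurable_EFinP.
by move=> r _; rewrite lee_fin.
Qed.

(** The bump is [eta] restricted to a line through a point [y0] where it is positive, reparametrised
    to vanish outside []a, b[] and divided by its integral. [hd] provides the direction of the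
    line. *)
Lemma bump_exists (a b : R) : a < b -> exists2 be : R -> R,
  (forall n, snear n setT be) &
  [/\ (forall s, 0 <= be s), (forall s, s <= a \/ b <= s -> be s = 0),
      mu.-integrable setT (EFin \o be) & (\int[mu]_s (be s)%:E = 1)%E].
Proof.
move=> ab; have [y0 y00] := eta_pt.
have [[se ce _] e1 e0 _] := heta.
pose i0 := Ordinal hd.
(* With q = 2(s - a)/(b - a) - 1, the line is y0 + rho q e_{i0}. Outside []a, b[] one has |q| >= 1,
   so that coordinate is at least rho - |y0_{i0}| = 1 in absolute value and [eta] vanishes. *)
pose rho := 1 + `|y0 ord0 i0|.
have rho0 : 0 < rho by rewrite ltr_pwDl.
pose c := 2 * rho / (b - a).
have ba : 0 < b - a by rewrite subr_gt0.
have c0 : 0 < c by rewrite divr_gt0// mulr_gt0.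
pose v : V := c *: basis_vec i0.
pose L : R -> V := fun s => s *: v.
have linL : linear L by move=> k r s; rewrite /L scalerDl; congr (_ + _); exact/esym/scalerA.
pose LL : {linear R -> V} := HB.pack L (GRing.isLinear.Build R R V _ L linL).
pose y1 : V := y0 - (rho * (a + b) / (b - a)) *: basis_vec i0.
pose be0 s := eta (y1 + L s).
have be0E s : y1 + L s = y0 + (rho * (2 * (s - a) / (b - a) - 1)) *: basis_vec i0.
  rewrite /y1 /L /v scalerA -addrA; congr (_ + _); rewrite -scaleNr -scalerDl; congr (_ *: _).
  by rewrite /c; field; rewrite gt_eqF.
have cL : continuous LL.
  exact: scalel_continuous.
have sb0 n : snear n setT be0.
  by apply: (@snear_affine _ _ _ n eta LL y1 cL); exact: (smoothP eta).1.
have cb0 : continuous be0.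
  by move=> s; apply: differentiable_continuous; exact: snear_diff (sb0 0%N) _.
have be00 s : 0 <= be0 s by exact: e0.
have out s : s <= a \/ b <= s -> be0 s = 0.
  move=> Hs; rewrite /be0 be0E; apply: e1; rewrite /enorm -[X in X <= _]sqrtr1 ler_sqrt; last first.
    by apply: sumr_ge0 => i _; exact: sqr_ge0.
  rewrite (bigD1 i0)//= -[leLHS]addr0; apply: lerD; last by apply: sumr_ge0 => i _; exact: sqr_ge0.
  rewrite !mxE !eqxx mulr1.
  set q := 2 * (s - a) / (b - a) - 1.
  have q1 : 1 <= `|q|.
    rewrite /q; case: Hs => Hs.
      rewrite ler0_norm; last by rewrite subr_le0 ler_pdivrMr//; nra.
      by rewrite opprB lerBrDr -lerBrDl subrr pmulr_lle0 ?invr_gt0//; nra.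
    rewrite ger0_norm; last by rewrite subr_ge0 ler_pdivlMr//; nra.
    by rewrite lerBrDr ler_pdivlMr//; nra.
  rewrite -[X in X <= _](expr1n _ 2) -[leRHS]real_normK ?num_real//.
  rewrite ler_sqr ?nnegrE//.
  rewrite [X in _ <= `|X|]addrC.
  have : rho <= `|rho * q| by rewrite normrM (gtr0_norm rho0) ler_peMr// ltW.
  have := lerB_normD (rho * q) (y0 ord0 i0).
  move=> A1 A2; have A3 : rho = 1 + `|y0 ord0 i0| by [].
  by rewrite A3 in A1; lra.
have c1 : be0 ((a + b) / 2) = eta y0.
  rewrite /be0 be0E; congr eta.
  have -> : rho * (2 * ((a + b) / 2 - a) / (b - a) - 1) = 0 by field; rewrite gt_eqF.
  by rewrite scale0r addr0.
have mb0 : measurable_fun setT be0 by exact: continuous_measurable_fun.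
have mEb0 : measurable_fun setT (fun s => (be0 s)%:E) by exact/measurable_EFinP.
have pos : (0 < \int[mu]_s (be0 s)%:E)%E.
  by apply: (@ge0_integral_pos _ ((a + b) / 2)) => //; rewrite c1.
have restr : (\int[mu]_s (be0 s)%:E = \int[mu]_(s in `[a, b]) (be0 s)%:E)%E.
  rewrite [RHS]integral_mkcond; apply: eq_integral => s _; rewrite patchE.
  case: ifPn => //; rewrite notin_setE /= in_itv /= => /negP; rewrite negb_and -!ltNge => H.
  by rewrite out//; case/orP: H => /ltW; [left|right].
have ib : mu.-integrable `[a, b] (EFin \o be0).
  by apply: continuous_compact_integrable; [exact: segment_compact|exact: continuous_subspaceT].
have fin : (\int[mu]_s (be0 s)%:E)%E \is a fin_num.
  by rewrite restr; exact: integrable_fin_num ib.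
pose I := fine (\int[mu]_s (be0 s)%:E)%E.
have I0 : 0 < I by rewrite fine_gt0// pos ltey_eq fin.
have mass : (\int[mu]_s (I^-1 * be0 s)%:E = 1)%E.
  under eq_integral do rewrite EFinM.
  rewrite ge0_integralZl//; last 2 first.
  - by move=> s _; rewrite lee_fin.
  - by rewrite lee_fin invr_ge0 ltW.
  by rewrite -(fineK fin) -EFinM mulVf// gt_eqF.
exists (fun s => I^-1 * be0 s).
  by move=> n; apply: snearM; [exact: openT|exact: snear_cst openT|].
split => //.
- by move=> s; rewrite mulr_ge0// invr_ge0 ltW.
- by move=> s /out ->; rewrite mulr0.
- apply/integrableP; split; first by apply/measurable_EFinP; exact: measurable_funM.
  under eq_integral => s _ do rewrite gee0_abs ?lee_fin ?mulr_ge0 ?invr_ge0 ?(ltW I0)//.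
  by rewrite mass ltry.
Qed.

Lemma snear_continuous (W : normedModType R) (f : W -> R) :
  (forall n, snear n setT f) -> continuous f.
Proof. by move=> sf y; apply: differentiable_continuous; exact: snear_diff (sf 0%N) _. Qed.

Definition primitive (f : R -> R) (s : R) : R := \int[mu]_(r in `]-oo, s]) f r.

Lemma snear_antideriv (F f : R -> R) : (forall n, snear n setT f) ->
  (forall s : R, is_derive s (1 : R) F (f s)) -> forall n, snear n setT F.
Proof.
move=> sf D.
have H (s v : R) : setT s -> hasD F s v (f s * v).
  move=> _; apply: (@hasD_comp1 _ _ F (f s) idfun).
  by split; [exact: ex_diff|rewrite derive_id].
move=> n; apply: (@snearW _ _ n).
apply: (@snear_step _ _ n setT F (fun v s => f s * v)) => //.
- exact: openT.
- by move=> v; apply: snearM; [exact: openT|exact: sf|exact: snear_cst openT].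
Qed.

Lemma is_derive_primitive (f : R -> R) (s : R) : continuous f ->
  mu.-integrable setT (EFin \o f) -> is_derive s (1 : R) (primitive f) (f s).
Proof.
move=> cf intf.
have [] := @continuous_FTC1 R f -oo%O s (s + 1) _ _ _ (cf s).
- by rewrite ltrDl.
- by apply: integrableS intf.
- exact: ltNyr.
by move=> d1 d2; split; [exact: d1|rewrite -derive1E; exact: d2].
Qed.

Lemma snear_primitive (f : R -> R) : (forall n, snear n setT f) ->
  mu.-integrable setT (EFin \o f) -> forall n, snear n setT (primitive f).
Proof.
move=> sf intf; apply: (snear_antideriv sf) => s.
exact: is_derive_primitive (snear_continuous sf) intf.
Qed.

Lemma is_derive_hasD (f : R -> R) (s a : R) : is_derive s (1 : R) f a -> hasD f s 1 a.
Proof. by move=> [df <-]; split => //; exact/derivable1_diffP. Qed.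

Lemma hasD_is_derive (f : R -> R) (s a : R) : hasD f s 1 a -> is_derive s (1 : R) f a.
Proof. by move=> [df <-]; split => //; exact: diff_derivable. Qed.

Lemma primitive_ge (f : R -> R) (a b s : R) : (forall r, r <= a \/ b <= r -> f r = 0) ->
  b <= s -> primitive f s = \int[mu]_r f r.
Proof.
move=> f0 bs; rewrite /primitive /Rintegral [in LHS]integral_mkcond; congr fine.
apply: eq_integral => r _; rewrite patchE; case: ifPn => //.
rewrite notin_setE /= in_itv /= => /negP; rewrite -ltNge => sr.
by rewrite f0//; right; apply: le_trans bs (ltW sr).
Qed.

Lemma primitive_le (f : R -> R) (a b s : R) : (forall r, r <= a \/ b <= r -> f r = 0) ->
  s <= a -> primitive f s = 0.
Proof.
move=> f0 sa; rewrite /primitive; under eq_Rintegral => r rs.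
  rewrite f0; last by left; move: rs; rewrite inE /= in_itv /= => /le_trans; exact.
  over.
by rewrite /Rintegral integral0.
Qed.

Lemma primitive_itv (f : R -> R) s : (forall r, 0 <= f r) -> mu.-integrable setT (EFin \o f) ->
  0 <= primitive f s <= \int[mu]_r f r.
Proof.
move=> f0 intf; apply/andP; split; first by apply: Rintegral_ge0.
rewrite -lee_fin /primitive /Rintegral !fineK.
- apply: ge0_subset_integral => //; first by case/integrableP : intf.
  by move=> r _; rewrite lee_fin.
- exact: integrable_fin_num intf.
- by apply: integrable_fin_num => //; apply: integrableS intf.
Qed.

(** [Th] is the difference of the primitives of two bumps of mass one, on []-1, 0[] and on []t, t +
    h[]. The rise takes place at negative times, which the equations do not see; for s >= 0 the
    derivative is minus an approximation of the Dirac mass at [t]. *)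
Lemma plateau_exists (t h : R) : 0 <= t -> 0 < h -> exists Th Th' be : R -> R,
  [/\ (forall n, snear n setT Th) /\ (forall s : R, is_derive s (1 : R) Th (Th' s)),
      [/\ (forall s, s < -1 -> Th s = 0), (forall s, t + h <= s -> Th s = 0),
          (forall s, 0 <= s <= t -> Th s = 1) & (forall s, 0 <= s -> 0 <= Th s <= 1)],
      (forall s, 0 <= s -> Th' s = - be s) &
      [/\ continuous be, (forall s, 0 <= be s), (forall s, s <= t \/ t + h <= s -> be s = 0),
        mu.-integrable setT (EFin \o be) & (\int[mu]_s (be s)%:E = 1)%E]].
Proof.
move=> t0 h0.
have [b1 s1 [b10 b1z i1 m1]] : exists2 b1 : R -> R, (forall n, snear n setT b1) &
  [/\ (forall s, 0 <= b1 s), (forall s, s <= -1 \/ 0 <= s -> b1 s = 0),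
      mu.-integrable setT (EFin \o b1) & (\int[mu]_s (b1 s)%:E = 1)%E].
  by apply: bump_exists; lra.
have [b2 s2 [b20 b2z i2 m2]] : exists2 b1 : R -> R, (forall n, snear n setT b1) &
  [/\ (forall s, 0 <= b1 s), (forall s, s <= t \/ t + h <= s -> b1 s = 0),
      mu.-integrable setT (EFin \o b1) & (\int[mu]_s (b1 s)%:E = 1)%E].
  by apply: bump_exists; lra.
have M1 : \int[mu]_s b1 s = 1 by rewrite /Rintegral m1.
have M2 : \int[mu]_s b2 s = 1 by rewrite /Rintegral m2.
have S1 := snear_primitive s1 i1; have S2 := snear_primitive s2 i2.
have D1 s := is_derive_primitive s (snear_continuous s1) i1.
have D2 s := is_derive_primitive s (snear_continuous s2) i2.
exists (fun s => primitive b1 s + (- 1) * primitive b2 s), (fun s => b1 s + (-1) * b2 s), b2; split.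
- split=> [n|s].
    apply: snearD; [exact: openT|exact: S1|].
    by apply: snearM; [exact: openT|exact: snear_cst openT|exact: S2].
  apply: hasD_is_derive.
  exact: (hasDD (is_derive_hasD (D1 s)) (hasDZ (-1) (is_derive_hasD (D2 s)))).
- split.
  + by move=> s Hs; rewrite !(@primitive_le _ _ _ _ b1z) ?(@primitive_le _ _ _ _ b2z); lra.
  + by move=> s Hs; rewrite (primitive_ge b1z) ?(primitive_ge b2z) ?M1 ?M2; lra.
  + by move=> s Hs; rewrite (primitive_ge b1z) ?(@primitive_le _ _ _ _ b2z) ?M1; lra.
  move=> s Hs; rewrite (primitive_ge b1z) ?M1; last by lra.
  by have := primitive_itv s b20 i2; rewrite M2 => /andP[? ?]; apply/andP; split; lra.
- by move=> s s0; rewrite b1z ?add0r ?mulN1r//; right.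
- by split => //; exact: snear_continuous.
Qed.

Section cutoff.
Variable y0 : V.
Hypothesis y00 : 0 < eta y0.

Definition rescale (n : nat) (z : R * V) : V := n.+1%:R^-1 *: z.2.

Lemma rescale_linear n : linear (rescale n).
Proof. by move=> a x y; rewrite /rescale /= scalerDr !scalerA mulrC. Qed.
HB.instance Definition _ n := GRing.isLinear.Build R (R * V)%type V _ (rescale n) (rescale_linear n).

Lemma continuous_rescale n : continuous (rescale n).
Proof.
move=> z; apply: (cvg_comp snd (fun y : V => n.+1%:R^-1 *: y)); first exact: cvg_snd.
exact: scaler_continuous.
Qed.

(** A cut-off in space made from [eta] alone. It need not equal 1 on large balls, but it tends to 1
    pointwise while staying bounded, and its derivatives are O(1/(n+1)); that is enough for
    dominated convergence. *)
Definition cutfun (n : nat) (z : R * V) : R := (eta y0)^-1 * eta (y0 + rescale n z).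

Let seta : smooth eta. Proof. by case: heta => -[]. Qed.

Lemma snear_cut n m : snear m setT (cutfun n).
Proof.
apply: snearM; [exact: openT|exact: snear_cst openT|].
apply: (@snear_affine _ _ _ m eta (rescale n) y0); first exact: continuous_rescale.
exact: (smoothP eta).1.
Qed.

Lemma deriveZv (W : normedModType R) (f : W -> R) x (c : R) v : differentiable f x ->
  'D_(c *: v) f x = c * 'D_v f x.
Proof. by move=> df; rewrite !deriveE// linearZ. Qed.

Lemma hasD_rescaled (f : V -> R) n (z v : R * V) : smooth f ->
  hasD (fun z => f (y0 + rescale n z)) z v (n.+1%:R^-1 * 'D_(v.2) f (y0 + rescale n z)).
Proof.
move=> sf; rewrite -deriveZv; last exact: (sf [::]).
by apply: (@hasD_affine _ _ _ f (rescale n)); [exact: continuous_rescale|exact: (sf [::])].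
Qed.

Lemma hasD_cut n (z v : R * V) :
  hasD (cutfun n) z v ((eta y0)^-1 * (n.+1%:R^-1 * 'D_(v.2) eta (y0 + rescale n z))).
Proof. by apply: hasDZ; exact: hasD_rescaled. Qed.

Lemma dt_cut n z : dt (cutfun n) z = 0.
Proof.
rewrite /dt; have [_ ->] := hasD_cut n z (1, 0).
by rewrite deriveE//= ?linear0 ?mulr0//; exact: (seta [::]).
Qed.

Lemma dx_cut n i z : dx i (cutfun n) z =
  (eta y0)^-1 * (n.+1%:R^-1 * partial i eta (y0 + rescale n z)).
Proof. by rewrite /dx; have [_ ->] := hasD_cut n z (0, basis_vec i). Qed.

Lemma dxdx_cut n i z : dx i (dx i (cutfun n)) z =
  (eta y0)^-1 * (n.+1%:R^-1 * (n.+1%:R^-1 * partial i (partial i eta) (y0 + rescale n z))).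
Proof.
rewrite (_ : dx i (cutfun n) = (fun z => (eta y0)^-1 * (n.+1%:R^-1 * partial i eta (y0 + rescale n z)))); last first.
  by apply/funext => y; exact: dx_cut.
rewrite /dx; have [] // := @hasDZ _ _ (eta y0)^-1 _ z (0, basis_vec i) _ (hasDZ (n.+1%:R^-1) (@hasD_rescaled (partial i eta) n z (0, basis_vec i) (smooth_deriv _ seta))).
Qed.

Lemma cut_bounded : exists B, [/\ 0 <= B, (forall n z, `|cutfun n z| <= B),
  (forall n i z, `|dx i (cutfun n) z| <= B * n.+1%:R^-1) &
  (forall n i z, `|dx i (dx i (cutfun n)) z| <= B * n.+1%:R^-1)].
Proof.
have [ce _ _ _] := heta.
have [B0 H0] := Cc_infty_bounded ce.
have /choice[B1 H1] : forall i, exists B, forall x, `|partial i eta x| <= B.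
  by move=> i; apply: Cc_infty_bounded; exact: Cc_infty_deriv.
have /choice[B2 H2] : forall i, exists B, forall x, `|partial i (partial i eta) x| <= B.
  by move=> i; apply: Cc_infty_bounded; do 2 apply: Cc_infty_deriv.
have p1 i : 0 <= B1 i by exact: le_trans (H1 i 0).
have p2 i : 0 <= B2 i by exact: le_trans (H2 i 0).
have p0 : 0 <= B0 by exact: le_trans (H0 0).
have e0 : 0 <= (eta y0)^-1 by rewrite invr_ge0 ltW.
pose B := (eta y0)^-1 * (B0 + \sum_i B1 i + \sum_i B2 i).
have s1 : 0 <= \sum_i B1 i by apply: sumr_ge0.
have s2 : 0 <= \sum_i B2 i by apply: sumr_ge0.
have le1 i : B1 i <= \sum_i B1 i by rewrite (bigD1 i)//= lerDl; apply: sumr_ge0.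
have le2 i : B2 i <= \sum_i B2 i by rewrite (bigD1 i)//= lerDl; apply: sumr_ge0.
have n0 n : 0 <= n.+1%:R^-1 :> R by rewrite invr_ge0.
have n1 n : n.+1%:R^-1 <= 1 :> R by rewrite invf_le1// ler1n.
exists B; split.
- by rewrite mulr_ge0// !addr_ge0.
- move=> n z; rewrite normrM ger0_norm//; apply: ler_wpM2l => //.
  by apply: le_trans (H0 _) _; lra.
- move=> n i z; rewrite dx_cut !normrM ger0_norm// (ger0_norm (n0 n)) /B -mulrA [X in _ <= _ * X]mulrC.
  apply: ler_wpM2l => //; apply: ler_wpM2l => //.
  by apply: le_trans (H1 _ _) _; have := le1 i; lra.
- move=> n i z; rewrite dxdx_cut !normrM ger0_norm// (ger0_norm (n0 n)) /B -mulrA [X in _ <= _ * X]mulrC.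
  apply: ler_wpM2l => //; apply: ler_wpM2l => //.
  (* One of the two factors 1/(n+1) of the second derivative is discarded, so that both orders share
     the same bound. *)
  apply: (@le_trans _ _ (1 * B2 i)); last by have := le2 i; lra.
  by apply: ler_pM.
Qed.

Lemma cut_cvg z : cutfun n z @[n --> \oo] --> (1 : R).
Proof.
rewrite -[X in _ --> X](mulVf (x := eta y0)) ?gt_eqF//.
apply: cvgMr; apply: (cvg_comp (fun n => y0 + rescale n z) eta); last exact: smooth_continuous.
have : y0 + rescale n z @[n --> \oo] --> y0 + 0 *: z.2.
  apply: cvgD; first exact: cvg_cst.
  by apply: cvgZl; exact: cvg_harmonic.
by rewrite scale0r addr0.
Qed.

End cutoff.
End bumps.

Section product_derivatives.
Context {R : realType} {d : nat}.
Local Notation V := 'rV[R]_d.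
Variables (K psi : R * V -> R).
Hypotheses (sK : forall n, snear n setT K) (sp : forall n, snear n setT psi).

Lemma snear_dx n i (f : R * V -> R) : snear n.+1 setT f -> snear n setT (dx i f).
Proof. by move=> sf; exact: sf.2. Qed.

Lemma dt_mul (z : R * V) : dt (fun z => K z * psi z) z = dt K z * psi z + K z * dt psi z.
Proof.
have s1 : hasD K z (1, 0) (dt K z) := snear_hasD _ (sK 0%N) Logic.I.
have s2 : hasD psi z (1, 0) (dt psi z) := snear_hasD _ (sp 0%N) Logic.I.
by have [] := hasDM s1 s2.
Qed.

Let hK i (z : R * V) : hasD K z (0, basis_vec i) (dx i K z) := snear_hasD _ (sK 0%N) Logic.I.
Let hpsi i (z : R * V) : hasD psi z (0, basis_vec i) (dx i psi z) := snear_hasD _ (sp 0%N) Logic.I.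

Lemma dx_mul i (z : R * V) : dx i (fun z => K z * psi z) z = dx i K z * psi z + K z * dx i psi z.
Proof. by have [] := hasDM (hK i z) (hpsi i z). Qed.

Lemma dxdx_mul i (z : R * V) : dx i (dx i (fun z => K z * psi z)) z =
  dx i (dx i K) z * psi z + 2 * (dx i K z * dx i psi z) + K z * dx i (dx i psi) z.
Proof.
rewrite (_ : dx i (fun z => K z * psi z) = (fun z => dx i K z * psi z + K z * dx i psi z)); last first.
  by apply/funext => y; exact: dx_mul.
have s3 : hasD (dx i K) z (0, basis_vec i) (dx i (dx i K) z) := snear_hasD _ (snear_dx i (sK 1%N)) Logic.I.
have s4 : hasD (dx i psi) z (0, basis_vec i) (dx i (dx i psi) z) := snear_hasD _ (snear_dx i (sp 1%N)) Logic.I.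
have [_ E] := hasDD (hasDM s3 (hpsi i z)) (hasDM (hK i z) s4).
transitivity (dx i (dx i K) z * psi z + dx i K z * dx i psi z
  + (dx i K z * dx i psi z + K z * dx i (dx i psi) z)); first exact: E.
move: (dx i (dx i K) z) (dx i (dx i psi) z) (dx i K z) (dx i psi z) (K z) (psi z) => a b c e f g.
by ring.
Qed.
End product_derivatives.

(** * Truncated test functions *)

Section spacetime_measurability.
Context {R : realType} {d : nat}.
Local Notation V := 'rV[R]_d.
Local Notation mu := (@lebesgue_measure R).
Local Notation lam := (lebesgue_rV d).
Local Notation tl := (mu \x lam)%E.
Local Notation RR := (measurableTypeR R).

(** Inversion is discontinuous at 0; the identity 1/x = x (x^2)^(-1), which also holds at 0 with the
    convention 1/0 = 0, reduces the claim to real powers. *)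
Lemma measurable_invr : measurable_fun (setT : set R) (@GRing.inv R).
Proof.
rewrite (_ : @GRing.inv R = fun x => x * (x * x) `^ (-1)).
  apply: measurable_funM => //; apply: (measurableT_comp (measurable_powR (-1))).
  exact: measurable_funM.
apply/funext => x; rewrite powR_inv1; last by rewrite -expr2 sqr_ge0.
have [->|x0] := eqVneq x 0; first by rewrite mul0r invr0.
by rewrite invfM mulrA mulfV// mul1r.
Qed.

Lemma measurable_time (f : R -> R) : measurable_fun setT f ->
  measurable_fun (setT : set (RR * V)) (fun z => f z.1).
Proof. by move=> mf; exact: (measurableT_comp mf measurable_fst). Qed.

Lemma measurable_space (f : V -> R) : measurable_fun setT f ->
  measurable_fun (setT : set (RR * V)) (fun z => f z.2).
Proof. by move=> mf; exact: (measurableT_comp mf measurable_snd). Qed.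

Lemma measurable_xsub (x : V) : measurable_fun (setT : set V) (fun y => x - y).
Proof. by apply: measurable_rVD; [exact: measurable_cst|exact: measurable_rVN]. Qed.

Variable nu : R.
Hypothesis nu0 : 0 < nu.
Variables (t0 : R) (x : V).

Lemma measurable_bgauss : measurable_fun (setT : set (RR * V)) (bgauss nu t0 x).
Proof.
apply: measurable_funM => //; apply: measurableT_comp => //; apply: measurable_funB.
  apply: measurable_funM => //; apply: (measurable_time (f := fun s => ln (t0 - s))).
  by apply: (measurableT_comp (@measurable_ln R)); apply: measurable_funB.
apply: measurable_funM; last first.
  apply: (measurable_time (f := fun s => (t0 - s)^-1)).
  by apply: (measurableT_comp measurable_invr); apply: measurable_funB.
apply: measurable_funM => //; apply: (measurable_space (f := fun y => sqn (x - y))).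
apply: (measurableT_comp (@measurable_sqn R d)); exact: measurable_xsub.
Qed.

Lemma measurable_bdgauss i : measurable_fun (setT : set (RR * V)) (bdgauss nu t0 x i).
Proof.
apply: measurable_funM; last exact: measurable_bgauss.
apply: measurable_funM.
  apply: (measurable_space (f := fun y => (x - y) ord0 i)).
  by apply: (measurableT_comp (measurable_coor i)); exact: measurable_xsub.
apply: (measurable_time (f := fun s => (2 * nu * (t0 - s))^-1)); apply: (measurableT_comp measurable_invr).
by apply: measurable_funM => //; apply: measurable_funB.
Qed.

(** The common majorant of the dominated convergence arguments in spacetime that remove the two
    cut-offs. *)
Lemma integrable_dom (c b t1 : R) : 0 <= c -> 0 < b ->
  tl.-integrable setT (fun z : RR * V =>
    (c * \1_(`[0, t1]%classic : set R) z.1 * gauss nu b (x - z.2))%:E).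
Proof.
move=> c0 b0.
have m1 : measurable_fun (setT : set R) (fun s => c * \1_(`[0, t1]%classic : set R) s).
  by apply: measurable_funM => //; apply: measurable_indic; exact: measurable_itv.
have mg : measurable_fun (setT : set V) (fun y => gauss nu b (x - y)).
  exact: (measurableT_comp (measurable_gauss nu b) (measurable_xsub x)).
have p1 s : 0 <= c * \1_(`[0, t1]%classic : set R) s by rewrite mulr_ge0.
have p2 y : 0 <= gauss nu b (x - y) by exact: ltW (gauss_gt0 nu0 _ _).
apply/integrable12ltyP.
  apply/measurable_EFinP; apply: measurable_funM.
    exact: (measurable_time m1).
  exact: (measurable_space mg).
have E s : (\int[lam]_y `|(c * \1_(`[0, t1]%classic : set R) s * gauss nu b (x - y))%:E|
   = (c * \1_(`[0, t1]%classic : set R) s)%:E)%E.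
  under eq_integral => y _ do rewrite abse_EFin (ger0_norm (mulr_ge0 (p1 s) (p2 y))) EFinM.
  rewrite ge0_integralZl//; last 3 first.
  - exact/measurable_EFinP.
  - by move=> y _; rewrite lee_fin.
  - by rewrite lee_fin.
  by rewrite gauss_mass// mule1.
under eq_integral => s _ do rewrite E EFinM.
rewrite ge0_integralZl//; last first.
  by apply/measurable_EFinP; apply: measurable_indic; exact: measurable_itv.
have mA : measurable (`[0, t1]%classic : set RR) by exact: measurable_itv.
rewrite (integral_indic _ measurableT mA) setIT; apply: lte_mul_pinfty => //.
rewrite [X in (X < _)%E](_ : _ = mu `[0, t1]%classic)//.
by rewrite lebesgue_measure_itv /=; case: ifPn => _; rewrite ltry.
Qed.

(** Up to [t1] the distance to the pole is at least [t0 - t1]. The time [2 * t0] dominates both the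
    times of the kernel and the doubled times that [dgauss_le] produces. *)
Lemma bgauss_bound t1 : 0 <= t1 -> t1 < t0 -> exists C, [/\ 0 <= C,
  (forall z : R * V, 0 <= z.1 <= t1 -> bgauss nu t0 x z <= C * gauss nu (2 * t0) (x - z.2)) &
  (forall i (z : R * V), 0 <= z.1 <= t1 -> `|bdgauss nu t0 x i z| <= C * gauss nu (2 * t0) (x - z.2))].
Proof.
move=> t10 tt.
pose a := t0 - t1; have a0 : 0 < a by rewrite subr_gt0.
pose C1 := expR (d%:R / 2 * (ln (2 * t0) - ln a)).
pose C2 := @c2 R d * (Num.sqrt (nu * a))^-1 * expR (d%:R / 2 * (ln (2 * t0) - ln (2 * a))).
have C10 : 0 <= C1 by exact: expR_ge0.
have s0 : 0 < Num.sqrt (nu * a) by rewrite sqrtr_gt0 mulr_gt0.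
have cc : 0 <= @c2 R d * (Num.sqrt (nu * a))^-1.
  by rewrite mulr_ge0 ?invr_ge0 ?(ltW s0)// ltW// c2_gt0.
have C20 : 0 <= C2 by rewrite mulr_ge0// expR_ge0.
exists (C1 + C2); split.
- exact: addr_ge0.
- move=> z /andP[z0 z1]; apply: (@le_trans _ _ (C1 * gauss nu (2 * t0) (x - z.2))).
    by apply: gauss_le_between => //; rewrite /a; lra.
  by apply: ler_wpM2r; [exact: ltW (gauss_gt0 nu0 _ _)|rewrite lerDl].
- move=> i z /andP[z0 z1].
  have zt : 0 < t0 - z.1 by lra.
  apply: (@le_trans _ _ (C2 * gauss nu (2 * t0) (x - z.2))); last first.
    by apply: ler_wpM2r; [exact: ltW (gauss_gt0 nu0 _ _)|rewrite lerDr].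
  apply: le_trans (dgauss_le nu0 _ _ zt) _.
  rewrite /C2 -[X in _ <= X]mulrA; apply: ler_pM.
  + by rewrite mulr_ge0 ?invr_ge0 ?sqrtr_ge0// ltW// c2_gt0.
  + exact: ltW (gauss_gt0 nu0 _ _).
  + apply: ler_wpM2l; first by rewrite ltW// c2_gt0.
    rewrite lef_pV2 ?posrE ?sqrtr_gt0 ?mulr_gt0//.
    by apply: ler_wsqrtr; rewrite ler_pM2l// /a; lra.
  + by apply: gauss_le_between => //; rewrite /a; lra.
Qed.

End spacetime_measurability.

Section test_function.
Context {R : realType} {d : nat}.
Local Notation V := 'rV[R]_d.
Variable eta : V -> R.
Hypothesis heta : kernel_axioms eta.
Variable y0 : V.
Hypothesis y00 : 0 < eta y0.
Variable nu : R.
Hypothesis nu0 : 0 < nu.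
Variables (t0 t1 : R) (x : V) (Th Th' : R -> R).
Hypotheses (t10 : t1 < t0) (sTh : forall n, snear n setT Th)
  (dTh : forall s : R, is_derive s (1 : R) Th (Th' s)) (Th0 : forall s, t1 < s -> Th s = 0)
  (Thm : forall s, s < -1 -> Th s = 0).

Definition tst n (z : R * V) : R := cutfun eta y0 n z * ptest nu t0 x Th z.

Lemma Cc_infty_tst n : Cc_infty setT (tst n).
Proof.
have [[se ce _] _ _ _] := heta.
split => //.
  apply/smoothP => m; apply: snearM; [exact: openT|exact: snear_cut heta _ _ _|].
  exact: snear_ptest t10 sTh Th0 _.
pose g (y : V) : V := n.+1%:R *: (y - y0).
pose K : set (R * V) := `[-1, t1]%classic `*` (g @` tsupport eta).
have cK : compact K.
  apply: compact_setX; first exact: segment_compact.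
  apply: continuous_compact => //; apply: continuous_subspaceT => y.
  apply: (cvg_comp (fun y => y - y0) (fun y => n.+1%:R *: y)); last exact: scaler_continuous.
  by apply: (@cvgB R V _ (nbhs y) _ id (cst y0)); [exact: cvg_id|exact: cvg_cst].
apply: (subclosed_compact _ cK); first exact: closed_closure.
have -> : K = closure K.
  by apply/closure_id; apply: compact_closed cK; exact: norm_hausdorff.
apply: closure_subset => z.
rewrite /= /tst /ptest !mulf_eq0 !negb_or.
move=> /and3P[/andP[_ cz] Tz _].
split.
  rewrite /= in_itv /= !leNgt; apply/andP; split; apply/negP => H; move: Tz.
    by rewrite Thm ?eqxx.
  by rewrite Th0 ?eqxx.
exists (y0 + rescale n z).
  exact: subset_closure.
by rewrite /g [y0 + _]addrC addrK /rescale scalerA mulfV ?scale1r.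
Qed.

(** Sorts the integrand by derivatives of the space cut-off: as it tends to 1, only the terms with
    [Th'] times [bgauss] and with [Th] times [bdgauss] will survive. *)
Lemma tst_weak n (z : R * V) (u : R) (f : 'I_d -> R) :
  u * (dt (tst n) z + nu * \sum_(i < d) dx i (dx i (tst n)) z) + \sum_(i < d) f i * dx i (tst n) z =
  u * (cutfun eta y0 n z * (Th' z.1 * bgauss nu t0 x z) + nu * \sum_(i < d)
     (dx i (dx i (cutfun eta y0 n)) z * (Th z.1 * bgauss nu t0 x z)
       + 2 * (dx i (cutfun eta y0 n) z * (Th z.1 * bdgauss nu t0 x i z))))
  + \sum_(i < d) f i * (dx i (cutfun eta y0 n) z * (Th z.1 * bgauss nu t0 x z)
       + cutfun eta y0 n z * (Th z.1 * bdgauss nu t0 x i z)).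
Proof.
have sK m : snear m setT (cutfun eta y0 n) by exact: snear_cut.
have sp m : snear m setT (ptest nu t0 x Th) by exact: snear_ptest sTh Th0 m.
congr (u * _ + _); last first.
  by apply: eq_bigr => i _; rewrite (dx_mul sK sp) (dx_ptest nu0 x t10 dTh Th0).
rewrite (dt_mul sK sp) dt_cut// mul0r add0r.
rewrite -(heat_ptest nu0 x t10 dTh Th0) mulrDr -addrA; congr (_ + _).
rewrite mulrCA -mulrDr; congr (nu * _); rewrite mulr_sumr -big_split /=.
apply: eq_bigr => i _; rewrite (dxdx_mul sK sp) (dx_ptest nu0 x t10 dTh Th0) addrC.
by rewrite -/(ptest _ _ _ _ _).
Qed.
End test_function.

(** * Removal of the space cut-off *)

Section domination.
Context {R : realType} (I : finType).

(** The constants count terms: [3 * B] is one [B] from the second derivative of the cut-off and two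
    from the doubled cross term, and [2 * B] comes from the product rule in the flux. *)
Lemma integrand_le (u cu th th' bg g M B CB nu C : R) (f dd d1 bdg : I -> R) :
  0 <= M -> 0 <= B -> 0 <= nu -> 0 <= bg -> `|u| <= M -> (forall i, `|f i| <= M) ->
  `|cu| <= B -> (forall i, `|d1 i| <= B) -> (forall i, `|dd i| <= B) ->
  0 <= th <= 1 -> `|th'| <= CB -> bg <= C * g -> (forall i, `|bdg i| <= C * g) ->
  `|u * (cu * (th' * bg) + nu * \sum_i (dd i * (th * bg) + 2 * (d1 i * (th * bdg i))))
    + \sum_i f i * (d1 i * (th * bg) + cu * (th * bdg i))|
  <= M * (B * CB + nu * (3 * B) *+ #|I| + (2 * B) *+ #|I|) * (C * g).
Proof.
move=> M0 B0 n0 bg0 uM fM cB dB ddB /andP[th0 th1] thB bgC bdC.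
have G0 : 0 <= C * g by exact: le_trans bgC.
have CB0 : 0 <= CB by exact: le_trans thB.
have tb : `|th * bg| <= C * g.
  by rewrite ger0_norm ?mulr_ge0//; apply: le_trans bgC; rewrite ler_piMl.
have td i : `|th * bdg i| <= C * g.
  by rewrite normrM (ger0_norm th0); apply: le_trans (bdC i); rewrite ler_piMl.
set T3 := 3 * B; set T2 := 2 * B.
rewrite -mulrA !mulrDl mulrDr; apply: le_trans (ler_normD _ _) _; apply: lerD.
  rewrite normrM; apply: ler_pM => //; apply: le_trans (ler_normD _ _) _; apply: lerD.
    rewrite !normrM -mulrA; apply: ler_pM => //.
    by rewrite (ger0_norm bg0); apply: ler_pM.
  rewrite normrM (ger0_norm n0) -mulrnAr -mulrA ler_wpM2l//.
  apply: le_trans (ler_norm_sum _ _ _) _.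
  rewrite mulrnAl -sumr_const; apply: ler_sum => i _.
  have a1 : `|dd i * (th * bg)| <= B * (C * g) by rewrite normrM; apply: ler_pM.
  have a2 : `|d1 i * (th * bdg i)| <= B * (C * g) by rewrite normrM; apply: ler_pM.
  apply: le_trans (ler_normD _ _) _; rewrite [`|2 * _|]normrM (ger0_norm (_ : 0 <= 2))// /T3; lra.
apply: le_trans (ler_norm_sum _ _ _) _.
rewrite mulrnAl -sumr_const mulr_sumr; apply: ler_sum => i _.
rewrite normrM; apply: ler_pM => //.
have a1 : `|d1 i * (th * bg)| <= B * (C * g) by rewrite normrM; apply: ler_pM.
have a2 : `|cu * (th * bdg i)| <= B * (C * g) by rewrite normrM; apply: ler_pM.
by apply: le_trans (ler_normD _ _) _; rewrite /T2; lra.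
Qed.
End domination.

Lemma cvg_sumr (R : realType) (I : Type) (r : seq I) (f : nat -> I -> R) (l : I -> R) :
  (forall i, f n i @[n --> \oo] --> l i) ->
  \sum_(i <- r) f n i @[n --> \oo] --> \sum_(i <- r) l i.
Proof.
move=> fl; elim: r => [|i r IH].
  by under eq_fun do rewrite big_nil; rewrite big_nil; exact: cvg_cst.
by under eq_fun do rewrite big_cons; rewrite big_cons; exact: cvgD.
Qed.

Section weak_limit.
Context {R : realType} {d : nat}.
Local Notation V := 'rV[R]_d.
Local Notation mu := (@lebesgue_measure R).
Local Notation lam := (lebesgue_rV d).
Local Notation tl := (mu \x lam)%E.
Local Notation RR := (measurableTypeR R).
Variable eta : V -> R.
Hypothesis heta : kernel_axioms eta.
Variable nu : R.
Hypothesis nu0 : 0 < nu.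

(** The weak formulation without its initial term. The integral runs over all times, so [U] and [F]
    are meant to vanish at negative ones. *)
Definition weak_form (U : R * V -> R) (F : 'I_d -> R * V -> R) (phi : R * V -> R) : R :=
  \int[tl]_z (U z * (dt phi z + nu * \sum_(i < d) dx i (dx i phi) z)
              + \sum_(i < d) F i z * dx i phi z).

(** The flux is an independent datum, so the same limits serve the nonlocal and the local equation,
    and either component may be set to zero. *)
Definition flux_data (U : R * V -> R) (F : 'I_d -> R * V -> R) :=
  [/\ measurable_fun (setT : set (RR * V)) U,
      (forall i, measurable_fun (setT : set (RR * V)) (F i)),
      (forall z : R * V, z.1 < 0 -> U z = 0 /\ forall i, F i z = 0) &
      forall T : R, exists2 M, 0 <= M & {ae tl, forall z : RR * V, z.1 <= T ->
         `|U z| <= M /\ forall i, `|F i z| <= M}].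

Section fixed_test.
Variables (U : R * V -> R) (F : 'I_d -> R * V -> R).
Hypothesis UF : flux_data U F.
Variable y0 : V.
Hypothesis y00 : 0 < eta y0.
Variables (t0 t1 : R) (x : V) (Th Th' : R -> R) (CB : R).
Hypotheses (t1p : 0 <= t1) (t10 : t1 < t0) (sTh : forall n, snear n setT Th)
  (dTh : forall s : R, is_derive s (1 : R) Th (Th' s)) (Th0 : forall s, t1 < s -> Th s = 0)
  (Th01 : forall s, 0 <= s -> 0 <= Th s <= 1)
  (Th'B : forall s, 0 <= s -> `|Th' s| <= CB).

Definition limit_integrand (z : R * V) : R :=
  U z * (Th' z.1 * bgauss nu t0 x z) + \sum_(i < d) F i z * (Th z.1 * bdgauss nu t0 x i z).

Lemma measurable_Th : measurable_fun (setT : set (RR * V)) (fun z => Th z.1).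
Proof.
have cT : continuous Th by exact: snear_continuous.
exact: (measurable_time (continuous_measurable_fun cT)).
Qed.

Lemma measurable_Th' : measurable_fun (setT : set (RR * V)) (fun z => Th' z.1).
Proof.
have cT : continuous Th'.
  apply: snear_continuous => n; have -> : Th' = 'D_(1 : R) Th.
    by apply/funext => s; have [_ ->] := dTh s.
  exact: (sTh n.+1).2.
exact: (measurable_time (continuous_measurable_fun cT)).
Qed.

Lemma measurable_sumV (G : 'I_d -> R * V -> R) :
  (forall i, measurable_fun (setT : set (RR * V)) (G i)) ->
  measurable_fun (setT : set (RR * V)) (fun z => \sum_(i < d) G i z).
Proof. by move=> mG; apply: measurable_sum. Qed.

Lemma measurable_limit_integrand : measurable_fun (setT : set (RR * V)) limit_integrand.
Proof.
have [mU mF _ _] := UF.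
have mb := measurable_bgauss nu t0 x; have md := measurable_bdgauss nu t0 x.
apply: measurable_funD.
  by apply: measurable_funM => //; apply: measurable_funM => //; exact: measurable_Th'.
apply: measurable_sumV => i; apply: measurable_funM => //.
by apply: measurable_funM => //; exact: measurable_Th.
Qed.

Lemma measurable_rescaled (f : V -> R) n : continuous f ->
  measurable_fun (setT : set (RR * V)) (fun z => f (y0 + rescale n z)).
Proof.
move=> cf; have cg : continuous (fun y : V => f (y0 + n.+1%:R^-1 *: y)).
  move=> y; apply: (cvg_comp (fun y : V => y0 + n.+1%:R^-1 *: y) f); last exact: cf.
  apply: (@cvgD R V _ (nbhs y) _ (cst y0)); first exact: cvg_cst.
  exact: scaler_continuous.
exact: (measurable_space (continuous_measurable_rV cg)).
Qed.

Lemma weak_limit : tl.-integrable setT (EFin \o (limit_integrand : RR * V -> R)) /\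
  weak_form U F (tst eta y0 nu t0 x Th n) @[n --> \oo] --> \int[tl]_z limit_integrand z.
Proof.
have [mU mF U0 Ub] := UF.
have [M M0 aeM] := Ub t1.
have [B [B0 Bc Bd Bdd]] := cut_bounded heta y00.
have [C [C0 Cb Cd]] := bgauss_bound nu0 x t1p t10.
have CB0 : 0 <= CB by exact: le_trans (Th'B (lexx 0)).
have [[se ce _] _ _ _] := heta.
pose K := M * (B * CB + nu * (3 * B) *+ #|'I_d| + (2 * B) *+ #|'I_d|) * C.
pose cu n (z : R * V) := cutfun eta y0 n z.
pose d1 n i (z : R * V) := dx i (cutfun eta y0 n) z.
pose dd n i (z : R * V) := dx i (dx i (cutfun eta y0 n)) z.
pose bg := bgauss nu t0 x; pose bdg := bdgauss nu t0 x.
pose f n (z : R * V) := U z * (cu n z * (Th' z.1 * bg z) + nu * \sum_(i < d)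
     (dd n i z * (Th z.1 * bg z) + 2 * (d1 n i z * (Th z.1 * bdg i z))))
  + \sum_(i < d) F i z * (d1 n i z * (Th z.1 * bg z) + cu n z * (Th z.1 * bdg i z)).
have wf n : weak_form U F (tst eta y0 nu t0 x Th n) = \int[tl]_z f n z.
  apply: eq_Rintegral => z _; exact: (tst_weak heta y0 nu0 x t10 sTh dTh Th0).
have mb : measurable_fun (setT : set (RR * V)) bg := measurable_bgauss nu t0 x.
have md i : measurable_fun (setT : set (RR * V)) (bdg i) := measurable_bdgauss nu t0 x i.
have mT := measurable_Th; have mT' := measurable_Th'.
have mcu n : measurable_fun (setT : set (RR * V)) (cu n).
  by apply: measurable_funM => //; apply: measurable_rescaled; exact: smooth_continuous.
have md1 n i : measurable_fun (setT : set (RR * V)) (d1 n i).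
  rewrite /d1 (_ : dx i (cutfun eta y0 n) = fun z => (eta y0)^-1 * (n.+1%:R^-1 * partial i eta (y0 + rescale n z))); last first.
    by apply/funext => z; exact: dx_cut.
  apply: measurable_funM => //; apply: measurable_funM => //; apply: measurable_rescaled.
  by apply: smooth_continuous; exact: smooth_deriv.
have mdd n i : measurable_fun (setT : set (RR * V)) (dd n i).
  rewrite /dd (_ : dx i (dx i (cutfun eta y0 n)) = fun z => (eta y0)^-1 * (n.+1%:R^-1 * (n.+1%:R^-1 * partial i (partial i eta) (y0 + rescale n z)))); last first.
    by apply/funext => z; exact: dxdx_cut.
  do 3 apply: measurable_funM => //; apply: measurable_rescaled.
  by apply: smooth_continuous; do 2 apply: smooth_deriv.
have mf n : measurable_fun (setT : set (RR * V)) (f n).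
  apply: measurable_funD.
    apply: measurable_funM => //; apply: measurable_funD.
      by apply: measurable_funM => //; apply: measurable_funM.
    apply: measurable_funM => //; apply: measurable_sumV => i.
    apply: measurable_funD; first by apply: measurable_funM => //; apply: measurable_funM.
    by apply: measurable_funM => //; apply: measurable_funM => //; apply: measurable_funM.
  apply: measurable_sumV => i; apply: measurable_funM => //.
  by apply: measurable_funD; apply: measurable_funM => //; apply: measurable_funM.
have n1 n : n.+1%:R^-1 <= 1 :> R by rewrite invf_le1// ler1n.
have Bd' n i z : `|d1 n i z| <= B.
  by apply: le_trans (Bd n i z) _; rewrite ler_piMr.
have Bdd' n i z : `|dd n i z| <= B.
  by apply: le_trans (Bdd n i z) _; rewrite ler_piMr.
have cz (k : nat -> R) : (forall n, `|k n| <= B * n.+1%:R^-1) -> k n @[n --> \oo] --> (0 : R).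
  move=> kB; apply: norm_cvg0; apply: (squeeze_cvgr (f := fun=> 0) (h := fun n => B * n.+1%:R^-1)).
  - by apply: nearW => n; rewrite normr_ge0 kB.
  - exact: cvg_cst.
  - by rewrite -[X in _ --> X](mulr0 B); apply: cvgMr; exact: cvg_harmonic.
have cf z : f n z @[n --> \oo] --> limit_integrand z.
  have ccu : cu n z @[n --> \oo] --> (1 : R) by exact: cut_cvg.
  have c1 i : d1 n i z @[n --> \oo] --> (0 : R) by apply: cz => n; exact: Bd.
  have c2 i : dd n i z @[n --> \oo] --> (0 : R) by apply: cz => n; exact: Bdd.
  have c3 i : dd n i z * (Th z.1 * bg z) + 2 * (d1 n i z * (Th z.1 * bdg i z)) @[n --> \oo] -->
      0 * (Th z.1 * bg z) + 2 * (0 * (Th z.1 * bdg i z)).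
    by apply: cvgD; [exact: cvgMl|apply: cvgMr; exact: cvgMl].
  have c4 i : F i z * (d1 n i z * (Th z.1 * bg z) + cu n z * (Th z.1 * bdg i z)) @[n --> \oo] -->
      F i z * (0 * (Th z.1 * bg z) + 1 * (Th z.1 * bdg i z)).
    by apply: cvgMr; apply: cvgD; exact: cvgMl.
  rewrite (_ : limit_integrand z = U z * (1 * (Th' z.1 * bg z) + nu * \sum_(i < d)
     (0 * (Th z.1 * bg z) + 2 * (0 * (Th z.1 * bdg i z))))
   + \sum_(i < d) F i z * (0 * (Th z.1 * bg z) + 1 * (Th z.1 * bdg i z))); last first.
    rewrite mul1r big1 => [|i _]; last by rewrite !mul0r mulr0 addr0.
    rewrite mulr0 addr0 /limit_integrand; congr (_ + _); apply: eq_bigr => i _.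
    by rewrite mul0r add0r mul1r.
  apply: cvgD.
    apply: cvgMr; apply: cvgD; first exact: cvgMl.
    by apply: cvgMr; exact: cvg_sumr c3.
  exact: cvg_sumr c4.
have K0 : 0 <= K.
  by rewrite mulr_ge0// mulr_ge0// !addr_ge0 ?mulrn_wge0 ?mulr_ge0// ltW.
have t0p : 0 < 2 * t0 by rewrite mulr_gt0// (le_lt_trans t1p).
have dom := integrable_dom nu0 x t1 K0 t0p.
have [||||i1 _ i2] := @dominated_convergence _ _ _ tl setT measurableT
  (fun n => EFin \o (f n : RR * V -> R)) (EFin \o (limit_integrand : RR * V -> R)) _ _ _ _ dom.
- by move=> n; apply/measurable_EFinP.
- by apply/measurable_EFinP; exact: measurable_limit_integrand.
- by apply: aeW => z _; apply: cvg_EFin; [exact: nearW|exact: cf].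
- move: aeM; apply: filterS => z zM n _.
  rewrite abse_EFin lee_fin.
  have dom0 : 0 <= K * \1_(`[0, t1]%classic : set R) z.1 * gauss nu (2 * t0) (x - z.2).
    by apply: mulr_ge0; [apply: mulr_ge0|exact: ltW (gauss_gt0 nu0 _ _)].
  (* Three ranges of time: before 0 the data vanish, after [t1] the functions [Th] and [Th'] vanish,
     and in between the Gaussian bounds apply. *)
  have [zn|zp] := ltP z.1 0.
    have [Uz Fz] := U0 z zn.
    rewrite /f Uz mul0r big1 => [|i _]; last by rewrite Fz mul0r.
    by rewrite addr0 normr0; exact: dom0.
  have [zt|zt] := ltP t1 z.1.
    have -> : f n z = 0; last by rewrite normr0; exact: dom0.
    rewrite /f (Th0 zt) (Th'0 dTh Th0 zt) big1 => [|i _]; last by rewrite !mul0r !mulr0 addr0.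
    rewrite big1 => [|i _]; last by rewrite !mul0r !mulr0 addr0 mulr0.
    by rewrite !mul0r !mulr0 !addr0 mulr0.
  have [UM FM] := zM zt.
  have z01 : 0 <= z.1 <= t1 by rewrite zp zt.
  rewrite indicE mem_set; last by rewrite /= in_itv.
  rewrite mulr1 /K -[X in _ <= X]mulrA.
  apply: integrand_le => //.
  + exact: ltW.
  + exact: ltW (gauss_gt0 nu0 _ _).
  + exact: Th01.
  + exact: Th'B.
  + exact: Cb.
  + by move=> i; exact: Cd.
split => //.
under eq_fun do rewrite wf.
apply: fine_cvg; rewrite fineK; last exact: integrable_fin_num i1.
exact: i2.
Qed.
End fixed_test.
End weak_limit.

(** * Removal of the time cut-off *)

Section plateau_limit.
Context {R : realType} {d : nat}.
Local Notation V := 'rV[R]_d.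
Local Notation mu := (@lebesgue_measure R).
Local Notation lam := (lebesgue_rV d).
Local Notation tl := (mu \x lam)%E.
Local Notation RR := (measurableTypeR R).
Variable nu : R.
Hypothesis nu0 : 0 < nu.

Lemma dominated_Rintegral (x : V) (K b t1 : R) (f : nat -> R * V -> R) (g : R * V -> R) :
  0 <= K -> 0 < b ->
  (forall n, measurable_fun (setT : set (RR * V)) (f n)) ->
  measurable_fun (setT : set (RR * V)) g ->
  (forall z, f n z @[n --> \oo] --> g z) ->
  {ae tl, forall z : RR * V, forall n,
     `|f n z| <= K * \1_(`[0, t1]%classic : set R) z.1 * gauss nu b (x - z.2)} ->
  tl.-integrable setT (EFin \o (g : RR * V -> R)) /\
  \int[tl]_z f n z @[n --> \oo] --> \int[tl]_z g z.
Proof.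
move=> K0 b0 mf mg cf aef; have dom := integrable_dom nu0 x t1 K0 b0.
have [||||i1 _ i2] := @dominated_convergence _ _ _ tl setT measurableT
  (fun n => EFin \o (f n : RR * V -> R)) (EFin \o (g : RR * V -> R)) _ _ _ _ dom.
- by move=> n; apply/measurable_EFinP.
- exact/measurable_EFinP.
- by apply: aeW => z _; apply: cvg_EFin; [exact: nearW|exact: cf].
- by move: aef; apply: filterS => z zM n _; rewrite abse_EFin lee_fin.
split => //; apply: fine_cvg; rewrite fineK; last exact: integrable_fin_num i1.
exact: i2.
Qed.

Definition is_plateau (t h : R) (Th Th' be : R -> R) : Prop :=
  [/\ (forall n, snear n setT Th) /\ (forall s : R, is_derive s (1 : R) Th (Th' s)),
      [/\ (forall s, s < -1 -> Th s = 0), (forall s, t + h <= s -> Th s = 0),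
          (forall s, 0 <= s <= t -> Th s = 1) & (forall s, 0 <= s -> 0 <= Th s <= 1)],
      (forall s, 0 <= s -> Th' s = - be s) &
      [/\ continuous be, (forall s, 0 <= be s), (forall s, s <= t \/ t + h <= s -> be s = 0),
        mu.-integrable setT (EFin \o be) & (\int[mu]_s (be s)%:E = 1)%E]].

Lemma plateau_bound (t h : R) (Th Th' be : R -> R) : 0 < h -> is_plateau t h Th Th' be ->
  exists2 B, 0 <= B & forall s, be s <= B.
Proof.
move=> h0 [_ _ _ [cb b_ge0 bz _ _]].
have tt1 : t <= t + h by rewrite lerDl ltW.
have [c _ H] := EVT_max tt1 (continuous_subspaceT cb).
exists (be c) => // s; have [st|st] := ltP s t; first by rewrite bz//; left; exact: ltW.
have [s1|s1] := ltP (t + h) s; first by rewrite bz//; right; exact: ltW.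
by apply: H; rewrite in_itv /= st s1.
Qed.

Variables (U : R * V -> R) (F : 'I_d -> R * V -> R).
Hypothesis UF : flux_data U F.
Hypothesis UL1 : forall s, 0 <= s -> (L1norm (fun y => U (s, y)) < +oo)%E.
Variables (t delta : R) (x : V).
Hypotheses (t0 : 0 <= t) (delta0 : 0 < delta).

(** At s = t the kernel is the Gaussian of time [delta], and this is the mollification of U(t, .)
    evaluated at [x]. *)
Definition heat_pairing s : R := \int[lam]_y (U (s, y) * bgauss nu (t + delta) x (s, y)).

Definition duhamel : R := \int[tl]_(z in cylinder `[0, t])
  \sum_(i < d) F i z * bdgauss nu (t + delta) x i z.

(** Continuity from the right is the relevant notion, as the densities [be n] live to the right of
    [t]; this also covers t = 0. *)
Hypothesis rcont : forall e, 0 < e -> exists2 r, 0 < r &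
  forall s, t <= s <= t + r -> `|heat_pairing s - heat_pairing t| <= e.

(** The factor 1/2 makes all plateaus end by [t + delta / 2], at a fixed distance from the pole
    [t + delta]. *)
Definition hstep (n : nat) : R := delta / 2 * n.+1%:R^-1.

Lemma hstep_gt0 n : 0 < hstep n.
Proof. by rewrite mulr_gt0// divr_gt0. Qed.

Lemma hstep_le n : hstep n <= delta / 2.
Proof. by rewrite ler_piMr ?invf_le1 ?ler1n// divr_ge0// ltW. Qed.

Lemma hstep_cvg : hstep n @[n --> \oo] --> (0 : R).
Proof. by rewrite -[X in _ --> X](mulr0 (delta / 2)); apply: cvgMr; exact: cvg_harmonic. Qed.

Variables (Th Th' be : nat -> R -> R).
Hypothesis pl : forall n, is_plateau t (hstep n) (Th n) (Th' n) (be n).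

Let t1 := t + delta / 2.

Let t1t0 : t1 < t + delta.
Proof. by rewrite /t1 ltrD2l ltr_pdivrMr// ltr_pMr// ltr1n. Qed.

Lemma measurable_Thn n : measurable_fun (setT : set (RR * V)) (fun z => Th n z.1).
Proof. by have [[sT _] _ _ _] := pl n; exact: measurable_Th. Qed.

Lemma plateau_zero n s : t1 < s -> Th n s = 0.
Proof.
have [_ [_ T0 _ _] _ _] := pl n.
by move=> ts; apply: T0; apply: le_trans (ltW ts); rewrite lerD2l hstep_le.
Qed.

(** At nonnegative times [Th n] tends to the indicator of [0, t]; at negative times [F] vanishes, so
    the rise of the plateau is invisible. *)
Lemma flux_limit : \int[tl]_z (\sum_(i < d) F i z * (Th n z.1 * bdgauss nu (t + delta) x i z))
  @[n --> \oo] --> duhamel.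
Proof.
have [mU mF U0 Ub] := UF.
have [M M0 aeM] := Ub t1.
have t1p : 0 <= t1 by rewrite addr_ge0// ltW// divr_gt0.
have [C [C0 Cb Cd]] := bgauss_bound nu0 x t1p t1t0.
pose S (z : R * V) := \sum_(i < d) F i z * bdgauss nu (t + delta) x i z.
have mS : measurable_fun (setT : set (RR * V)) S.
  by apply: measurable_sumV => i; apply: measurable_funM => //; exact: measurable_bdgauss.
pose g (z : R * V) := \1_(`[0, t]%classic : set R) z.1 * S z.
have mI : measurable_fun (setT : set (RR * V)) (fun z : RR * V => \1_(`[0, t]%classic : set R) z.1 : R).
  apply: (measurable_time (f := \1_(`[0, t]%classic : set R))).
  by apply: measurable_indic; exact: measurable_itv.
have K0 : 0 <= M * C *+ d by rewrite mulrn_wge0// mulr_ge0.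
have b0 : 0 < 2 * (t + delta) by rewrite mulr_gt0// ltr_wpDl.
have E n z : \sum_(i < d) F i z * (Th n z.1 * bdgauss nu (t + delta) x i z) = Th n z.1 * S z.
  by rewrite /S mulr_sumr; apply: eq_bigr => i _; rewrite mulrCA.
have [||||_] := @dominated_Rintegral x (M * C *+ d) (2 * (t + delta)) t1
  (fun n z => Th n z.1 * S z) g K0 b0.
- by move=> n; apply: measurable_funM => //; exact: measurable_Thn.
- exact: measurable_funM.
- move=> z; have [zn|zp] := ltP z.1 0.
    have Sz : S z = 0.
      by rewrite /S big1// => i _; have [_ ->] := U0 _ zn; rewrite mul0r.
    by rewrite /g Sz mulr0; under eq_fun do rewrite mulr0; exact: cvg_cst.
  apply: cvgMl; have [zt|zt] := leP z.1 t.
    rewrite indicE mem_set; last by rewrite /= in_itv /= zp zt.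
    rewrite (_ : (fun n => _) = fun=> 1); first exact: cvg_cst.
    by apply/funext => n; have [_ [_ _ T1 _] _ _] := pl n; rewrite T1// zp zt.
  rewrite indicE memNset; last by rewrite /= in_itv /= zp leNgt zt.
  apply: cvg_near_cst.
  have zt0 : 0 < z.1 - t by rewrite subr_gt0.
  have [N _ HN] := cvgr0_norm_lt _ hstep_cvg _ zt0; exists N => // n /HN /=.
  rewrite gtr0_norm ?hstep_gt0// => hn.
  by have [_ [_ T0 _ _] _ _] := pl n; rewrite T0// -lerBrDl ltW.
- move: aeM; apply: filterS => z zM n.
  have dom0 : 0 <= M * C *+ d * \1_(`[0, t1]%classic : set R) z.1 * gauss nu (2 * (t + delta)) (x - z.2).
    by apply: mulr_ge0; [apply: mulr_ge0|exact: ltW (gauss_gt0 nu0 _ _)].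
  have [zn|zp] := ltP z.1 0.
    have -> : S z = 0.
      by rewrite /S big1// => i _; have [_ ->] := U0 _ zn; rewrite mul0r.
    by rewrite mulr0 normr0.
  have [zt|zt] := ltP t1 z.1; first by rewrite plateau_zero// mul0r normr0.
  have [_ FM] := zM zt.
  have z01 : 0 <= z.1 <= t1 by rewrite zp zt.
  rewrite indicE mem_set; last by rewrite /= in_itv.
  have [_ [_ _ _ T01] _ _] := pl n.
  have /andP[Tn0 Tn1] := T01 _ zp.
  rewrite mulr1 normrM (ger0_norm Tn0); apply: (@le_trans _ _ `|S z|); first by rewrite ler_piMl.
  apply: le_trans (ler_norm_sum _ _ _) _.
  have -> : M * C *+ d * gauss nu (2 * (t + delta)) (x - z.2) =
      \sum_(i < d) M * (C * gauss nu (2 * (t + delta)) (x - z.2)).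
    by rewrite sumr_const card_ord mulrnAl mulrA.
  apply: ler_sum => i _.
  by rewrite normrM; apply: ler_pM => //; exact: Cd.
move=> H; have -> : duhamel = \int[tl]_z g z; last first.
  have -> : (fun n => \int[tl]_z (\sum_(i < d) F i z * (Th n z.1 * bdgauss nu (t + delta) x i z)))
    = (fun n => \int[tl]_z (Th n z.1 * S z)).
    by apply/funext => n; apply: eq_Rintegral => z _; exact: E.
  exact: H.
rewrite /duhamel /Rintegral integral_mkcond; congr fine; apply: eq_integral => z _.
rewrite patchE /g; case: ifPn => zc.
  by rewrite indicE mem_set ?mul1r//; move: zc; rewrite inE => -[].
rewrite indicE memNset ?mul0r//; move: zc; rewrite notin_setE => zc zt.
by apply: zc; split.
Qed.

Lemma heat_integrable s : 0 <= s <= t1 ->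
  lam.-integrable setT (fun y => (U (s, y) * bgauss nu (t + delta) x (s, y))%:E).
Proof.
move=> /andP[s0 s1]; have [mU _ _ _] := UF.
have mUs : measurable_fun setT (fun y => U (s, y)).
  exact: (measurableT_comp mU (@pair1_measurable _ _ _ _ (s : RR))).
have mbs : measurable_fun setT (fun y => bgauss nu (t + delta) x (s, y)).
  exact: (measurableT_comp (measurable_bgauss nu _ x) (@pair1_measurable _ _ _ _ (s : RR))).
pose c := @gK R d nu * expR (- (d%:R / 2) * ln (delta / 2)).
have i1 : lam.-integrable setT (fun y => c%:E * (U (s, y))%:E)%E.
  by apply: integrableZl => //; exact: L1norm_integrable (UL1 s0).
apply: (le_integrable _ _ _ i1) => //.
  by apply/measurable_EFinP; exact: measurable_funM.
move=> y _; rewrite -EFinM !abse_EFin lee_fin [U _ * _]mulrC [X in X <= _]normrM [X in _ <= X]normrM; apply: ler_pM => //.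
rewrite [X in X <= _]ger0_norm; last by apply: ltW; exact: gauss_gt0.
apply: le_trans (ler_norm _); apply: gauss_ub => //.
  by rewrite divr_gt0.
by rewrite /= lerBrDr; move: s1; rewrite /t1; lra.
Qed.

(** By Fubini this is minus the mean of [heat_pairing] for the probability density [be n], which
    concentrates at [t] from the right. *)
Lemma time_limit : \int[tl]_z (U z * (Th' n z.1 * bgauss nu (t + delta) x z))
  @[n --> \oo] --> - heat_pairing t.
Proof.
have [mU mF U0 Ub] := UF.
have [M M0 aeM] := Ub t1.
have t1p : 0 <= t1 by rewrite addr_ge0// ltW// divr_gt0.
have [C [C0 Cb Cd]] := bgauss_bound nu0 x t1p t1t0.
have b0 : 0 < 2 * (t + delta) by rewrite mulr_gt0// ltr_wpDl.
have mb : measurable_fun (setT : set (RR * V)) (bgauss nu (t + delta) x) by exact: measurable_bgauss.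
pose f n (z : R * V) := be n z.1 * (U z * bgauss nu (t + delta) x z).
have mf n : measurable_fun (setT : set (RR * V)) (f n).
  have [_ _ _ [cb _ _ _ _]] := pl n.
  by apply: measurable_funM; [exact: (measurable_time (continuous_measurable_fun cb))|exact: measurable_funM].
have fE n z : U z * (Th' n z.1 * bgauss nu (t + delta) x z) = - f n z.
  have [zn|zp] := ltP z.1 0.
    by have [Uz _] := U0 _ zn; rewrite /f Uz !mul0r mulr0 oppr0.
  have [_ _ T' _] := pl n.
  by rewrite T'// /f mulNr mulrN mulrCA.
have be0 n s : s < t \/ t1 < s -> be n s = 0.
  have [_ _ _ [_ _ bz _ _]] := pl n => -[st|st]; apply: bz; [left; exact: ltW|right].
  by apply: le_trans (ltW st); rewrite lerD2l hstep_le.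
have if_ n : tl.-integrable setT (EFin \o (f n : RR * V -> R)).
  have [_ _ _ [cb b_ge0 bz _ _]] := pl n.
  have [B B0 HB] := plateau_bound (hstep_gt0 n) (pl n).
  (* Used with a constant sequence, dominated convergence merely yields the integrability of
     [f n]. *)
  have [|||||//] := @dominated_Rintegral x (B * (M * C)) (2 * (t + delta)) t1 (fun=> f n) (f n) _ b0.
  - by rewrite !mulr_ge0.
  - by [].
  - exact: mf.
  - by move=> z; exact: cvg_cst.
  move: aeM; apply: filterS => z zM _.
  have dom0 : 0 <= B * (M * C) * \1_(`[0, t1]%classic : set R) z.1 * gauss nu (2 * (t + delta)) (x - z.2).
    by apply: mulr_ge0; [rewrite !mulr_ge0|exact: ltW (gauss_gt0 nu0 _ _)].
  have [zn|zp] := ltP z.1 0.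
    by have [Uz _] := U0 _ zn; rewrite /f Uz mul0r mulr0 normr0.
  have [zt|zt] := ltP t1 z.1; first by rewrite /f be0 ?mul0r ?normr0//; right.
  have [UM _] := zM zt.
  have z01 : 0 <= z.1 <= t1 by rewrite zp zt.
  rewrite indicE mem_set; last by rewrite /= in_itv.
  rewrite mulr1 /f normrM [`|U z * _|]normrM -!mulrA; apply: ler_pM => //.
    by rewrite ger0_norm.
  apply: ler_pM => //; rewrite ger0_norm; first exact: Cb.
  exact: ltW (gauss_gt0 nu0 _ _).
pose G n s := be n s * heat_pairing s.
have GE n s : fubini_F lam (EFin \o (f n : RR * V -> R)) s = (G n s)%:E.
  rewrite /fubini_F /= /f /G.
  have [st|st] := ltP s t.
    by rewrite be0 ?mul0r; [under eq_integral do rewrite mul0r; rewrite integral0|left].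
  have [s1|s1] := ltP t1 s.
    by rewrite be0 ?mul0r; [under eq_integral do rewrite mul0r; rewrite integral0|right].
  have s01 : 0 <= s <= t1 by rewrite (le_trans t0 st) s1.
  transitivity ((be n s)%:E * \int[lam]_y (U (s, y) * bgauss nu (t + delta) x (s, y))%:E)%E.
    rewrite -(integralZl measurableT (heat_integrable s01)); apply: eq_integral => y _.
    by rewrite EFinM.
  by rewrite EFinM /heat_pairing /Rintegral fineK//; exact: integrable_fin_num (heat_integrable s01).
have iG n : mu.-integrable setT (EFin \o G n).
  have := integrable_fubini_F (if_ n).
  by congr (integrable _ _ _); apply/funext => s; rewrite GE.
have IG n : \int[tl]_z f n z = \int[mu]_s G n s.
  rewrite /Rintegral -(integral12_prod_meas1 (if_ n)); congr fine.
  by apply: eq_integral => s _; rewrite GE.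
have E n : \int[tl]_z (U z * (Th' n z.1 * bgauss nu (t + delta) x z)) = - \int[mu]_s G n s.
  rewrite -IG -mulN1r -(RintegralZl _ measurableT (if_ n)).
  by apply: eq_Rintegral => z _; rewrite fE mulN1r.
under eq_fun do rewrite E.
apply: cvgN; apply/cvgrPdist_le => e e0.
have [r r0 Hr] := rcont e0.
have [N _ HN] := cvgr0_norm_le _ hstep_cvg _ r0; exists N => // n /HN /=.
rewrite gtr0_norm ?hstep_gt0// => hr.
have [_ _ _ [cb b_ge0 bz ib mb1]] := pl n.
have ibe (a : R) : mu.-integrable setT (fun s => (be n s * a)%:E).
  rewrite (_ : (fun s => _) = (fun s => a%:E * (be n s)%:E)%E); last first.
    by apply/funext => s; rewrite -EFinM mulrC.
  exact: integrableZl.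
have Ibe a : \int[mu]_s (be n s * a) = a.
  rewrite /Rintegral; under eq_integral do rewrite mulrC EFinM.
  by rewrite integralZl// mb1 mule1.
rewrite -[in X in X <= _](Ibe (heat_pairing t)) -RintegralB//; last exact: ibe.
apply: le_trans (le_normr_Rintegral _ _) _ => //.
  have := integrableB measurableT (ibe (heat_pairing t)) (iG n).
  by congr (integrable _ _ _).
rewrite -[X in _ <= X](Ibe e); apply: le_Rintegral => //.
- have := integrable_abse (integrableB measurableT (ibe (heat_pairing t)) (iG n)).
  by congr (integrable _ _ _); apply/funext => s.
- exact: ibe.
move=> s _; rewrite /G -mulrBr normrM (ger0_norm (b_ge0 s)).
have [st|st] := ltP s t; first by rewrite (bz s) ?mul0r//; left; exact: ltW.
have [s1|s1] := ltP (t + hstep n) s; first by rewrite (bz s) ?mul0r//; right; exact: ltW.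
apply: ler_wpM2l => //; rewrite distrC; apply: Hr.
by rewrite st (le_trans s1)// lerD2l.
Qed.
End plateau_limit.

(** * The mild formulation *)

Section mild.
Context {R : realType} {d : nat}.
Local Notation V := 'rV[R]_d.
Local Notation mu := (@lebesgue_measure R).
Local Notation lam := (lebesgue_rV d).
Local Notation tl := (mu \x lam)%E.
Local Notation RR := (measurableTypeR R).
Variable eta : V -> R.
Hypotheses (hd : (1 <= d)%N) (heta : kernel_axioms eta).
Variable nu : R.
Hypothesis nu0 : 0 < nu.

Definition right_continuous_pairing (U : R * V -> R) t delta x :=
  forall e, 0 < e -> exists2 r, 0 < r & forall s, t <= s <= t + r ->
    `|heat_pairing nu U t delta x s - heat_pairing nu U t delta x t| <= e.

(** Setting one component to zero in [weak_limit] gives the integrability of each half of the limit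
    integrand separately, which is needed to split the integral. *)
Lemma flux_dataU (U : R * V -> R) (F : 'I_d -> R * V -> R) : flux_data U F -> flux_data U (fun _ _ => 0).
Proof.
move=> [mU mF U0 Ub]; split => // [z z0|T]; first by have [-> _] := U0 z z0.
have [M M0 aeM] := Ub T; exists M => //; move: aeM; apply: filterS => z H /H[? _].
by split => // i; rewrite normr0.
Qed.

Lemma flux_dataF (U : R * V -> R) (F : 'I_d -> R * V -> R) : flux_data U F -> flux_data (fun=> 0) F.
Proof.
move=> [mU mF U0 Ub]; split => // [z z0|T]; first by have [_ ?] := U0 z z0.
have [M M0 aeM] := Ub T; exists M => //; move: aeM; apply: filterS => z H /H[_ ?].
by split => //; rewrite normr0.
Qed.

Lemma weak_form_plateau (U : R * V -> R) (F : 'I_d -> R * V -> R) (y0 : V) t delta x h Th Th' be :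
  0 < eta y0 -> flux_data U F -> 0 <= t -> 0 < h -> h < delta -> is_plateau t h Th Th' be ->
  weak_form nu U F (tst eta y0 nu (t + delta) x Th n) @[n --> \oo] -->
  \int[tl]_z (U z * (Th' z.1 * bgauss nu (t + delta) x z)) +
  \int[tl]_z (\sum_(i < d) F i z * (Th z.1 * bdgauss nu (t + delta) x i z)).
Proof.
move=> y00 UF t0 h0 hdelta pl.
have [B B0 HB] := plateau_bound h0 pl.
have [[sT dT] [T1 T0 _ T01] T' [_ b0 _ _ _]] := pl.
have th0 : 0 <= t + h by rewrite addr_ge0// ltW.
have tt : t + h < t + delta by rewrite ltrD2l.
have T0' s : t + h < s -> Th s = 0 by move=> /ltW/T0.
have T'B s : 0 <= s -> `|Th' s| <= B by move=> s0; rewrite T'// normrN ger0_norm.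
have [_ cv] := weak_limit heta nu0 UF y00 x th0 tt sT dT T0' T01 T'B.
have [i1 _] := weak_limit heta nu0 (flux_dataU UF) y00 x th0 tt sT dT T0' T01 T'B.
have [i2 _] := weak_limit heta nu0 (flux_dataF UF) y00 x th0 tt sT dT T0' T01 T'B.
have E1 : limit_integrand nu U (fun _ _ => 0) (t + delta) x Th Th' =
    (fun z => U z * (Th' z.1 * bgauss nu (t + delta) x z)).
  apply/funext => z; rewrite /limit_integrand big1 ?addr0// => i _.
  by rewrite mul0r.
have E2 : limit_integrand nu (fun=> 0) F (t + delta) x Th Th' =
    (fun z => \sum_(i < d) F i z * (Th z.1 * bdgauss nu (t + delta) x i z)).
  by apply/funext => z; rewrite /limit_integrand mul0r add0r.
rewrite E1 in i1; rewrite E2 in i2.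
by rewrite -RintegralD.
Qed.

(** The limits are iterated: the space cut-off goes first, with the plateau fixed, and then the
    plateau shrinks to [0, t]. Since the two weak forms agree before the limits, so do the
    limits. *)
Theorem mild_identity (U W : R * V -> R) (F G : 'I_d -> R * V -> R) t delta x :
  flux_data U F -> flux_data W G ->
  (forall s, 0 <= s -> (L1norm (fun y => U (s, y)) < +oo)%E) ->
  (forall s, 0 <= s -> (L1norm (fun y => W (s, y)) < +oo)%E) ->
  (forall phi, Cc_infty setT phi -> weak_form nu U F phi = weak_form nu W G phi) ->
  0 <= t -> 0 < delta ->
  right_continuous_pairing U t delta x -> right_continuous_pairing W t delta x ->
  heat_pairing nu U t delta x t - heat_pairing nu W t delta x t =
  duhamel nu F t delta x - duhamel nu G t delta x.
Proof.
move=> UF WG UL1 WL1 eqw t0 delta0 rU rW.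
have [y0 y00] := eta_pt heta.
have /choice[P HP] : forall n, exists p : (R -> R) * (R -> R) * (R -> R),
    is_plateau t (hstep delta n) p.1.1 p.1.2 p.2.
  move=> n; have [Th [Th' [be H]]] := plateau_exists hd heta t0 (hstep_gt0 delta0 n).
  by exists ((Th, Th'), be).
pose Th n := (P n).1.1; pose Th' n := (P n).1.2; pose be n := (P n).2.
have pl n : is_plateau t (hstep delta n) (Th n) (Th' n) (be n) by exact: HP.
have hdelta n : hstep delta n < delta.
  by apply: (le_lt_trans (hstep_le delta0 n)); rewrite ltr_pdivrMr// ltr_pMr// ltr1n.
have E n : \int[tl]_z (U z * (Th' n z.1 * bgauss nu (t + delta) x z)) +
  \int[tl]_z (\sum_(i < d) F i z * (Th n z.1 * bdgauss nu (t + delta) x i z)) =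
  \int[tl]_z (W z * (Th' n z.1 * bgauss nu (t + delta) x z)) +
  \int[tl]_z (\sum_(i < d) G i z * (Th n z.1 * bdgauss nu (t + delta) x i z)).
  have cU := weak_form_plateau (x := x) y00 UF t0 (hstep_gt0 delta0 n) (hdelta n) (pl n).
  have cW := weak_form_plateau (x := x) y00 WG t0 (hstep_gt0 delta0 n) (hdelta n) (pl n).
  have eqs : (fun m => weak_form nu U F (tst eta y0 nu (t + delta) x (Th n) m)) =
             (fun m => weak_form nu W G (tst eta y0 nu (t + delta) x (Th n) m)); last first.
    by rewrite eqs in cU; apply: cvg_unique cU cW.
  apply/funext => m; apply: eqw.
  have [[sT dT] [T1 T0 _ _] _ _] := pl n.
  apply: (@Cc_infty_tst _ _ eta heta y0 nu (t + delta) (t + hstep delta n) x (Th n)) => //.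
  - by rewrite ltrD2l.
  - by move=> s /ltW/T0.
have cU := cvgD (time_limit nu0 UF UL1 t0 delta0 rU pl) (flux_limit nu0 UF t0 delta0 pl).
have cW := cvgD (time_limit nu0 WG WL1 t0 delta0 rW pl) (flux_limit nu0 WG t0 delta0 pl).
have : - heat_pairing nu U t delta x t + duhamel nu F t delta x =
       - heat_pairing nu W t delta x t + duhamel nu G t delta x.
  have {}cU : \int[tl]_z (U z * (Th' n z.1 * bgauss nu (t + delta) x z)) +
    \int[tl]_z (\sum_(i < d) F i z * (Th n z.1 * bdgauss nu (t + delta) x i z)) @[n --> \oo] -->
    - heat_pairing nu U t delta x t + duhamel nu F t delta x by exact: cU.
  have {}cW : \int[tl]_z (W z * (Th' n z.1 * bgauss nu (t + delta) x z)) +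
    \int[tl]_z (\sum_(i < d) G i z * (Th n z.1 * bdgauss nu (t + delta) x i z)) @[n --> \oo] -->
    - heat_pairing nu W t delta x t + duhamel nu G t delta x by exact: cW.
  rewrite (funext E) in cU.
  by apply: cvg_unique cU cW; exact: norm_hausdorff.
move=> H; lra.
Qed.
End mild.

(** * Null sets in product spaces *)

Section almost_everywhere_product.
Context d1 d2 (T1 : measurableType d1) (T2 : measurableType d2) {R : realType}.
Variables (m1 : {sigma_finite_measure set T1 -> \bar R}) (m2 : {sigma_finite_measure set T2 -> \bar R}).

(** The measures of the sections of a null set integrate to 0, so almost all of them vanish. *)
Lemma ae_iterated (P : T1 * T2 -> Prop) :
  {ae (m1 \x m2)%E, forall z, P z} -> {ae m1, forall x, {ae m2, forall y, P (x, y)}}.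
Proof.
move=> [A [mA A0 HA]].
have mS : measurable_fun setT (fun x => m2 (xsection A x)) by exact: measurable_fun_xsection.
have I0 : (\int[m1]_x `|m2 (xsection A x)| = 0)%E.
  under eq_integral do rewrite gee0_abs//.
  exact: A0.
have := (ae_eq_integral_abs m1 measurableT mS).1 I0.
apply: filterS => x /(_ Logic.I) Sx; exists (xsection A x); split => //.
- exact: measurable_xsection.
- by move=> y /= nP; rewrite /xsection /= inE; apply: HA.
Qed.

Lemma ae_fst (Q : T1 -> Prop) :
  {ae m1, forall x, Q x} -> {ae (m1 \x m2)%E, forall z, Q z.1}.
Proof.
move=> [A [mA A0 HA]]; exists (A `*` setT); split.
- exact: measurableX.
- by rewrite (product_measure1E m1 m2 mA measurableT) [X in (X * _)%E]A0 mul0e.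
- by move=> z /= nQ; split => //; exact: HA.
Qed.
End almost_everywhere_product.

(** * Continuity in time *)

Section time_continuity.
Context {R : realType} {d : nat}.
Local Notation V := 'rV[R]_d.
Local Notation mu := (@lebesgue_measure R).
Local Notation lam := (lebesgue_rV d).
Local Notation tl := (mu \x lam)%E.
Local Notation RR := (measurableTypeR R).

Lemma C0_Lp_int (k : nat) T (u : R -> V -> R) s e : (0 < k)%N -> C0_Lp T (k%:R)%:E u ->
  0 <= s <= T -> 0 < e -> exists2 r, 0 < r & forall t, 0 <= t <= T -> `|t - s| <= r ->
    (\int[lam]_y (`|u t y - u s y| ^+ k)%:E <= e%:E)%E.
Proof.
move=> k0 [_ uc] sT e0.
have kR0 : k%:R != 0 :> R by rewrite pnatr_eq0 -lt0n.
(* Since e1 <= 1 and k > 0, the k-th power of e1 is at most e1, hence at most e. *)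
pose e1 := Num.min e 1.
have e10 : 0 < e1 by rewrite lt_min e0 ltr01.
have := uc s; rewrite /= in_itv /= sT => /(_ isT) /cvge0P -/(_ (fun=> Lnorm_ge0 _ _ _)) /(_ e1 e10).
rewrite near_withinE => /nbhs_ballP[r /= r0 H].
exists (r / 2); first by rewrite divr_gt0.
move=> t tT ts.
have := H t; rewrite /ball /= in_itv /= tT => /(_ _ isT) Ht.
have {}Ht : ('N[lam]_(k%:R)%:E[EFin \o (u t \- u s)%R] <= e1%:E)%E.
  by apply: Ht; rewrite distrC (le_lt_trans ts)// ltr_pdivrMr// ltr_pMr// ltr1n.
have -> : (\int[lam]_y (`|u t y - u s y| ^+ k)%:E = 'N[lam]_(k%:R)%:E[EFin \o (u t \- u s)%R] `^ k%:R)%E.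
  rewrite poweR_Lnorm//; apply: eq_integral => y _.
  have -> : (`|(EFin \o (u t \- u s)%R) y|)%E = (`|u t y - u s y|)%:E by [].
  by rewrite poweR_EFin powR_mulrn.
apply: (@le_trans _ _ (e1%:E `^ k%:R)%E).
  apply: gt0_ler_poweR => //; rewrite in_itv /= ?leey ?andbT.
  - exact: Lnorm_ge0.
  - by rewrite lee_fin ltW.
rewrite poweR_EFin lee_fin powR_mulrn ?(ltW e10)//.
rewrite -(prednK k0) exprS; apply: (@le_trans _ _ e1); last by rewrite ge_min lexx.
rewrite ler_piMr ?(ltW e10)// exprn_ile1// ?(ltW e10)//.
by rewrite ge_min lexx orbT.
Qed.

Lemma pairing_small (k : nat) (c e : R) : k = 1%N \/ k = 2%N -> 0 < c -> 0 < e ->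
  exists2 e1, 0 < e1 & forall z g : V -> R, measurable_fun setT z -> measurable_fun setT g ->
    (forall y, 0 <= g y <= c) -> (\int[lam]_y (g y)%:E = 1)%E ->
    (\int[lam]_y (`|z y| ^+ k)%:E <= e1%:E)%E ->
    (\int[lam]_y (`|z y| * g y)%:E <= e%:E)%E.
Proof.
move=> kk c0 e0.
(* For [k = 2]: [|z| g <= (c / e) |z|^2 + e / (4 c) g^2] and [g^2 <= c g]. *)
pose e1 := if k == 1%N then e / c else e / 2 * (e / c).
exists e1 => [|z g mz mg gc g1].
  have ec : 0 < e / c by exact: divr_gt0.
  by rewrite /e1; case: ifP => _ //; apply: mulr_gt0 => //; exact: divr_gt0.
have [k1 | k2] := kk; rewrite /e1.
  rewrite k1 /= => H; apply: (@le_trans _ _ (\int[lam]_y (c%:E * (`|z y| ^+ 1)%:E))%E).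
    apply: ge0_le_integral => //.
    - by move=> y _; rewrite lee_fin mulr_ge0//; have /andP[] := gc y.
    - by apply/measurable_EFinP; apply: measurable_funM => //; exact: measurableT_comp.
    - apply: measurable_funeM; apply/measurable_EFinP.
      by apply: measurable_funX; exact: measurableT_comp.
    move=> y _; rewrite -EFinM lee_fin expr1 mulrC ler_wpM2r//.
    by have /andP[] := gc y.
  rewrite ge0_integralZl//; last 2 first.
  - by apply/measurable_EFinP; apply: measurable_funX; exact: measurableT_comp.
  - by rewrite lee_fin ltW.
  apply: (@le_trans _ _ (c%:E * (e / c)%:E)%E); first by apply: lee_wpmul2l => //; rewrite lee_fin ltW.
  by rewrite -EFinM mulrC divfK// gt_eqF.
rewrite k2 /= => H.
have mz2 : measurable_fun setT (fun y => (`|z y| ^+ 2)%:E).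
  by apply/measurable_EFinP; apply: measurable_funX; exact: measurableT_comp.
apply: (@le_trans _ _ (\int[lam]_y ((c / e)%:E * (`|z y| ^+ 2)%:E + (e / 4)%:E * (g y)%:E))%E).
  apply: ge0_le_integral => //.
  - by move=> y _; rewrite lee_fin mulr_ge0//; have /andP[] := gc y.
  - by apply/measurable_EFinP; apply: measurable_funM => //; exact: measurableT_comp.
  - apply: emeasurable_funD; apply: measurable_funeM => //.
    exact/measurable_EFinP.
  move=> y _; rewrite -!EFinM -EFinD lee_fin.
  have /andP[gy0 gyc] := gc y.
  set a := `|z y|; set b := g y.
  have b2 : e / (4 * c) * b ^+ 2 <= e / 4 * b.
    rewrite invfM -!mulrA ler_pM2l// ler_pM2l ?invr_gt0//.
    by rewrite -ler_pdivlMl ?invr_gt0// invrK expr2 ler_wpM2r.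
  apply: le_trans (_ : _ <= c / e * a ^+ 2 + e / (4 * c) * b ^+ 2) _; last by rewrite lerD2l.
  rewrite -subr_ge0.
  have -> : c / e * a ^+ 2 + e / (4 * c) * b ^+ 2 - a * b = (c / e) * (a - e / (2 * c) * b) ^+ 2.
    by field; rewrite !gt_eqF.
  by rewrite mulr_ge0 ?sqr_ge0// divr_ge0// ltW.
rewrite ge0_integralD//; last 4 first.
- by move=> y _; rewrite mule_ge0// lee_fin ?exprn_ge0// divr_ge0// ltW.
- exact: measurable_funeM.
- by move=> y _; rewrite mule_ge0// lee_fin; [rewrite divr_ge0// ltW|have /andP[] := gc y].
- by apply: measurable_funeM; exact/measurable_EFinP.
rewrite !ge0_integralZl//; last 4 first.
- exact/measurable_EFinP.
- by move=> y _; rewrite lee_fin; have /andP[] := gc y.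
- by rewrite lee_fin divr_ge0// ltW.
- by rewrite lee_fin divr_ge0// ltW.
rewrite g1 mule1.
apply: (@le_trans _ _ ((c / e)%:E * (e / 2 * (e / c))%:E + (e / 4)%:E)%E).
  by apply: leeD => //; apply: lee_wpmul2l => //; rewrite lee_fin divr_ge0// ltW.
rewrite -EFinM -EFinD lee_fin.
have -> : c / e * (e / 2 * (e / c)) = e / 2 by field; rewrite !gt_eqF.
by lra.
Qed.

Lemma integrable_bounded_mul (f g : V -> R) c : measurable_fun setT f -> measurable_fun setT g ->
  (L1norm f < +oo)%E -> (forall y, `|g y| <= c) ->
  lam.-integrable setT (fun y => (f y * g y)%:E).
Proof.
move=> mf mg f1 gc.
have i1 : lam.-integrable setT (fun y => c%:E * (f y)%:E)%E.
  by apply: integrableZl => //; exact: L1norm_integrable.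
apply: (le_integrable _ _ _ i1) => //.
  by apply/measurable_EFinP; exact: measurable_funM.
move=> y _; rewrite -EFinM !abse_EFin lee_fin mulrC !normrM; apply: ler_pM => //.
exact: le_trans (gc y) (ler_norm _).
Qed.

Variable nu : R.
Hypothesis nu0 : 0 < nu.

Lemma continuous_bgauss_time t0 x s (y : V) : s < t0 -> {for s, continuous (fun s => bgauss nu t0 x (s, y))}.
Proof.
move=> st.
have [df _] := hasD_bgauss nu0 x (z := (s, y)) 0 st.
have cb := differentiable_continuous df.
apply: (@cvg_comp _ _ _ (fun s : R => (s, y)) (bgauss nu t0 x) _ _ _ _ cb).
by apply: (cvg_pair (G := nbhs s) (H := nbhs y)); [exact: cvg_id|exact: cvg_cst].
Qed.

(** The exponent covers both problems: continuity in L^2 for the nonlocal solution, in L^1 for the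
    local one. The increment is split into that of U against the kernel at time s, small by
    [pairing_small], and that of the kernel against U(t, .), handled by [h]. *)
Lemma right_continuous_C0 (k : nat) (u : R -> V -> R) (U : R * V -> R) t delta x :
  k = 1%N \/ k = 2%N -> (forall T, 0 < T -> C0_Lp T (k%:R)%:E u) ->
  measurable_fun (setT : set (RR * V)) U ->
  (forall s y, 0 <= s -> U (s, y) = u s y) ->
  (forall s, 0 <= s -> (L1norm (fun y => U (s, y)) < +oo)%E) ->
  0 <= t -> 0 < delta -> right_continuous_pairing nu U t delta x.
Proof.
move=> kk uC mU Uu UL1 t0 delta0 e e0.
have d20 : 0 < delta / 2 by rewrite divr_gt0.
have e20 : 0 < e / 2 by rewrite divr_gt0.
pose c := @gK R d nu * expR (- (d%:R / 2) * ln (delta / 2)).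
have c0 : 0 < c by rewrite mulr_gt0 ?gK_gt0// expR_gt0.
pose bg s y := bgauss nu (t + delta) x (s, y).
have bgc s y : s <= t + delta / 2 -> 0 <= bg s y <= c.
  move=> sd; apply/andP; split; first exact: ltW (gauss_gt0 nu0 _ _).
  apply: gauss_ub => //; rewrite /=; lra.
have bgn s y : s <= t + delta / 2 -> `|bg s y| <= c.
  by move=> /bgc-/(_ y)/andP[b0 bc]; rewrite ger0_norm.
have mbg s : measurable_fun setT (bg s).
  exact: (measurableT_comp (measurable_bgauss nu _ x) (@pair1_measurable _ _ _ _ (s : RR))).
have mUs s : measurable_fun setT (fun y => U (s, y)).
  exact: (measurableT_comp mU (@pair1_measurable _ _ _ _ (s : RR))).
have mass s : s <= t + delta / 2 -> (\int[lam]_y (bg s y)%:E = 1)%E.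
  move=> st; have ts : 0 < t + delta - s by lra.
  exact: (gauss_mass nu0 x ts).
have [e1 e10 He1] := pairing_small kk c0 e20.
have tT : 0 <= t <= t + delta by rewrite t0 lerDl ltW.
have k0 : (0 < k)%N by case: kk => ->.
have T0 : 0 < t + delta by rewrite ltr_wpDl.
have [r1 r10 Hr1] := C0_Lp_int k0 (uC _ T0) tT e10.
pose h s := \int[lam]_y (U (t, y) * bg s y).
have ch : {for t, continuous h}.
  have In : (t : R) \in (`](t - 1)%R, (t + delta / 2)%R[%classic : set R).
    by rewrite inE /= in_itv /=; apply/andP; split; lra.
  apply: (@continuity_under_integral _ _ _ lam (fun s y => U (t, y) * bg s y) setT measurableT
    (t - 1) (t + delta / 2) _ _ (fun y => `|U (t, y)| * c) _ _ t In).
  - move=> s /=; rewrite in_itv /= => /andP[_ /ltW sd].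
    by apply: (@integrable_bounded_mul _ _ c) => //; [exact: UL1|move=> y; exact: bgn].
  - apply: aeW => y _ s; rewrite inE /= in_itv /= => /andP[_ sd].
    apply: cvgMr; apply: continuous_bgauss_time; lra.
  - apply: (@integrable_bounded_mul _ _ c) => //.
    + exact: measurableT_comp.
    + by rewrite /L1norm; under eq_integral do rewrite normr_id; exact: UL1.
    + by move=> y; rewrite gtr0_norm.
  - move=> s /=; rewrite in_itv /= => /andP[_ /ltW sd].
    by apply: aeW => y _; rewrite normrM ler_wpM2l// bgn.
have /cvgrPdist_le /(_ _ e20) /nbhs_ballP[r2 /= r20 Hr2] := ch.
exists (Num.min (delta / 2) (Num.min r1 (r2 / 2))).
  by rewrite !lt_min d20 r10 divr_gt0.
move=> s /andP[ts]; rewrite -lerBlDl !le_min => /and3P[s1 s2 s3].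
have sd : s <= t + delta / 2 by rewrite -lerBlDl.
have s0 : 0 <= s by exact: le_trans ts.
have iU a b : 0 <= a -> b <= t + delta / 2 ->
    lam.-integrable setT (EFin \o (fun y => U (a, y) * bg b y)).
  by move=> a0 bd; apply: (@integrable_bounded_mul _ _ c) => //; [exact: UL1|move=> y; exact: bgn].
have td : t <= t + delta / 2 by rewrite lerDl ltW.
have -> : heat_pairing nu U t delta x s - heat_pairing nu U t delta x t =
    \int[lam]_y (U (s, y) * bg s y - U (t, y) * bg s y) + (h s - h t).
  rewrite RintegralB//; [|exact: iU|exact: iU].
  rewrite /heat_pairing /h -!/(bg _ _).
  by rewrite addrA subrK.
rewrite [e](splitr e); apply: le_trans (ler_normD _ _) _; apply: lerD; last first.
  rewrite distrC; apply: Hr2; rewrite /ball /= distrC ger0_norm ?subr_ge0//.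
  by rewrite (le_lt_trans s3)// ltr_pdivrMr// ltr_pMr// ltr1n.
apply: le_trans (le_normr_Rintegral _ _) _ => //.
  have := integrableB measurableT (iU s s s0 sd) (iU t s t0 sd).
  by congr (integrable _ _ _).
have iab : lam.-integrable setT (EFin \o (fun y => `|U (s, y) * bg s y - U (t, y) * bg s y|)).
  exact: (integrable_abse (integrableB measurableT (iU s s s0 sd) (iU t s t0 sd))).
rewrite -lee_fin /Rintegral fineK; last exact: integrable_fin_num iab.
have := He1 (fun y => U (s, y) - U (t, y)) (bg s) _ (mbg s) (fun y => bgc s y sd) (mass s sd) _.
have -> : (\int[lam]_y (`|U (s, y) - U (t, y)| * bg s y)%:E =
           \int[lam]_y `|U (s, y) * bg s y - U (t, y) * bg s y|%:E)%E.
  apply: eq_integral => y _; rewrite -mulrBl normrM (ger0_norm (_ : 0 <= bg s y))//.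
  by have /andP[] := bgc s y sd.
apply; first exact: measurable_funB.
under eq_integral do rewrite !Uu//.
apply: Hr1; last by rewrite ger0_norm ?subr_ge0.
by rewrite s0 (le_trans sd)// lerD2l ler_pdivrMr// ler_pMr// ler1n.
Qed.
End time_continuity.

(** * Flux data of the two problems *)

Section solutions.
Context {R : realType} {d : nat}.
Local Notation V := 'rV[R]_d.
Local Notation mu := (@lebesgue_measure R).
Local Notation lam := (lebesgue_rV d).
Local Notation tl := (mu \x lam)%E.
Local Notation RR := (measurableTypeR R).
Implicit Types (u : R -> V -> R).

Lemma lipschitz_coor (b : R -> V) : lipschitz b -> exists2 L, 0 < L &
  forall i r s, `|b r ord0 i - b s ord0 i| <= L * `|r - s|.
Proof.
move=> [M [Mr HM]].
(* [lipschitz] supplies the inequality for constants strictly above [M]. *)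
pose L := Num.max M 0 + 1.
have ML : M < L by rewrite ltr_pwDr// le_max lexx.
have L0 : 0 < L by rewrite ltr_pwDr// le_max lexx orbT.
exists L => // i r s.
have := HM L ML (r, s) (conj Logic.I Logic.I) => /=.
apply: le_trans.
have -> : b r ord0 i - b s ord0 i = (b r - b s) ord0 i by rewrite !mxE.
rewrite [X in _ <= X]mx_normrE.
exact: (le_trans _ (@le_bigmax _ _ _ 0 (fun ij : 'I_1 * 'I_d => `|(b r - b s) ij.1 ij.2|) (ord0, i))).
Qed.

Lemma kernel_facts (eta : V -> R) : kernel_axioms eta ->
  [/\ measurable_fun setT eta, forall x, 0 <= eta x, (exists B, forall x, eta x <= B) &
      (\int[lam]_x (eta x)%:E = 1)%E].
Proof.
move=> [ce _ e0 e1]; have [se _ _] := ce; split => //.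
- exact: continuous_measurable_rV (smooth_continuous se).
- have [B HB] := Cc_infty_bounded ce; exists B => x; exact: le_trans (ler_norm _) (HB x).
move: e1; rewrite /Rintegral; case: (\int[lam]_x (eta x)%:E)%E => [r|/=|/=].
- by move=> /= ->.
- by move=> /eqP; rewrite eq_sym oner_eq0.
- by move=> /eqP; rewrite eq_sym oner_eq0.
Qed.

(** A solution is unconstrained at negative times. The extension by zero turns integrals over the
    half-space of nonnegative times into integrals over the whole space. *)
Definition ext u (z : R * V) : R := if 0 <= z.1 then u z.1 z.2 else 0.

Lemma ext_ge0 u s y : 0 <= s -> ext u (s, y) = u s y.
Proof. by move=> s0; rewrite /ext /= s0. Qed.

Lemma ext_lt0 u (z : R * V) : z.1 < 0 -> ext u z = 0.
Proof. by move=> z0; rewrite /ext leNgt z0. Qed.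

Lemma measurable_cylinder (A : set R) : measurable (A : set RR) ->
  measurable (cylinder A : set (RR * V)).
Proof. by move=> mA; exact: measurableX. Qed.

Lemma measurable_ext u : measurable_fun (cylinder `[0, +oo[) (fun z : R * V => u z.1 z.2) ->
  measurable_fun (setT : set (RR * V)) (ext u).
Proof.
move=> mu_; rewrite (_ : ext u = (fun z : R * V => u z.1 z.2) \_ (cylinder `[0, +oo[)).
  apply/(measurable_restrictT _ _).1 => //.
  by apply: measurable_cylinder; exact: measurable_itv.
apply/funext => z; rewrite /ext patchE; case: ifPn => z0; case: ifPn => // zc.
  by move: zc; rewrite notin_setE => -[]; split => //=; rewrite in_itv /= z0.
by move: zc; rewrite inE => -[/=]; rewrite in_itv /= andbT (negbTE z0).
Qed.

Lemma measurable_slice (U : R * V -> R) s : measurable_fun (setT : set (RR * V)) U ->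
  measurable_fun setT (fun y => U (s, y)).
Proof. by move=> mU; exact: (measurableT_comp mU (@pair1_measurable _ _ _ _ (s : RR))). Qed.

Lemma L1norm_ext u s : (forall t, 0 <= t -> ('N[lam]_1[EFin \o u t] < +oo)%E) ->
  (L1norm (fun y => ext u (s, y)) < +oo)%E.
Proof.
move=> H; have [s0|s0] := leP 0 s.
  rewrite (_ : (fun y => _) = u s); last by apply/funext => y; rewrite ext_ge0.
  by have := H s s0; rewrite Lnorm1.
rewrite /L1norm; under eq_integral do rewrite ext_lt0// normr0.
by rewrite integral0.
Qed.

Lemma ext_bounded u T : Linfty_on `[0, T] u ->
  exists2 M, 0 <= M & {ae tl, forall z : RR * V, z.1 <= T -> `|ext u z| <= M}.
Proof.
move=> [M [A [mA A0 HA]]]; exists `|M| => //; exists A; split => //.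
move=> z nP; apply: HA => /= H; apply: nP => /= zT.
have [z0|z0] := leP 0 z.1; last by rewrite ext_lt0// normr0.
rewrite /ext z0; apply: le_trans (ler_norm M); apply: H; split => //=.
by rewrite in_itv /= z0.
Qed.

Variables (b : R -> V) (nu : R) (ubar : V -> R).
Hypothesis hb : lipschitz b.

Definition local_flux u (i : 'I_d) (z : R * V) : R := ext u z * b (ext u z) ord0 i.

Definition nonlocal_flux (k : V -> R) u (i : 'I_d) (z : R * V) : R :=
  ext u z * b (convolution (fun y => ext u (z.1, y)) k z.2) ord0 i.

Lemma measurable_b i : measurable_fun (setT : set R) (fun r => b r ord0 i).
Proof.
have [L L0 HL] := lipschitz_coor hb.
apply: continuous_measurable_fun => r; apply/cvgrPdist_le => e e0.
apply/nbhs_ballP; exists (e / L) => /=; first by rewrite divr_gt0.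
move=> s /ltW rs; apply: le_trans (HL i r s) _.
by rewrite -ler_pdivlMl// mulrC.
Qed.

Lemma b_bound M : exists2 B, 0 <= B & forall i r, `|r| <= M -> `|b r ord0 i| <= B.
Proof.
have [L L0 HL] := lipschitz_coor hb.
exists (\sum_i `|b 0 ord0 i| + L * `|M|).
  by rewrite addr_ge0 ?sumr_ge0// mulr_ge0// ltW.
move=> i r rM; rewrite -[b r ord0 i](subrK (b 0 ord0 i)).
apply: le_trans (ler_normD _ _) _; rewrite addrC; apply: lerD.
  by rewrite (bigD1 i)//= lerDl sumr_ge0.
apply: le_trans (HL _ _ _) _; rewrite subr0 ler_pM2l//.
exact: le_trans rM (ler_norm _).
Qed.

Lemma measurable_conv_st (k : V -> R) (U : R * V -> R) : measurable_fun setT k ->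
  measurable_fun (setT : set (RR * V)) U ->
  measurable_fun (setT : set (RR * V)) (fun z => convolution (fun y => U (z.1, y)) k z.2).
Proof.
move=> mk mU.
apply: (@measurable_Rintegral_rV R _ (RR * V)%type d (fun p => U (p.1.1, p.2) * k (p.1.2 - p.2))).
apply: measurable_funM.
  apply: (measurableT_comp mU); apply/measurable_fun_pairP; split; last exact: measurable_snd.
  exact: (measurableT_comp measurable_fst measurable_fst).
apply: (measurableT_comp mk); apply: measurable_rVD.
  exact: (measurableT_comp measurable_snd measurable_fst).
by apply: measurable_rVN; exact: measurable_snd.
Qed.

Lemma local_flux_data u : measurable_fun (setT : set (RR * V)) (ext u) ->
  (forall T, 0 < T -> Linfty_on `[0, T] u) -> flux_data (ext u) (local_flux u).
Proof.
move=> mU bU; split => //.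
- move=> i; apply: measurable_funM => //; exact: (measurableT_comp (measurable_b i) mU).
- by move=> z z0; rewrite /local_flux ext_lt0//; split => // i; rewrite mul0r.
move=> T; have T0 : 0 < Num.max T 1 by rewrite lt_max ltr01 orbT.
have [M M0 aeM] := ext_bounded (bU _ T0).
have [B B0 HB] := b_bound M.
exists (M + M * B); first by rewrite addr_ge0// mulr_ge0.
move: aeM; apply: filterS => z H zT.
have {}H : `|ext u z| <= M by apply: H; rewrite le_max zT.
split=> [|i]; first by rewrite (le_trans H)// lerDl mulr_ge0.
rewrite normrM; apply: (@le_trans _ _ (M * B)); last by rewrite lerDr.
by apply: ler_pM => //; exact: HB.
Qed.

(** The bound almost everywhere in spacetime gives, at almost every time, a bound almost everywhere
    in space, and therefore a bound on the convolution at every point. *)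
Lemma nonlocal_flux_data (eta : V -> R) eps u : kernel_axioms eta -> 0 < eps ->
  measurable_fun (setT : set (RR * V)) (ext u) ->
  (forall s, (L1norm (fun y => ext u (s, y)) < +oo)%E) ->
  (forall T, 0 < T -> Linfty_on `[0, T] u) ->
  flux_data (ext u) (nonlocal_flux (eta_ eta eps) u).
Proof.
move=> /kernel_facts[mk k0 [Bk kB] k1] eps0 mU L1 bU; split => //.
- move=> i; apply: measurable_funM => //; apply: (measurableT_comp (measurable_b i)).
  by apply: measurable_conv_st => //; exact: measurable_eta_.
- by move=> z z0; rewrite /nonlocal_flux ext_lt0//; split => // i; rewrite mul0r.
move=> T; have T0 : 0 < Num.max T 1 by rewrite lt_max ltr01 orbT.
have [M M0 aeM] := ext_bounded (bU _ T0).
have [B B0 HB] := b_bound M.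
exists (M + M * B); first by rewrite addr_ge0// mulr_ge0.
have aeC : {ae tl, forall z : RR * V, z.1 <= Num.max T 1 ->
    `|convolution (fun y => ext u (z.1, y)) (eta_ eta eps) z.2| <= M}.
  have := ae_iterated aeM => aeS.
  have {}aeS : {ae mu, forall s : RR, forall x, s <= Num.max T 1 ->
      `|convolution (fun y => ext u (s, y)) (eta_ eta eps) x| <= M}.
    move: aeS; apply: filterS => s H x sT.
    apply: (conv_ub mk k0 kB k1) => //.
    - exact: measurable_slice.
    - by move: H; apply: filterS => y /(_ sT).
  by move: (ae_fst lam aeS); apply: filterS => z; exact.
move: aeM aeC; apply: filterS2 => z H1 H2 zT.
have zT' : z.1 <= Num.max T 1 by rewrite le_max zT.
have {}H1 := H1 zT'; have {}H2 := H2 zT'.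
split=> [|i]; first by rewrite (le_trans H1)// lerDl mulr_ge0.
rewrite normrM; apply: (@le_trans _ _ (M * B)); last by rewrite lerDr.
by apply: ler_pM => //; exact: HB.
Qed.

(** The value depends on [ubar] and [phi] only, which is why the nonlocal and the local weak forms
    coincide. *)
Lemma distributional_weak_form u (v : R -> V -> V) F phi :
  distributional_solution nu ubar v u ->
  (forall i (z : R * V), 0 <= z.1 -> F i z = u z.1 z.2 * v z.1 z.2 ord0 i) ->
  (forall i (z : R * V), z.1 < 0 -> F i z = 0) -> Cc_infty setT phi ->
  weak_form nu (ext u) F phi = - \int[lam]_x (ubar x * phi (0, x)).
Proof.
move=> du F1 F0 cphi; have := du phi cphi; move/eqP; rewrite addr_eq0 => /eqP <-.
rewrite /weak_form /Rintegral [in RHS]integral_mkcond; congr fine.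
apply: eq_integral => z _; rewrite patchE.
have zc : (z \in cylinder `[0, +oo[) = (0 <= z.1).
  apply/idP/idP; first by rewrite inE => -[/=]; rewrite in_itv /= andbT.
  by move=> z0; rewrite inE; split => //=; rewrite in_itv /= z0.
rewrite zc; case: ifPn => z0.
  rewrite /ext z0; congr (_%:E); rewrite !mulrDr -!addrA; congr (_ + _).
  rewrite addrC; congr (_ + _); rewrite mulr_sumr; apply: eq_bigr => i _.
  by rewrite F1// mulrA.
rewrite /ext (negbTE z0) mul0r big1 ?addr0// => i _.
by rewrite F0 ?mul0r// ltNge.
Qed.
End solutions.

(** * Duhamel terms *)

Section time_kernel.
Context {R : realType}.
Local Notation mu := (@lebesgue_measure R).
Local Notation RR := (measurableTypeR R).

(* The singular kernel of the Duhamel formula damped at rate [l]: its integral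
   is bounded by a multiple of [l^(-1/2)], which replaces Gronwall's lemma. *)
Definition tker (t0 l s : R) : R := (Num.sqrt (t0 - s))^-1 * (1 + l * (t0 - s))^-1.

Lemma tker_ge0 t0 l s : 0 <= l -> s <= t0 -> 0 <= tker t0 l s.
Proof.
move=> l0 st; rewrite mulr_ge0 ?invr_ge0 ?sqrtr_ge0//.
by rewrite addr_ge0// mulr_ge0// subr_ge0.
Qed.

Lemma measurable_tker t0 l : measurable_fun (setT : set RR) (tker t0 l).
Proof.
have mtau : measurable_fun (setT : set RR) (fun s => t0 - s) by exact: measurable_funB.
apply: measurable_funM; apply: (measurableT_comp (@measurable_invr R)).
  apply: (@measurableT_comp _ _ _ _ _ _ (@Num.sqrt R)) => //.
  apply: continuous_measurable_fun; exact: sqrt_continuous.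
by apply: measurable_funD => //; exact: measurable_funM.
Qed.

(** The primitive -(2 / sqrt l) atan(sqrt(l (t0 - s))) is explicit. Two values of atan differ by
    less than pi < 4, whence the constant 8. *)
Lemma integral_tker t t0 l : 0 <= t -> t < t0 -> 0 < l ->
  (\int[mu]_(s in `[0%R, t]) (tker t0 l s)%:E <= (8 / Num.sqrt l)%:E)%E.
Proof.
move=> tp tt0 l0.
have sl0 : 0 < Num.sqrt l by rewrite sqrtr_gt0.
have [t0p|tn0] := ltP 0 t; last first.
  have -> : t = 0 by apply/eqP; rewrite eq_le tn0 tp.
  by rewrite set_itv1 integral_set1 lee_fin divr_ge0// ltW.
pose F s := - (2 / Num.sqrt l) * atan (Num.sqrt l * Num.sqrt (t0 - s)).
have dF (s : R) : s <= t -> is_derive s (1 : R) F (tker t0 l s).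
  move=> st; have ts : 0 < t0 - s by lra.
  have s2 : 0 < Num.sqrt (t0 - s) by rewrite sqrtr_gt0.
  have h0 : hasD (fun s : R => t0 - s) s 1 (- 1).
    rewrite -[- 1 : R]add0r; apply: hasDD; first exact: hasD_cst.
    by apply: hasDN; split; [exact: ex_diff|rewrite derive_id].
  have h1 := @hasD_comp1 _ _ (@Num.sqrt R) _ (fun s : R => t0 - s) s 1 _ (is_derive1_sqrt ts) h0.
  have h2 := hasDZ (Num.sqrt l) h1.
  have h3 := @hasD_comp1 _ _ (@atan R) _ (fun s : R => Num.sqrt l * Num.sqrt (t0 - s)) s 1 _ (is_derive1_atan _) h2.
  have h4 := hasDZ (- (2 / Num.sqrt l)) h3.
  apply: hasD_is_derive.
  have -> : tker t0 l s = - (2 / Num.sqrt l) *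
     ((1 + (Num.sqrt l * Num.sqrt (t0 - s)) ^+ 2)^-1 *
       (Num.sqrt l * ((2 * Num.sqrt (t0 - s))^-1 * -1))); last exact: h4.
  rewrite /tker exprMn !sqr_sqrtr ?(ltW l0) ?(ltW ts)//.
  have d0 : 1 + l * (t0 - s) != 0 by rewrite gt_eqF// ltr_wpDr// mulr_ge0// ltW.
  by field; rewrite d0 !gt_eqF.
have cF (s : R) : s <= t -> {for s, continuous F}.
  move=> /dF[df _]; apply: differentiable_continuous; exact/derivable1_diffP.
have ck (s : R) : s <= t -> {for s, continuous (tker t0 l)}.
  move=> st; have ts : 0 < t0 - s by lra.
  have cs : {for s, continuous (fun s : R => t0 - s)}.
    by apply: cvgB; [exact: cvg_cst|exact: cvg_id].
  apply: cvgM; apply: cvgV.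
  - by rewrite gt_eqF// sqrtr_gt0.
  - by apply: (cvg_comp (fun s : R => t0 - s) (@Num.sqrt R)); [exact: cs|exact: sqrt_continuous].
  - by rewrite gt_eqF// ltr_wpDr// mulr_ge0// ltW.
  - by apply: cvgD; [exact: cvg_cst|apply: cvgMr; exact: cs].
have wt : {within `[0, t], continuous (tker t0 l)}.
  apply: continuous_in_subspaceT => s; rewrite inE /= in_itv /= => /andP[_ st].
  exact: ck.
rewrite (continuous_FTC2 (F := F) t0p wt).
- rewrite -EFinB lee_fin /F.
  have a1 := atan_gtNpi2 (Num.sqrt l * Num.sqrt (t0 - t)).
  have a2 := atan_ltpi2 (Num.sqrt l * Num.sqrt (t0 - 0)).
  have /andP[_ p2] := @pihalf_02 R.
  set A := atan (_ * Num.sqrt (t0 - t)) in a1 *; set B := atan _ in a2 *.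
  rewrite (_ : - (2 / Num.sqrt l) * A - - (2 / Num.sqrt l) * B = (2 * (B - A)) / Num.sqrt l); last first.
    by field; rewrite gt_eqF.
  rewrite ler_pM2r ?invr_gt0//; lra.
- split.
  + move=> s; rewrite in_itv /= => /andP[_ /ltW st].
    by have [] := dF s st.
  + apply: cvg_at_right_filter; exact: cF.
  + apply: cvg_at_left_filter; exact: cF.
- move=> s; rewrite in_itv /= => /andP[_ /ltW st].
  by rewrite derive1E; have [_ ->] := dF s st.
Qed.

(** Write exp(l s) = exp(l t0) exp(-l (t0 - s)) and use exp(-a) <= 1/(1 + a): the rational damping
    has an elementary primitive. *)
Lemma exp_tker t0 l s : 0 < l -> s <= t0 ->
  expR (l * s) * (Num.sqrt (t0 - s))^-1 <= expR (l * t0) * tker t0 l s.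
Proof.
move=> l0 st; rewrite /tker [X in _ <= _ * X]mulrC mulrA.
apply: ler_wpM2r; first by rewrite invr_ge0 sqrtr_ge0.
have d0 : 0 < 1 + l * (t0 - s) by rewrite ltr_wpDr// mulr_ge0 ?(ltW l0)// subr_ge0.
have -> : expR (l * s) = expR (l * t0) / expR (l * (t0 - s)).
  by rewrite -expRN -expRD; congr expR; ring.
by rewrite ler_pM2l ?expR_gt0// lef_pV2 ?posrE ?expR_gt0// expR_ge1Dx.
Qed.

(** With rate 1/r the damping factor is at least 1/2 on the last [r] units of time, so [tker] also
    handles the undamped kernel near [t0], with an integral of order sqrt r. *)
Lemma indic_tker t0 r s : 0 < r -> s <= t0 -> t0 - s <= r ->
  (Num.sqrt (t0 - s))^-1 <= 2 * tker t0 r^-1 s.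
Proof.
move=> r0 st tr; rewrite /tker mulrCA ler_peMr ?invr_ge0 ?sqrtr_ge0//.
have q0 : 0 <= r^-1 * (t0 - s) by rewrite mulr_ge0 ?invr_ge0 ?(ltW r0)// subr_ge0.
have q1 : r^-1 * (t0 - s) <= 1 by rewrite mulrC ler_pdivrMr// mul1r.
by rewrite ler_pdivlMr ?mul1r; lra.
Qed.
End time_kernel.

Section duhamel_estimate.
Context {R : realType} {d : nat}.
Local Notation V := 'rV[R]_d.
Local Notation mu := (@lebesgue_measure R).
Local Notation lam := (lebesgue_rV d).
Local Notation tl := (mu \x lam)%E.
Local Notation RR := (measurableTypeR R).
Variable nu : R.
Hypothesis nu0 : 0 < nu.

Definition flux_sum (F : 'I_d -> R * V -> R) t0 x (z : R * V) : R :=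
  \sum_(i < d) F i z * bdgauss nu t0 x i z.

Lemma measurable_flux_sum F t0 x : (forall i, measurable_fun (setT : set (RR * V)) (F i)) ->
  measurable_fun (setT : set (RR * V)) (flux_sum F t0 x).
Proof.
by move=> mF; apply: measurable_sumV => i; apply: measurable_funM => //; exact: measurable_bdgauss.
Qed.

Lemma measurable_indic_time t :
  measurable_fun (setT : set (RR * V)) (fun z : RR * V => \1_(`[0, t]%classic : set R) z.1 : R).
Proof.
apply: (measurable_time (f := \1_(`[0, t]%classic : set R))).
by apply: measurable_indic; exact: measurable_itv.
Qed.

Lemma duhamel_integrable U F t delta x : flux_data U F -> 0 <= t -> 0 < delta ->
  tl.-integrable setT (EFin \o (fun z : RR * V =>
    \1_(`[0, t]%classic : set R) z.1 * flux_sum F (t + delta) x z)).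
Proof.
move=> [mU mF U0 Ub] t0 delta0.
have [M M0 aeM] := Ub t.
have tt : t < t + delta by rewrite ltrDl.
have [C [C0 Cb Cd]] := bgauss_bound nu0 x t0 tt.
have K0 : 0 <= d%:R * (M * C) by rewrite !mulr_ge0.
have b0 : 0 < 2 * (t + delta) by rewrite mulr_gt0// ltr_wpDl.
have mS : measurable_fun (setT : set (RR * V)) (fun z : RR * V =>
    \1_(`[0, t]%classic : set R) z.1 * flux_sum F (t + delta) x z).
  by apply: measurable_funM; [exact: measurable_indic_time|exact: measurable_flux_sum].
have [|||iS _] := @dominated_Rintegral _ _ nu nu0 x (d%:R * (M * C)) (2 * (t + delta)) t
  (fun=> fun z : R * V => \1_(`[0, t]%classic : set R) z.1 * flux_sum F (t + delta) x z) _ K0 b0 _ mS; last exact: iS.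
- by move=> _; exact: mS.
- by move=> z; exact: cvg_cst.
move: aeM; apply: filterS => z zM _.
have [zt|zt] := boolP (0 <= z.1 <= t); last first.
  rewrite indicE memNset ?mul0r ?normr0 ?mulr0 ?mul0r//.
  by rewrite /= in_itv /=; exact/negP.
rewrite indicE mem_set; last by rewrite /= in_itv.
have /andP[_ z2] := zt.
have [_ FM] := zM z2.
rewrite mul1r mulr1; apply: le_trans (ler_norm_sum _ _ _) _.
have -> : d%:R * (M * C) * gauss nu (2 * (t + delta)) (x - z.2) =
    \sum_(i < d) M * (C * gauss nu (2 * (t + delta)) (x - z.2)).
  by move: (gauss _ _ _) => g; rewrite sumr_const card_ord -mulr_natl; ring.
by apply: ler_sum => i _; rewrite normrM; apply: ler_pM => //; exact: Cd.
Qed.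

Lemma duhamelE F t delta x : duhamel nu F t delta x =
  \int[tl]_z (\1_(`[0, t]%classic : set R) z.1 * flux_sum F (t + delta) x z).
Proof.
rewrite /duhamel /Rintegral integral_mkcond; congr fine; apply: eq_integral => z _.
rewrite patchE; case: ifPn => zc.
  by rewrite indicE mem_set ?mul1r//; move: zc; rewrite inE => -[].
rewrite indicE memNset ?mul0r//; move: zc; rewrite notin_setE => zc zt.
by apply: zc; split.
Qed.

Definition flux_gap (F G : 'I_d -> R * V -> R) t0 x (z : R * V) : R :=
  \sum_(i < d) `|F i z - G i z| * `|bdgauss nu t0 x i z|.

Lemma measurable_flux_gap F G t0 x : (forall i, measurable_fun (setT : set (RR * V)) (F i)) ->
  (forall i, measurable_fun (setT : set (RR * V)) (G i)) ->
  measurable_fun (setT : set (RR * V)) (flux_gap F G t0 x).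
Proof.
move=> mF mG; apply: measurable_sumV => i; apply: measurable_funM.
  by apply: measurableT_comp => //; exact: measurable_funB.
by apply: measurableT_comp => //; exact: measurable_bdgauss.
Qed.

Lemma flux_gap_ge0 F G t0 x z : 0 <= flux_gap F G t0 x z.
Proof. by apply: sumr_ge0 => i _; exact: mulr_ge0. Qed.

Lemma duhamel_diff_le U W F G t delta x : flux_data U F -> flux_data W G ->
  0 <= t -> 0 < delta ->
  (`|duhamel nu F t delta x - duhamel nu G t delta x|%:E <=
   \int[mu]_(s in `[0%R, t]) \int[lam]_y (flux_gap F G (t + delta) x (s, y))%:E)%E.
Proof.
move=> UF WG t0 delta0.
have iF := duhamel_integrable x UF t0 delta0; have iG := duhamel_integrable x WG t0 delta0.
have [_ mF _ _] := UF; have [_ mG _ _] := WG.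
pose I (z : R * V) : R := \1_(`[0, t]%classic : set R) z.1.
have mI : measurable_fun (setT : set (RR * V)) I by exact: measurable_indic_time.
have mg : measurable_fun (setT : set (RR * V)) (fun z => I z * flux_gap F G (t + delta) x z).
  by apply: measurable_funM => //; exact: measurable_flux_gap.
have I0 z : 0 <= I z by rewrite /I indicE.
apply: (@le_trans _ _ (\int[tl]_z (I z * flux_gap F G (t + delta) x z)%:E)%E).
  rewrite !duhamelE -RintegralB//.
  have iD := integrableB measurableT iF iG.
  rewrite /Rintegral -abse_EFin fineK; last first.
    by apply: integrable_fin_num => //; move: iD; congr (integrable _ _ _).
  apply: le_trans (le_abse_integral _ _ _) _ => //.
    by have /integrableP[] := iD.
  apply: ge0_le_integral => //.
  - by apply: measurableT_comp => //; have /integrableP[] := iD.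
  - exact/measurable_EFinP.
  move=> z _; rewrite abse_EFin lee_fin -mulrBr normrM (ger0_norm (I0 z)).
  apply: ler_wpM2l => //; rewrite /flux_sum -sumrB.
  apply: le_trans (ler_norm_sum _ _ _) _; apply: ler_sum => i _.
  by rewrite -mulrBl normrM.
rewrite fubini_tonelli1; last 2 first.
- exact/measurable_EFinP.
- by move=> z; rewrite lee_fin mulr_ge0// flux_gap_ge0.
rewrite [in leRHS]integral_mkcond.
rewrite le_eqVlt; apply/orP; left; apply/eqP.
apply: eq_integral => s _; rewrite patchE /fubini_F /=; case: ifPn => st.
  apply: eq_integral => y _; rewrite /I indicE /=.
  by rewrite st mul1r.
rewrite -[RHS](@integral0 _ _ _ lam setT); apply: eq_integral => y _.
by rewrite /I indicE /= (negbTE st) mul0r.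
Qed.

(** The constant of [dgauss_le], summed over the d components and freed of its dependence on
    time. *)
Definition gap_cst : R := d%:R * (@c2 R d / Num.sqrt nu).

Lemma gap_cst_ge0 : 0 <= gap_cst.
Proof. by rewrite mulr_ge0// divr_ge0 ?sqrtr_ge0// ltW// c2_gt0. Qed.

Lemma flux_gap_le (F G : 'I_d -> R * V -> R) t0 x s (P : V -> R) : s < t0 ->
  measurable_fun (setT : set V) (fun y => flux_gap F G t0 x (s, y)) ->
  measurable_fun (setT : set V) P -> (forall y, 0 <= P y) ->
  {ae lam, forall y, forall i, `|F i (s, y) - G i (s, y)| <= P y} ->
  (\int[lam]_y (flux_gap F G t0 x (s, y))%:E <=
   (gap_cst * (Num.sqrt (t0 - s))^-1)%:E *
     \int[lam]_y (P y * gauss nu (2 * (t0 - s)) (x - y))%:E)%E.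
Proof.
move=> st mgap mP P0 aeP.
have ts : 0 < t0 - s by rewrite subr_gt0.
have mgs : measurable_fun (setT : set V) (fun y => gauss nu (2 * (t0 - s)) (x - y)).
  exact: (measurableT_comp (measurable_gauss nu _) (measurable_xsub x)).
have g0 y : 0 <= gauss nu (2 * (t0 - s)) (x - y) by exact: ltW (gauss_gt0 nu0 _ _).
have mPg : measurable_fun (setT : set V) (fun y => (P y * gauss nu (2 * (t0 - s)) (x - y))%:E).
  by apply/measurable_EFinP; exact: measurable_funM.
have c0 : 0 <= gap_cst * (Num.sqrt (t0 - s))^-1.
  by rewrite mulr_ge0 ?gap_cst_ge0// invr_ge0 sqrtr_ge0.
rewrite -ge0_integralZl//; last by move=> y _; rewrite lee_fin mulr_ge0.
apply: ae_ge0_le_integral => //.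
- by move=> y _; rewrite lee_fin flux_gap_ge0.
- exact/measurable_EFinP.
- by move=> y _; apply: mule_ge0; rewrite lee_fin//; exact: mulr_ge0.
- exact: measurable_funeM.
move: aeP; apply: filterS => y HP _; rewrite -EFinM lee_fin.
have -> : gap_cst * (Num.sqrt (t0 - s))^-1 * (P y * gauss nu (2 * (t0 - s)) (x - y)) =
   \sum_(i < d) P y * (@c2 R d * (Num.sqrt (nu * (t0 - s)))^-1 * gauss nu (2 * (t0 - s)) (x - y)).
  rewrite sumr_const card_ord -mulr_natl sqrtrM ?(ltW nu0)// /gap_cst invfM; ring.
by apply: ler_sum => i _; apply: ler_pM => //; exact: dgauss_le.
Qed.
End duhamel_estimate.

(** * Stability *)

Section convolution_linear.
Context {R : realType} {d : nat}.
Local Notation V := 'rV[R]_d.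
Local Notation lam := (lebesgue_rV d).
Variables (k : V -> R) (Bk : R).
Hypotheses (mk : measurable_fun setT k) (k0 : forall x, 0 <= k x)
  (kB : forall x, k x <= Bk) (k1 : (\int[lam]_x (k x)%:E = 1)%E).
Variable eps : R.
Hypothesis eps0 : 0 < eps.

Local Notation conv f := (convolution f (eta_ k eps)).

Lemma convB (f g : V -> R) x : measurable_fun setT f -> measurable_fun setT g ->
  (L1norm f < +oo)%E -> (L1norm g < +oo)%E ->
  conv f x - conv g x = conv (fun y => f y - g y) x.
Proof.
move=> mf mg f1 g1; rewrite /convolution -RintegralB//.
- by apply: eq_Rintegral => y _; rewrite mulrBl.
- by have := integrable_conv mk k0 kB x eps0 mf f1.
- by have := integrable_conv mk k0 kB x eps0 mg g1.
Qed.

Lemma L1normB_lty (f g : V -> R) : measurable_fun setT f -> measurable_fun setT g ->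
  (L1norm f < +oo)%E -> (L1norm g < +oo)%E -> (L1norm (fun y => f y - g y)%R < +oo)%E.
Proof.
move=> mf mg f1 g1; apply: (le_lt_trans (y := (L1norm f + L1norm g)%E)); last exact: lte_add_pinfty.
by apply: L1normD_le => //; [exact: measurable_funB|move=> x; exact: ler_normB].
Qed.

End convolution_linear.

Section tker_sum.
Context {R : realType}.
Local Notation mu := (@lebesgue_measure R).
Local Notation RR := (measurableTypeR R).

(** In [stability_step] the three rates are [l] for the propagated bound, [r^-1] for the
    mollification gap near the final time, and [(2 * h)^-1] for the times not yet reached by the
    induction; [q] is the mollification gap at earlier times. *)
Lemma integral_tker_sum (t t0 T l1 l2 l3 a1 a2 a3 a4 Q : R) (q : RR -> \bar R) :
  0 <= t <= T -> t < t0 -> 0 < l1 -> 0 < l2 -> 0 < l3 ->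
  0 <= a1 -> 0 <= a2 -> 0 <= a3 -> 0 <= a4 ->
  measurable_fun setT q -> (forall s, 0 <= q s)%E ->
  (\int[mu]_(s in `[0%R, T]) q s <= Q%:E)%E ->
  (\int[mu]_(s in `[0%R, t]) ((a1 * tker t0 l1 s + a2 * tker t0 l2 s + a3 * tker t0 l3 s)%:E
     + a4%:E * q s) <=
   (a1 * (8 / Num.sqrt l1) + a2 * (8 / Num.sqrt l2) + a3 * (8 / Num.sqrt l3) + a4 * Q)%:E)%E.
Proof.
move=> /andP[tp tT] tt0 l10 l20 l30 a10 a20 a30 a40 mq q0 qQ.
have mD : measurable (`[0, t]%classic : set RR) by exact: measurable_itv.
have st s : `[0, t]%classic s -> s <= t0.
  by rewrite /= in_itv /= => /andP[_ st]; exact: le_trans st (ltW tt0).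
have mk l : measurable_fun (`[0, t]%classic : set RR) (fun s => (tker t0 l s)%:E).
  by apply/measurable_EFinP; apply: measurable_funTS; exact: measurable_tker.
have kp l s : 0 < l -> `[0, t]%classic s -> (0 <= (tker t0 l s)%:E)%E.
  by move=> l0 /st ?; rewrite lee_fin tker_ge0// ltW.
have mak a l : measurable_fun (`[0, t]%classic : set RR) (fun s => a%:E * (tker t0 l s)%:E)%E.
  exact: measurable_funeM.
have akp a l s : 0 <= a -> 0 < l -> `[0, t]%classic s -> (0 <= a%:E * (tker t0 l s)%:E)%E.
  by move=> a0 l0 /(kp l s l0) ?; rewrite mule_ge0// lee_fin.
have mqt : measurable_fun (`[0, t]%classic : set RR) q by exact: measurable_funTS.
have Es s : ((a1 * tker t0 l1 s + a2 * tker t0 l2 s + a3 * tker t0 l3 s)%:E =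
  a1%:E * (tker t0 l1 s)%:E + a2%:E * (tker t0 l2 s)%:E + a3%:E * (tker t0 l3 s)%:E)%E by [].
under eq_integral do rewrite Es.
rewrite ge0_integralD//; last 4 first.
- by move=> s ts; rewrite !adde_ge0// akp.
- by apply: emeasurable_funD => //; apply: emeasurable_funD.
- by move=> s ts; rewrite mule_ge0// lee_fin.
- exact: measurable_funeM.
rewrite ge0_integralD//; last 3 first.
- by move=> s ts; rewrite adde_ge0 ?akp.
- exact: emeasurable_funD.
- by move=> s ts; exact: akp.
rewrite ge0_integralD//; last 2 first.
- by move=> s ts; exact: akp.
- by move=> s ts; exact: akp.
have I a l : 0 <= a -> 0 < l ->
    (\int[mu]_(s in `[0%R, t]) (a%:E * (tker t0 l s)%:E) <= (a * (8 / Num.sqrt l))%:E)%E.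
  move=> a0 l0; rewrite ge0_integralZl//; last by move=> s; exact: kp.
  by rewrite [leRHS]EFinM; apply: lee_wpmul2l; rewrite ?lee_fin//; exact: integral_tker.
rewrite !EFinD; apply: leeD; first by apply: leeD; [apply: leeD|]; exact: I.
rewrite ge0_integralZl//.
rewrite [leRHS]EFinM; apply: lee_wpmul2l; rewrite ?lee_fin//; apply: le_trans qQ.
apply: ge0_subset_integral => //.
- exact: measurable_funTS.
- by move=> s /=; rewrite !in_itv /= => /andP[-> /le_trans]; apply.
Qed.
End tker_sum.

Section stability.
Context {R : realType} {d : nat}.
Local Notation V := 'rV[R]_d.
Local Notation mu := (@lebesgue_measure R).
Local Notation lam := (lebesgue_rV d).
Local Notation tl := (mu \x lam)%E.
Local Notation RR := (measurableTypeR R).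
Variable nu : R.
Hypothesis nu0 : 0 < nu.
Variables (k : V -> R) (Bk : R).
Hypotheses (mk : measurable_fun setT k) (k0 : forall x, 0 <= k x)
  (kB : forall x, k x <= Bk) (k1 : (\int[lam]_x (k x)%:E = 1)%E).
Variable eps : R.
Hypothesis eps0 : 0 < eps.
Variables (b : R -> V) (L : R).
Hypotheses (L0 : 0 < L) (bL : forall i r s, `|b r ord0 i - b s ord0 i| <= L * `|r - s|).

Local Notation conv f := (convolution f (eta_ k eps)).

(** As m <= 1, [f] is bounded by M + 1. The constants thus depend on the bound of the local solution
    [g] and not on an a priori bound of [f], which would not be uniform in [eps]. *)
Lemma nonlocal_gap (f g : V -> R) (M m B : R) : measurable_fun setT f -> measurable_fun setT g ->
  (L1norm f < +oo)%E -> (L1norm g < +oo)%E -> 0 <= M -> 0 <= m <= 1 ->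
  (forall i r, `|r| <= M + 1 -> `|b r ord0 i| <= B) ->
  {ae lam, forall y, `|g y| <= M} -> {ae lam, forall y, `|f y - g y| <= m} ->
  {ae lam, forall y, forall i, `|f y * b (conv f y) ord0 i - g y * b (g y) ord0 i| <=
     (B + M * L) * m + M * L * `|conv g y - g y|}.
Proof.
move=> mf mg f1 g1 M0 /andP[m0 m1] HB aeg aed.
have aef : {ae lam, forall y, `|f y| <= M + 1}.
  move: aeg aed; apply: filterS2 => y H1 H2.
  rewrite -[f y](subrK (g y)) addrC; apply: le_trans (ler_normD _ _) _.
  by apply: lerD => //; exact: le_trans H2 m1.
have M1 : 0 <= M + 1 by rewrite addr_ge0.
have cf x : `|conv f x| <= M + 1 by exact: (conv_ub mk k0 kB k1).
have cd x : `|conv f x - conv g x| <= m.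
  rewrite (convB mk k0 kB eps0)//; apply: (conv_ub mk k0 kB k1) => //; first exact: measurable_funB.
  exact: L1normB_lty.
move: aeg aed; apply: filterS2 => y H1 H2 i.
(* The convolution is compared with [g] through [conv g], which separates the error f - g from the
   mollification error of [g]. *)
have -> : f y * b (conv f y) ord0 i - g y * b (g y) ord0 i =
  (f y - g y) * b (conv f y) ord0 i + g y * (b (conv f y) ord0 i - b (conv g y) ord0 i)
  + g y * (b (conv g y) ord0 i - b (g y) ord0 i) by ring.
have -> : (B + M * L) * m + M * L * `|conv g y - g y| =
   m * B + M * (L * m) + M * (L * `|conv g y - g y|) by ring.
apply: le_trans (ler_normD _ _) _; apply: lerD.
  apply: le_trans (ler_normD _ _) _; apply: lerD; rewrite normrM; apply: ler_pM => //.
    exact: HB.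
  by apply: le_trans (bL _ _ _) _; rewrite ler_pM2l.
by rewrite normrM; apply: ler_pM.
Qed.

(** A bound of tau^(-1/2) [gauss nu (2 * tau)] for all tau >= r. *)
Definition gauss_sup r : R := (Num.sqrt r)^-1 * (@gK R d nu * expR (- (d%:R / 2) * ln (2 * r))).

Lemma gauss_sup_ge0 r : 0 <= gauss_sup r.
Proof. by rewrite !mulr_ge0 ?invr_ge0 ?sqrtr_ge0 ?expR_ge0// ltW// gK_gt0. Qed.

(** Within [r] of [t0] the gap is bounded by 2 M and the singular kernel is kept; [indic_tker]
    doubles this to 4 M. Farther away the kernel is bounded by [gauss_sup r], and the L^1 norm of
    the gap, small with [eps], takes over. *)
Lemma nonlocal_gap_integral (g : V -> R) (A C M t0 r s : R) x : measurable_fun setT g ->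
  (L1norm g < +oo)%E -> 0 <= M -> 0 <= A -> 0 <= C -> {ae lam, forall y, `|g y| <= M} ->
  0 < r -> s < t0 ->
  ((Num.sqrt (t0 - s))^-1%:E *
     \int[lam]_y ((A + C * `|conv g y - g y|)%R * gauss nu (2 * (t0 - s)) (x - y))%:E <=
   (A * (Num.sqrt (t0 - s))^-1 + C * (4 * M) * tker t0 r^-1 s)%:E +
   (C * gauss_sup r)%:E * L1norm (fun y => conv g y - g y)%R)%E.
Proof.
move=> mg g1 M0 A0 C0 aeg r0 st.
have ts : 0 < t0 - s by rewrite subr_gt0.
have ts2 : 0 < 2 * (t0 - s) by rewrite mulr_gt0.
have si0 : 0 <= (Num.sqrt (t0 - s))^-1 by rewrite invr_ge0 sqrtr_ge0.
pose G y := gauss nu (2 * (t0 - s)) (x - y).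
have mG : measurable_fun setT G.
  exact: (measurableT_comp (measurable_gauss nu _) (measurable_xsub x)).
have G0 y : 0 <= G y by exact: ltW (gauss_gt0 nu0 _ _).
have G1 : (\int[lam]_y (G y)%:E = 1)%E by exact: gauss_mass.
pose q y := `|conv g y - g y|.
have mq : measurable_fun setT q.
  apply: measurableT_comp => //; apply: measurable_funB => //.
  by apply: measurable_conv.
have q0 y : 0 <= q y by rewrite /q normr_ge0.
have mqG : measurable_fun setT (fun y => (q y * G y)%:E).
  by apply/measurable_EFinP; exact: measurable_funM.
have L10 : (0 <= L1norm (fun y => conv g y - g y)%R)%E by exact: L1norm_ge0.
have E : (\int[lam]_y ((A + C * q y)%R * G y)%:E = A%:E + C%:E * \int[lam]_y (q y * G y)%:E)%E.
  under eq_integral do rewrite mulrDl EFinD.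
  rewrite ge0_integralD//; last 4 first.
  - by move=> y _; rewrite lee_fin mulr_ge0.
  - by apply/measurable_EFinP; exact: measurable_funM.
  - by move=> y _; rewrite lee_fin; apply: mulr_ge0 => //; exact: mulr_ge0.
  - by apply/measurable_EFinP; apply: measurable_funM => //; exact: measurable_funM.
  congr (_ + _)%E.
    under eq_integral do rewrite EFinM.
    rewrite ge0_integralZl//; first by rewrite G1 mule1.
    - exact/measurable_EFinP.
    - by move=> y _; rewrite lee_fin.
  under eq_integral do rewrite -mulrA EFinM.
  rewrite ge0_integralZl//.
  by move=> y _; rewrite lee_fin mulr_ge0.
rewrite -/(q _) E.
have I0 : (0 <= \int[lam]_y (q y * G y)%:E)%E.
  by apply: integral_ge0 => y _; rewrite lee_fin mulr_ge0.
rewrite ge0_muleDr ?mule_ge0 ?lee_fin// -EFinM [(Num.sqrt _)^-1 * A]mulrC.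
rewrite EFinD -addeA; apply: leeD => //.
have [tr|tr] := leP (t0 - s) r.
  have cg y : `|conv g y| <= M by exact: (conv_ub mk k0 kB k1).
  have qM : (\int[lam]_y (q y * G y)%:E <= (2 * M)%:E)%E.
    apply: (@le_trans _ _ (\int[lam]_y ((2 * M)%:E * (G y)%:E))%E).
      apply: ae_ge0_le_integral => //.
      - by move=> y _; rewrite lee_fin mulr_ge0.
      - by move=> y _; rewrite mule_ge0// lee_fin// mulr_ge0.
      - by apply: measurable_funeM; exact/measurable_EFinP.
      move: aeg; apply: filterS => y gM _; rewrite -EFinM lee_fin ler_wpM2r//.
      rewrite /q; apply: le_trans (ler_normB _ _) _; rewrite mulr_natl mulr2n; apply: lerD => //.
    rewrite ge0_integralZl//; last 3 first.
    - exact/measurable_EFinP.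
    - by move=> y _; rewrite lee_fin.
    - by rewrite lee_fin mulr_ge0.
    by rewrite G1 mule1.
  apply: (@le_trans _ _ (C * (4 * M) * tker t0 r^-1 s)%:E); last first.
    by rewrite leeDl// mule_ge0// lee_fin mulr_ge0// gauss_sup_ge0.
  apply: (@le_trans _ _ ((Num.sqrt (t0 - s))^-1%:E * (C%:E * (2 * M)%:E))%E).
    by apply: lee_wpmul2l; rewrite ?lee_fin//; apply: lee_wpmul2l; rewrite ?lee_fin.
  rewrite -!EFinM lee_fin.
  have := indic_tker r0 (ltW st) tr; set a := _^-1 => ha.
  have -> : C * (4 * M) * tker t0 r^-1 s = (2 * tker t0 r^-1 s) * (C * (2 * M)) by ring.
  by apply: ler_wpM2r => //; rewrite !mulr_ge0.
apply: (@le_trans _ _ ((C * gauss_sup r)%:E * L1norm (fun y => conv g y - g y)%R)%E); last first.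
  rewrite leeDr// lee_fin; apply: mulr_ge0; first by rewrite !mulr_ge0.
  by apply: tker_ge0; [rewrite invr_ge0 ltW|exact: ltW].
pose S := @gK R d nu * expR (- (d%:R / 2) * ln (2 * r)).
have qS : (\int[lam]_y (q y * G y)%:E <= S%:E * L1norm (fun y => conv g y - g y)%R)%E.
  have S0 : 0 <= S by rewrite mulr_ge0 ?expR_ge0// ltW// gK_gt0.
  rewrite /L1norm -ge0_integralZl//; last exact/measurable_EFinP.
  apply: ge0_le_integral => //.
  - by move=> y _; rewrite lee_fin mulr_ge0.
  - by apply: measurable_funeM; exact/measurable_EFinP.
  move=> y _; rewrite -EFinM lee_fin mulrC ler_wpM2r//.
  apply: gauss_ub => //; first by rewrite mulr_gt0.
  by rewrite ler_pM2l// ltW.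
apply: (@le_trans _ _ ((Num.sqrt r)^-1%:E * (C%:E * (S%:E * L1norm (fun y => conv g y - g y)%R)))%E).
  apply: lee_pmul => //; rewrite ?lee_fin//.
  - by rewrite mule_ge0// lee_fin.
  - by rewrite lef_pV2 ?posrE ?sqrtr_gt0// ler_wsqrtr// ltW.
  - by apply: lee_wpmul2l; rewrite ?lee_fin.
rewrite !muleA -!EFinM /gauss_sup -/S.
by rewrite (_ : _ * C * S = C * ((Num.sqrt r)^-1 * S))//; ring.
Qed.
Variables (U W : R * V -> R).

Let F (i : 'I_d) (z : R * V) : R := U z * b (conv (fun y => U (z.1, y)) z.2) ord0 i.
Let G (i : 'I_d) (z : R * V) : R := W z * b (W z) ord0 i.

Hypotheses (UF : flux_data U F) (WG : flux_data W G)
  (UL1 : forall s, (L1norm (fun y => U (s, y)) < +oo)%E)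
  (WL1 : forall s, (L1norm (fun y => W (s, y)) < +oo)%E).
Hypothesis mild : forall t delta x, 0 <= t -> 0 < delta ->
  heat_pairing nu U t delta x t - heat_pairing nu W t delta x t =
  duhamel nu F t delta x - duhamel nu G t delta x.
(** [D] and [h] may depend on [eps]; the other constants will be chosen before it. *)
Variables (T M B D Q E l r h : R).
Hypotheses (M0 : 0 <= M) (B0 : 0 <= B) (D0 : 0 <= D) (E0 : 0 < E) (l0 : 0 < l)
  (r0 : 0 < r) (h0 : 0 < h) (El : E * expR (l * T) <= 1).
Hypothesis HB : forall i a, `|a| <= M + 1 -> `|b a ord0 i| <= B.
Hypothesis aeW : {ae mu, forall s : RR, s <= T -> {ae lam, forall y, `|W (s, y)| <= M}}.
Hypothesis aeD : {ae mu, forall s : RR, s <= T ->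
  {ae lam, forall y, forall i, `|F i (s, y) - G i (s, y)| <= D}}.
Let q (s : RR) : \bar R := L1norm (fun y => conv (fun y => W (s, y)) y - W (s, y)).
Hypothesis mq : measurable_fun setT q.
Hypothesis qQ : (\int[mu]_(s in `[0%R, T]) q s <= Q%:E)%E.

Let g := @gap_cst R d nu.
(** [H1] leaves half of the target bound to the propagated error, once exp(l t0) has been replaced
    by 2 exp(l t); [H2] fits all other errors into the other half. *)
Hypothesis H1 : g * (B + M * L) * (8 / Num.sqrt l) <= 4^-1.
Hypothesis H2 : g * (M * L * (4 * M)) * (8 / Num.sqrt r^-1) + g * D * 2 * (8 / Num.sqrt (2 * h)^-1)
  + g * (M * L * gauss_sup r) * Q <= E / 2.

Let g_ge0 : 0 <= g. Proof. exact: gap_cst_ge0. Qed.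
Let ML0 : 0 <= M * L. Proof. by rewrite mulr_ge0// ltW. Qed.

(** The bound comes back with the same [E] and [l], for the mollified difference, on an interval
    longer by [h]; hence nothing accumulates under iteration. *)
Lemma stability_step t1 t delta x :
  (forall s, 0 <= s <= T -> s < t1 -> {ae lam, forall y, `|U (s, y) - W (s, y)| <= E * expR (l * s)}) ->
  0 <= t <= T -> t < t1 + h -> 0 < delta -> delta <= h -> l * delta <= 2^-1 ->
  `|heat_pairing nu U t delta x t - heat_pairing nu W t delta x t| <= E * expR (l * t).
Proof.
move=> IH /andP[tp tT] tt1 delta0 dh ld.
have [mU mF _ _] := UF; have [mW mG _ _] := WG.
have mWs s : measurable_fun setT (fun y => W (s, y)) by exact: measurable_slice.
have mUs s : measurable_fun setT (fun y => U (s, y)) by exact: measurable_slice.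
pose t0 := t + delta.
have tt0 : t < t0 by rewrite ltrDl.
rewrite (mild x tp delta0) -lee_fin; apply: le_trans (duhamel_diff_le nu0 x UF WG tp delta0) _.
rewrite -/t0.
pose a1 := g * (B + M * L) * (E * expR (l * t0)).
pose a2 := g * (M * L * (4 * M)); pose a3 := g * D * 2; pose a4 := g * (M * L * gauss_sup r).
have a10 : 0 <= a1.
  by rewrite /a1; apply: mulr_ge0; [rewrite mulr_ge0// addr_ge0|rewrite mulr_ge0 ?expR_ge0// ltW].
have a20 : 0 <= a2 by rewrite /a2; apply: mulr_ge0 => //; apply: mulr_ge0 => //; exact: mulr_ge0.
have a30 : 0 <= a3 by rewrite /a3; apply: mulr_ge0 => //; exact: mulr_ge0.
have a40 : 0 <= a4 by rewrite /a4; apply: mulr_ge0 => //; apply: mulr_ge0 => //; exact: gauss_sup_ge0.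
have h20 : 0 < (2 * h)^-1 by rewrite invr_gt0 mulr_gt0.
have ri0 : 0 < r^-1 by rewrite invr_gt0.
have q0 s : (0 <= q s)%E by exact: L1norm_ge0.
apply: (@le_trans _ _ (\int[mu]_(s in `[0%R, t])
  ((a1 * tker t0 l s + a2 * tker t0 r^-1 s + a3 * tker t0 (2 * h)^-1 s)%:E + a4%:E * q s))%E); last first.
  apply: le_trans (integral_tker_sum _ tt0 l0 ri0 h20 a10 a20 a30 a40 mq q0 qQ) _; first by rewrite tp tT.
  rewrite lee_fin.
  have e1 : 1 <= expR (l * t) by rewrite -expR0 ler_expR mulr_ge0// ltW.
  (* From l delta <= 1/2: exp(-l delta) >= 1 - 1/2. *)
  have ed : expR (l * t0) <= 2 * expR (l * t).
    rewrite /t0 mulrDr expRD mulrC ler_pM2r ?expR_gt0//.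
    rewrite -[X in X <= _]invrK invf_ple ?posrE ?invr_gt0 ?expR_gt0//.
    rewrite -expRN; apply: le_trans (expR_ge1Dx _); lra.
  have A1 : a1 * (8 / Num.sqrt l) <= E * expR (l * t) / 2.
    rewrite /a1 mulrAC; apply: (@le_trans _ _ (4^-1 * (E * (2 * expR (l * t))))).
      apply: ler_pM => //.
      - by rewrite mulr_ge0 ?divr_ge0 ?sqrtr_ge0// mulr_ge0// addr_ge0.
      - by rewrite mulr_ge0 ?expR_ge0// ltW.
      - by rewrite ler_pM2l.
    by lra.
  have A2 : a2 * (8 / Num.sqrt r^-1) + a3 * (8 / Num.sqrt (2 * h)^-1) + a4 * Q <= E * expR (l * t) / 2.
    apply: (le_trans H2); rewrite ler_pM2r// ler_pMr//.
  move: A1 A2; move: (a1 * _) (a2 * _) (a3 * _) (a4 * _) => x1 x2 x3 x4 A1 A2; lra.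
have mgap : measurable_fun (setT : set (RR * V)) (flux_gap nu F G t0 x) by exact: measurable_flux_gap.
have mgapE : measurable_fun (setT : set (RR * V)) (fun z => (flux_gap nu F G t0 x z)%:E).
  exact/measurable_EFinP.
apply: ae_ge0_le_integral.
- exact: measurable_itv.
- by move=> s _; apply: integral_ge0 => y _; rewrite lee_fin flux_gap_ge0.
- apply: measurable_funTS.
  have p0 z : (0 <= (flux_gap nu F G t0 x z)%:E)%E by rewrite lee_fin flux_gap_ge0.
  exact: (@measurable_fun_fubini_tonelli_F _ _ _ _ _ lam _ mgapE p0).
- move=> s; rewrite /= in_itv /= => /andP[_ st].
  have st0 : s <= t0 by exact: le_trans st (ltW tt0).
  by rewrite adde_ge0 ?mule_ge0 ?lee_fin// !addr_ge0// mulr_ge0// tker_ge0// ltW.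
- apply: measurable_funTS; apply: emeasurable_funD; last exact: measurable_funeM.
  have mtk a l' : measurable_fun (setT : set RR) (fun s => a * tker t0 l' s).
    by apply: measurable_funM => //; exact: measurable_tker.
  by apply/measurable_EFinP; apply: measurable_funD => //; exact: measurable_funD.
move: aeW aeD; apply: filterS2 => s HW HD; rewrite /= in_itv /= => /andP[sp st].
have sT : s <= T by exact: le_trans tT.
have st0 : s < t0 by exact: le_lt_trans tt0.
have {}HW := HW sT; have {}HD := HD sT.
have mgs : measurable_fun (setT : set V) (fun y => flux_gap nu F G t0 x (s, y)).
  exact: (measurable_slice s mgap).
have k1p : 0 <= tker t0 l s by rewrite tker_ge0// ltW.
have k2p : 0 <= tker t0 r^-1 s by rewrite tker_ge0// ltW.
have k3p : 0 <= tker t0 (2 * h)^-1 s by rewrite tker_ge0// ltW.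
have si0 : 0 <= (Num.sqrt (t0 - s))^-1 by rewrite invr_ge0 sqrtr_ge0.
have [s1|s1] := ltP s t1; last first.
  (* The induction does not reach the last [h] units of time, where only the crude
     bound [D] is available. *)
  have mD : measurable_fun (setT : set V) (fun=> D) by exact: measurable_cst.
  have Hc := @flux_gap_le _ _ nu nu0 F G t0 x s (fun=> D) st0 mgs mD (fun=> D0) HD.
  apply: (le_trans Hc).
  have -> : (\int[lam]_y (D * gauss nu (2 * (t0 - s)) (x - y))%:E = D%:E)%E.
    under eq_integral do rewrite EFinM.
    rewrite ge0_integralZl//; last 2 first.
    - apply/measurable_EFinP.
      exact: (measurableT_comp (measurable_gauss nu _) (measurable_xsub x)).
    - by move=> y _; rewrite lee_fin; exact: ltW (gauss_gt0 nu0 _ _).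
    by rewrite gauss_mass ?mule1// mulr_gt0// subr_gt0.
  rewrite -EFinM; apply: (@le_trans _ _ (a3 * tker t0 (2 * h)^-1 s)%:E).
    rewrite lee_fin -/g.
    have h20' : 0 < 2 * h by rewrite mulr_gt0.
    (* One [h] is the length of the step, the other bounds [delta]. *)
    have ts : t0 - s <= 2 * h by rewrite /t0; lra.
    have := indic_tker h20' (ltW st0) ts; set a := _^-1 => ha.
    have -> : g * a * D = (g * D) * a by ring.
    have -> : a3 * tker t0 (2 * h)^-1 s = (g * D) * (2 * tker t0 (2 * h)^-1 s) by rewrite /a3; ring.
    by apply: ler_wpM2l => //; exact: mulr_ge0.
  rewrite -[leLHS]adde0; apply: leeD; last by rewrite mule_ge0// lee_fin.
  by rewrite lee_fin lerDr addr_ge0// mulr_ge0.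
have m0 : 0 <= E * expR (l * s) by rewrite mulr_ge0 ?expR_ge0// ltW.
have m1 : E * expR (l * s) <= 1.
  by apply: le_trans El; rewrite ler_pM2l// ler_expR ler_pM2l.
have m01 : 0 <= E * expR (l * s) <= 1 by rewrite m0 m1.
have sT' : 0 <= s <= T by rewrite sp sT.
have gap := nonlocal_gap (mUs s) (mWs s) (UL1 s) (WL1 s) M0 m01 HB HW (IH s sT' s1).
set A := (B + M * L) * (E * expR (l * s)) in gap.
have A0 : 0 <= A by rewrite mulr_ge0// addr_ge0.
pose P y := A + M * L * `|conv (fun y => W (s, y)) y - W (s, y)|.
have mP : measurable_fun (setT : set V) P.
  apply: measurable_funD => //; apply: measurable_funM => //; apply: measurableT_comp => //.
  by apply: measurable_funB => //; exact: measurable_conv.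
have P0 y : 0 <= P y by rewrite addr_ge0// mulr_ge0.
have Hc := @flux_gap_le _ _ nu nu0 F G t0 x s P st0 mgs mP P0 gap.
apply: (le_trans Hc).
have := nonlocal_gap_integral x (mWs s) (WL1 s) M0 A0 ML0 HW r0 st0.
rewrite -/(q s) => HI.
rewrite EFinM -muleA; apply: (@le_trans _ _ (g%:E * ((A * (Num.sqrt (t0 - s))^-1 + M * L * (4 * M) * tker t0 r^-1 s)%:E +
   (M * L * gauss_sup r)%:E * q s))%E).
  by apply: lee_wpmul2l; rewrite ?lee_fin.
rewrite ge0_muleDr; last 2 first.
- rewrite lee_fin; apply: addr_ge0; first exact: mulr_ge0.
  by apply: mulr_ge0 => //; rewrite !mulr_ge0// ltW.
- by rewrite mule_ge0// lee_fin; apply: mulr_ge0 => //; exact: gauss_sup_ge0.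
rewrite muleA -!EFinM; apply: leeD => //; rewrite lee_fin mulrDr.
rewrite -[leLHS]addr0; apply: lerD; last exact: mulr_ge0.
apply: lerD; last by rewrite /a2 [leLHS]mulrA.
have := exp_tker l0 (ltW st0); set a := _^-1 => ha.
have -> : g * (A * a) = (g * (B + M * L) * E) * (expR (l * s) * a) by rewrite /A; ring.
have -> : a1 * tker t0 l s = (g * (B + M * L) * E) * (expR (l * t0) * tker t0 l s) by rewrite /a1; ring.
apply: ler_wpM2l => //; apply: mulr_ge0; last exact: ltW.
by apply: mulr_ge0 => //; exact: addr_ge0.
Qed.

(** Induction on the number of steps of length [h]. At each stage [stability_step] bounds the
    Gaussian mollifications of the difference for arbitrarily small [delta], and [conv_criterion]
    turns this into a bound almost everywhere, ready for the next step. *)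
Lemma stability_bound t : 0 <= t <= T ->
  {ae lam, forall y, `|U (t, y) - W (t, y)| <= E * expR (l * t)}.
Proof.
have [mU _ _ _] := UF; have [mW _ _ _] := WG.
have mWs s : measurable_fun setT (fun y => W (s, y)) by exact: measurable_slice.
have mUs s : measurable_fun setT (fun y => U (s, y)) by exact: measurable_slice.
suff H n s : 0 <= s <= T -> s < n%:R * h -> {ae lam, forall y, `|U (s, y) - W (s, y)| <= E * expR (l * s)}.
  move=> tT; have /andP[tp _] := tT.
  apply: (H (Num.bound (t / h))) => //.
  by rewrite -ltr_pdivrMr//; apply: archi_boundP; rewrite divr_ge0// ltW.
elim: n s => [|n IH] s sT; first by rewrite mul0r => s0; have := le_lt_trans (proj1 (andP sT)) s0; rewrite ltxx.
rewrite -natr1 mulrDl mul1r => sn.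
(* Secures both conditions of [stability_step] on [delta], for the whole sequence [de]. *)
pose d0 := Num.min h (2 * l)^-1.
have d00 : 0 < d0 by rewrite lt_min h0 invr_gt0 mulr_gt0.
pose de n := d0 * n.+1%:R^-1 : R.
have de0 m : 0 < de m by rewrite mulr_gt0.
have de1 m : de m <= d0 by rewrite ler_piMr ?invf_le1 ?ler1n// ltW.
have g1p : forall y : V, 0 <= gauss nu 1 y by move=> y; exact: ltW (gauss_gt0 nu0 _ _).
have se0 m : 0 < Num.sqrt (de m) by rewrite sqrtr_gt0.
apply: (conv_criterion (measurable_gauss nu 1) g1p (gauss1_le nu0) (gauss1_mass nu0)
   (e_ := fun m => Num.sqrt (de m))) => //.
- exact: measurable_funB.
- by apply: L1normB_lty.
- have cde : de n @[n --> \oo] --> (0 : R).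
    by rewrite -[X in _ --> X](mulr0 d0); apply: cvgMr; exact: cvg_harmonic.
  rewrite -[X in _ --> X]sqrtr0; apply: (cvg_comp de (@Num.sqrt R) cde).
  exact: sqrt_continuous.
move=> m x.
have hpE (X : R * V -> R) : heat_pairing nu X s (de m) x s =
    convolution (fun y => X (s, y)) (eta_ (gauss nu 1) (Num.sqrt (de m))) x.
  apply: eq_Rintegral => y _; rewrite /bgauss /= [s + _]addrC addrK.
  by rewrite gauss_eta.
rewrite -(convB (measurable_gauss nu 1) g1p (gauss1_le nu0) (se0 m))// -!hpE.
apply: (stability_step (t1 := n%:R * h)) => //.
- by apply: le_trans (de1 m) _; rewrite ge_min lexx.
- rewrite mulrC -ler_pdivlMr//; apply: le_trans (de1 m) _.
  by rewrite ge_min invfM lexx orbT.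
Qed.
End stability.

(** * Convergence *)

Lemma Lfun1_L1norm (R : realType) (d : nat) (f : 'rV[R]_d -> R) :
  f \in Lfun (lebesgue_rV d) 1%:E -> (L1norm f < +oo)%E.
Proof.
move=> /sub_Lfun_finLfun; rewrite inE /= /finite_norm => H.
by rewrite /L1norm -[X in (X < _)%E](Lnorm1 (lebesgue_rV d) (EFin \o f)).
Qed.

Section vanishing_gap.
Context {R : realType} {d : nat}.
Local Notation V := 'rV[R]_d.
Local Notation mu := (@lebesgue_measure R).
Local Notation lam := (lebesgue_rV d).
Local Notation tl := (mu \x lam)%E.
Local Notation RR := (measurableTypeR R).

(** By the triangle inequality the L^1 norm is continuous in time, and a continuous function attains
    its maximum on [0, T]. *)
Lemma L1norm_C0_bounded (w : R -> V -> R) T : 0 <= T -> C0_Lp T 1%:E w ->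
  exists2 N, 0 <= N & forall t, 0 <= t <= T -> (L1norm (w t) <= N%:E)%E.
Proof.
move=> T0 wC; have [wL _] := wC.
have wt t : 0 <= t <= T -> measurable_fun setT (w t) /\ (L1norm (w t) < +oo)%E.
  move=> tT; have := wL t; rewrite /= in_itv /= tT => /(_ isT) wl; split.
    by have := sub_Lfun_mfun wl; rewrite inE.
  exact: Lfun1_L1norm.
pose n t := fine (L1norm (w t)).
have nE t : 0 <= t <= T -> (n t)%:E = L1norm (w t).
  by move=> /wt[_ wf]; rewrite /n fineK// ge0_fin_numE// L1norm_ge0.
have step s t e : 0 <= s <= T -> 0 <= t <= T ->
    (\int[lam]_y (`|w t y - w s y| ^+ 1)%:E <= e%:E)%E -> n t <= n s + e.
  move=> sT tT H; have [mt ft] := wt t tT; have [ms fs] := wt s sT.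
  rewrite -lee_fin EFinD !nE//.
  apply: (@le_trans _ _ (L1norm (w s) + L1norm (fun y => w t y - w s y)%R)%E).
    apply: L1normD_le => //; first exact: measurable_funB.
    by move=> y; apply: le_trans (ler_normD _ _); rewrite addrC subrK.
  by apply: leeD.
have cn : {within `[0, T], continuous n}.
  apply/subspace_continuousP => s; rewrite /= in_itv /= => sT.
  apply/cvgrPdist_le => e e0.
  have [r r0 H] := C0_Lp_int (ltn0Sn 0) wC sT e0.
  rewrite near_withinE; apply/nbhs_ballP; exists r => //= t; rewrite /ball /= => st.
  rewrite in_itv /= => tT.
  have ts : `|t - s| <= r by rewrite distrC ltW.
  have h1 := step s t e sT tT (H t tT ts).
  have h2 : n s <= n t + e.
    apply: step => //; under eq_integral do rewrite distrC.
    exact: H.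
  have : `|n s - n t| <= e by rewrite ler_norml; apply/andP; split; lra.
  exact.
have [c cT Hc] := EVT_max T0 cn.
exists (n c); first by rewrite fine_ge0// L1norm_ge0.
by move=> t tT; rewrite -nE// lee_fin; apply: Hc; rewrite in_itv.
Qed.

Variables (k : V -> R) (Bk : R).
Hypotheses (mk : measurable_fun setT k) (k0 : forall x, 0 <= k x)
  (kB : forall x, k x <= Bk) (k1 : (\int[lam]_x (k x)%:E = 1)%E).
Variable (W : R * V -> R).
Hypotheses (mW : measurable_fun (setT : set (RR * V)) W)
  (WL1 : forall s, (L1norm (fun y => W (s, y)) < +oo)%E).

Definition conv_gap eps (s : RR) : \bar R :=
  L1norm (fun y => convolution (fun y => W (s, y)) (eta_ k eps) y - W (s, y)).

Lemma measurable_conv_gap eps : measurable_fun setT (conv_gap eps).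
Proof.
have mf : measurable_fun (setT : set (RR * V))
    (fun z => `|convolution (fun y => W (z.1, y)) (eta_ k eps) z.2 - W z|%:E).
  apply/measurable_EFinP; apply: measurableT_comp => //; apply: measurable_funB => //.
  by apply: measurable_conv_st => //; exact: measurable_eta_.
have p0 z : (0 <= `|convolution (fun y => W (z.1, y)) (eta_ k eps) z.2 - W z|%:E)%E by [].
exact: (@measurable_fun_fubini_tonelli_F _ _ _ _ _ lam _ mf p0).
Qed.

(** At each time the gap tends to 0 by [approx_identity], and it is at most twice the L^1 norm;
    dominated convergence in time concludes along every sequence. *)
Lemma conv_gap_cvg T N : 0 <= N -> (forall s, 0 <= s <= T -> (L1norm (fun y => W (s, y)) <= N%:E)%E) ->
  (\int[mu]_(s in `[0%R, T]) conv_gap eps s)%E @[eps --> 0^'+] --> 0%E.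
Proof.
move=> N0 HN; apply/cvge_at_rightP => e [e0 ce].
have mWs s : measurable_fun setT (fun y => W (s, y)) by exact: measurable_slice.
have mD : measurable (`[0, T]%classic : set RR) by exact: measurable_itv.
have [||||_ _] := @dominated_convergence _ _ _ mu `[0, T]%classic mD (fun n => conv_gap (e n)) (cst 0%E)
  (cst (N + N)%:E) _ (measurable_cst _).
- by move=> n; apply: measurable_funTS; exact: measurable_conv_gap.
- by apply: aeW => s _; apply: (approx_identity mk k0 kB k1).
- apply/integrableP; split; first exact: measurable_cst.
  rewrite integral_cst//; apply: lte_mul_pinfty => //.
  rewrite [X in (X < _)%E](_ : _ = mu `[0, T]%classic)//.
  by rewrite lebesgue_measure_itv /=; case: ifPn => _; rewrite ltry.
- apply: aeW => s n; rewrite /= in_itv /= => sT.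
  rewrite gee0_abs; last exact: L1norm_ge0.
  apply: le_trans (conv_L1_le mk k0 kB k1 (e0 n) (mWs s) (WL1 s)) _.
  by rewrite EFinD; apply: leeD; exact: HN.
by rewrite integral0.
Qed.
End vanishing_gap.

Section Lp_interpolation.
Context d (T : measurableType d) {R : realType}.
Variable m : {measure set T -> \bar R}.

Lemma Lnorm_interpolation (f : T -> R) (p c N : R) : 1 < p -> 0 <= c -> 0 <= N ->
  measurable_fun setT f -> {ae m, forall x, `|f x| <= c} ->
  (\int[m]_x `|f x|%:E <= N%:E)%E ->
  ('N[m]_p%:E[EFin \o f] <= ((c `^ (p - 1) * N) `^ p^-1)%:E)%E.
Proof.
move=> p1 c0 N0 mf fc fN.
have p0 : 0 < p by exact: lt_trans p1.
have pm : 0 < p - 1 by rewrite subr_gt0.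
have mabs : measurable_fun setT (fun x => `|f x|%:E).
  by apply/measurable_EFinP; exact: measurableT_comp.
have I0 : (0 <= \int[m]_x `|(EFin \o f) x| `^ p)%E.
  by apply: integral_ge0 => x _; exact: poweR_ge0.
rewrite unlock -poweR_EFin; apply: gt0_ler_poweR.
- by rewrite invr_ge0 ltW.
- by rewrite in_itv /= I0 leey.
- by rewrite in_itv /= lee_fin mulr_ge0 ?powR_ge0// leey.
apply: (@le_trans _ _ (\int[m]_x ((c `^ (p - 1))%:E * `|f x|%:E))%E).
  apply: ae_ge0_le_integral => //.
  - by move=> x _; exact: poweR_ge0.
  - apply: (measurableT_comp (measurable_poweR p)).
    by apply: measurableT_comp => //; exact/measurable_EFinP.
  - by move=> x _; rewrite mule_ge0// lee_fin powR_ge0.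
  - exact: measurable_funeM.
  move: fc; apply: filterS => x fx _.
  have -> : (`|(EFin \o f) x|)%E = `|f x|%:E by [].
  rewrite poweR_EFin -EFinM lee_fin.
  have [->|f0] := eqVneq `|f x| 0; first by rewrite powR0 ?mulr0// gt_eqF.
  have -> : `|f x| `^ p = `|f x| `^ (p - 1) * `|f x|.
    rewrite -{1}[p](subrK 1) [LHS]powRD; last by apply/implyP.
    by rewrite powRr1.
  rewrite ler_wpM2r// ge0_ler_powR ?nnegrE//.
  exact: ltW.
rewrite ge0_integralZl//; last by rewrite lee_fin powR_ge0.
by rewrite EFinM lee_wpmul2l// lee_fin powR_ge0.
Qed.
End Lp_interpolation.

Section convergence.
Context {R : realType} {d : nat}.
Local Notation V := 'rV[R]_d.
Local Notation mu := (@lebesgue_measure R).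
Local Notation lam := (lebesgue_rV d).
Local Notation tl := (mu \x lam)%E.
Local Notation RR := (measurableTypeR R).
Variables (eta : V -> R) (b : R -> V) (ubar : V -> R) (nu : R).
Hypotheses (hd : (1 <= d)%N) (heta : kernel_axioms eta) (hb : lipschitz b)
  (hubar : ubar \in Lfun (lebesgue_rV d) 1%:E) (nu0 : 0 < nu).

Lemma ubar_L1 : (L1norm ubar < +oo)%E.
Proof. exact: Lfun1_L1norm. Qed.

Lemma nonlocal_solution_data eps u : 0 < eps -> nonlocal_solution eta b nu ubar eps u ->
  [/\ measurable_fun (setT : set (RR * V)) (ext u),
      (forall s, (L1norm (fun y => ext u (s, y)) < +oo)%E),
      (forall s, 0 <= s -> (L1norm (u s) <= L1norm ubar)%E),
      flux_data (ext u) (nonlocal_flux b (eta_ eta eps) u) &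
      (forall phi, Cc_infty setT phi ->
         weak_form nu (ext u) (nonlocal_flux b (eta_ eta eps) u) phi =
         - \int[lam]_x (ubar x * phi (0, x))) /\
      (forall t delta x, 0 <= t -> 0 < delta -> right_continuous_pairing nu (ext u) t delta x)].
Proof.
move=> eps0 [mu_ du hT].
have mU := measurable_ext mu_.
have L1u s : 0 <= s -> (L1norm (u s) <= L1norm ubar)%E.
  move=> s0; have s1 : 0 < s + 1 by rewrite ltr_wpDl.
  have [H _ _ _ _] := hT _ s1.
  have := H s; rewrite s0 lerDl ler01 => /(_ isT).
  by rewrite !Lnorm1.
have L1 s : (L1norm (fun y => ext u (s, y)) < +oo)%E.
  apply: L1norm_ext => t t0; rewrite Lnorm1.
  exact: le_lt_trans (L1u t t0) ubar_L1.
have fd : flux_data (ext u) (nonlocal_flux b (eta_ eta eps) u).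
  by apply: nonlocal_flux_data => // T T0; have [] := hT T T0.
split => //; split.
  move=> phi; apply: (distributional_weak_form du).
  - by move=> i z z0; rewrite /nonlocal_flux /ext z0.
  - by move=> i z z0; rewrite /nonlocal_flux ext_lt0// mul0r.
move=> t delta x t0 delta0.
apply: (@right_continuous_C0 _ _ _ nu0 2 u) => //.
- by right.
- by move=> T T0; have [] := hT T T0.
- by move=> s y s0; rewrite ext_ge0.
Qed.

Lemma local_solution_data w : local_solution b nu ubar w ->
  [/\ measurable_fun (setT : set (RR * V)) (ext w),
      (forall s, (L1norm (fun y => ext w (s, y)) < +oo)%E),
      (forall T, 0 < T -> Linfty_on `[0, T] w),
      flux_data (ext w) (local_flux b w) &
      (forall phi, Cc_infty setT phi ->
         weak_form nu (ext w) (local_flux b w) phi = - \int[lam]_x (ubar x * phi (0, x))) /\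
      (forall t delta x, 0 <= t -> 0 < delta -> right_continuous_pairing nu (ext w) t delta x)].
Proof.
move=> [mw dw [M [A [mA A0 HA]]] cw].
have mW := measurable_ext mw.
have L1 s : (L1norm (fun y => ext w (s, y)) < +oo)%E.
  apply: L1norm_ext => t t0; have t1 : 0 < t + 1 by rewrite ltr_wpDl.
  have [wL _] := cw _ t1; have := wL t; rewrite /= in_itv /= t0 lerDl ler01 => /(_ isT) wl.
  by rewrite Lnorm1; exact: Lfun1_L1norm.
have Lo T : 0 < T -> Linfty_on `[0, T] w.
  move=> T0; exists M, A; split => // z nP; apply: HA => /= H; apply: nP => /= -[zT _].
  by apply: H; split => //=; move: zT; rewrite /= !in_itv /= andbT => /andP[].
split => //; first exact: local_flux_data.
split.
  move=> phi; apply: (distributional_weak_form dw).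
  - by move=> i z z0; rewrite /local_flux /ext z0.
  - by move=> i z z0; rewrite /local_flux ext_lt0// mul0r.
move=> t delta x t0 delta0.
apply: (@right_continuous_C0 _ _ _ nu0 1 w) => //.
- by left.
- by move=> s y s0; rewrite ext_ge0.
Qed.

(** With r = a^2 the left side is 8 c a; the [c + 1] in the denominator of [a] allows c = 0. *)
Lemma sqrt_small (c e : R) : 0 <= c -> 0 < e -> exists2 r, 0 < r & c * (8 / Num.sqrt r^-1) <= e / 8.
Proof.
move=> c0 e0; pose a := e / (64 * (c + 1)).
have c1 : 0 < c + 1 by rewrite ltr_wpDl.
have a0 : 0 < a by rewrite divr_gt0// mulr_gt0.
exists (a ^+ 2); first by rewrite exprn_gt0.
rewrite sqrtrV ?sqr_ge0// sqrtr_sqr gtr0_norm// invrK.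
have -> : c * (8 * a) = (c / (c + 1)) * (e / 8) by rewrite /a; field; rewrite gt_eqF.
by rewrite ler_piMl ?divr_ge0 ?(ltW e0)// ler_pdivrMr// mul1r lerDl.
Qed.

Variables (u_eps : R -> R -> V -> R) (w : R -> V -> R).
Hypotheses (hu : forall eps, 0 < eps <= 1 -> nonlocal_solution eta b nu ubar eps (u_eps eps))
  (hw : local_solution b nu ubar w).

(** The order of the choices matters: [l], then [E], then [r], then [Q], all depending on the local
    solution and on [m] only; then [eps], small enough for [Q]; finally [D] and [h], depending on
    [eps]. The errors in [H2] are E/8, E/8 and E/4. *)
Lemma uniform_convergence T m : 0 < T -> 0 < m -> \forall eps \near 0^'+,
  forall t, 0 <= t <= T -> {ae lam, forall y, `|u_eps eps t y - w t y| <= m}.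
Proof.
move=> T0 m0.
have [mW WL1 WLo WG [wfW rcW]] := local_solution_data hw.
have [mk k0 [Bk kB] k1] := kernel_facts heta.
have [L L0 bL] := lipschitz_coor hb.
have [M M0 aeM] := ext_bounded (WLo T T0).
have [B B0 HB] := b_bound hb (M + 1).
have [_ _ _ cw] := hw.
have [N N0 HN] := L1norm_C0_bounded (ltW T0) (cw T T0).
have HN' s : 0 <= s <= T -> (L1norm (fun y => ext w (s, y)) <= N%:E)%E.
  move=> sT; rewrite (_ : (fun y => _) = w s); first exact: HN.
  by apply/funext => y; rewrite ext_ge0//; case/andP: sT.
pose g := @gap_cst R d nu.
have g0 : 0 <= g by exact: gap_cst_ge0.
have ML0 : 0 <= M * L by rewrite mulr_ge0// ltW.
(* With sqrt l = a + 1, the left side of [H1] becomes (a / (a + 1)) / 4. *)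
pose a := 32 * (g * (B + M * L)).
have a0 : 0 <= a by rewrite /a; apply: mulr_ge0 => //; apply: mulr_ge0 => //; exact: addr_ge0.
have a1 : 0 < a + 1 by rewrite ltr_wpDl.
pose l := (a + 1) ^+ 2.
have l0 : 0 < l by rewrite exprn_gt0.
have H1 : g * (B + M * L) * (8 / Num.sqrt l) <= 4^-1.
  rewrite sqrtr_sqr gtr0_norm//.
  have -> : g * (B + M * L) * (8 / (a + 1)) = (a / (a + 1)) * 4^-1.
    by rewrite /a; field; rewrite gt_eqF.
  by rewrite ler_piMl// ler_pdivrMr// mul1r lerDl.
(* The cap at 1 is what keeps the nonlocal solution below M + 1. Then [E] is tuned so that the bound
   E exp(l t) reaches exactly [m1] at time [T]. *)
pose m1 := Num.min m 1.
have m10 : 0 < m1 by rewrite lt_min m0 ltr01.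
pose E := m1 * expR (- (l * T)).
have E0 : 0 < E by rewrite mulr_gt0// expR_gt0.
have EE : E * expR (l * T) = m1 by rewrite /E -mulrA -expRD addNr expR0 mulr1.
have El : E * expR (l * T) <= 1 by rewrite EE ge_min lexx orbT.
pose c2r := g * (M * L * (4 * M)).
have c2r0 : 0 <= c2r by rewrite /c2r; apply: mulr_ge0 => //; apply: mulr_ge0 => //; exact: mulr_ge0.
have [r r0 Hr] := sqrt_small c2r0 E0.
pose c4 := g * (M * L * @gauss_sup R d nu r).
have c40 : 0 <= c4 by rewrite /c4; apply: mulr_ge0 => //; apply: mulr_ge0 => //; exact: gauss_sup_ge0.
pose Q := E / (4 * (c4 + 1)).
have c41 : 0 < c4 + 1 by rewrite ltr_wpDl.
have Q0 : 0 < Q by rewrite divr_gt0// mulr_gt0.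
have HQ : c4 * Q <= E / 4.
  have -> : c4 * Q = (c4 / (c4 + 1)) * (E / 4) by rewrite /Q; field; rewrite gt_eqF.
  by rewrite ler_piMl ?divr_ge0 ?(ltW E0)// ler_pdivrMr// mul1r lerDl.
have gap_ge0 eps : (0 <= \int[mu]_(s in `[0%R, T]) conv_gap eta (ext w) eps s)%E.
  by apply: integral_ge0 => s _; exact: L1norm_ge0.
have /(cvge0P _ gap_ge0)/(_ Q Q0) nearQ := conv_gap_cvg mk k0 kB k1 mW WL1 N0 HN'.
near=> eps.
have e0 : 0 < eps by near: eps; exact: nbhs_right_gt.
have e1 : eps <= 1 by near: eps; exact: nbhs_right_le.
have qQ : (\int[mu]_(s in `[0%R, T]) conv_gap eta (ext w) eps s <= Q%:E)%E by near: eps.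
have he : 0 < eps <= 1 by rewrite e0 e1.
have [mU UL1 UL UF [wfU rcU]] := nonlocal_solution_data e0 (hu he).
have [MU MU0 aeU] := let: And4 _ _ _ H := UF in H T.
have [MW MW0 aeWF] := let: And4 _ _ _ H := WG in H T.
pose D := MU + MW.
have D0 : 0 <= D by exact: addr_ge0.
have gD0 : 0 <= g * D * 2 by apply: mulr_ge0 => //; exact: mulr_ge0.
have [r2 r20 Hr2] := sqrt_small gD0 E0.
(* The step length is fixed after [eps], because [D] contains the bound of the nonlocal flux. *)
pose h := r2 / 2.
have h0 : 0 < h by rewrite divr_gt0.
have h2 : 2 * h = r2 by rewrite /h mulrC divfK.
have H2 : g * (M * L * (4 * M)) * (8 / Num.sqrt r^-1) + g * D * 2 * (8 / Num.sqrt (2 * h)^-1)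
  + g * (M * L * @gauss_sup R d nu r) * Q <= E / 2.
  rewrite h2 -/c2r -/c4; move: Hr Hr2 HQ.
  by move: (c2r * _) (_ * (8 / Num.sqrt r2^-1)) (c4 * Q) => x1 x2 x3; lra.
have aeWs : {ae mu, forall s : RR, s <= T -> {ae lam, forall y, `|ext w (s, y)| <= M}}.
  move: (ae_iterated aeM); apply: filterS => s H sT.
  by move: H; apply: filterS => y; exact.
have aeD : {ae mu, forall s : RR, s <= T -> {ae lam, forall y, forall i,
    `|nonlocal_flux b (eta_ eta eps) (u_eps eps) i (s, y) - local_flux b w i (s, y)| <= D}}.
  move: (ae_iterated aeU) (ae_iterated aeWF); apply: filterS2 => s HU HW sT.
  move: HU HW; apply: filterS2 => y /(_ sT)[_ FU] /(_ sT)[_ FW] i.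
  by apply: le_trans (ler_normB _ _) _; exact: lerD.
have mild t delta x : 0 <= t -> 0 < delta ->
  heat_pairing nu (ext (u_eps eps)) t delta x t - heat_pairing nu (ext w) t delta x t =
  duhamel nu (nonlocal_flux b (eta_ eta eps) (u_eps eps)) t delta x -
  duhamel nu (local_flux b w) t delta x.
  move=> t0 delta0; apply: (mild_identity hd heta nu0) => //.
  - by move=> phi cphi; rewrite wfU// wfW.
  - exact: rcU.
  - exact: rcW.
move=> t tT.
have := stability_bound nu0 mk k0 kB k1 e0 L0 bL UF WG UL1 WL1 mild M0 B0 D0 E0 l0 r0 h0 El HB
  aeWs aeD (measurable_conv_gap mk mW eps) qQ H1 H2 tT.
apply: filterS => y; have /andP[t0 tT'] := tT.
rewrite !ext_ge0// => H; apply: (le_trans H).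
apply: (@le_trans _ _ m1); last by rewrite ge_min lexx.
by rewrite -EE ler_pM2l// ler_expR ler_pM2l.
Unshelve. all: by end_near.
Qed.
End convergence.

Theorem theorem1p1 (R : realType) (d : nat) (hd : (1 <= d)%N)
    (eta : 'rV[R]_d -> R) (heta : kernel_axioms eta)
    (b : R -> 'rV[R]_d) (hb : lipschitz b)
    (ubar : 'rV[R]_d -> R)
    (hubar1 : ubar \in Lfun (lebesgue_rV d) 1%:E)
    (hubaroo : ubar \in Lfun (lebesgue_rV d) +oo%E)
    (nu : R) (hnu : 0 < nu)
    (p : R) (hp2 : 2 <= p) (hpd : d%:R < p)
    (u_eps : R -> R -> 'rV[R]_d -> R)
    (hu_eps : forall eps : R, 0 < eps <= 1 ->
       nonlocal_solution eta b nu ubar eps (u_eps eps))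
    (u_nu : R -> 'rV[R]_d -> R)
    (hu_nu : local_solution b nu ubar u_nu) :
  forall T : R, 0 < T ->
    Linfty_Lp_norm T p (fun t => u_eps eps t \- u_nu t) @[eps --> 0^'+] --> 0%E.
Proof.
move=> T T0.
have p1 : 1 < p by apply: lt_le_trans hp2; rewrite ltr1n.
have p0 : 0 < p by exact: lt_trans p1.
have [_ _ _ cw] := hu_nu.
have [N N0 HN] := L1norm_C0_bounded (ltW T0) (cw T T0).
apply/cvge0P => [eps|e e0].
  (* Nonnegativity of the essential supremum requires [0, T] to have positive measure, since over a
     null space it would be minus infinity. *)
  apply: ess_sup_gee.
    rewrite /= /mrestr setTI; have -> : lebesgue_measure `[0, T]%classic = T%:E.
      by rewrite lebesgue_measure_itv /= lte_fin T0 oppr0 adde0.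
    by rewrite lte_fin.
  by apply: aeW => t; exact: Lnorm_ge0.
have ubf : L1norm ubar \is a fin_num by rewrite ge0_fin_numE ?L1norm_ge0// ubar_L1.
(* Bounds the L^1 norm of the difference at all times; the 1 makes it positive. Then [m] solves
   (m^(p-1) N')^(1/p) = e, the bound that interpolation produces. *)
pose N' := fine (L1norm ubar) + N + 1.
have N'0 : 0 < N' by rewrite ltr_wpDl// addr_ge0// fine_ge0// L1norm_ge0.
pose m := (e `^ p / N') `^ (p - 1)^-1.
have m0 : 0 < m by rewrite powR_gt0// divr_gt0// powR_gt0.
have mE : (m `^ (p - 1) * N') `^ p^-1 = e.
  rewrite /m -powRrM mulVf ?gt_eqF ?subr_gt0// powRr1 ?divr_ge0 ?powR_ge0 ?(ltW N'0)//.
  by rewrite divfK ?gt_eqF// -powRrM mulfV ?gt_eqF// powRr1// ltW.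
have near_m := uniform_convergence hd heta hb hubar1 hnu hu_eps hu_nu T0 m0.
near=> eps.
have eps0 : 0 < eps by near: eps; exact: nbhs_right_gt.
have eps1 : eps <= 1 by near: eps; exact: nbhs_right_le.
have Hm : forall t, 0 <= t <= T -> {ae lebesgue_rV d, forall y, `|u_eps eps t y - u_nu t y| <= m}.
  by near: eps.
have he : 0 < eps <= 1 by rewrite eps0 eps1.
have [mU UL1 UL _ _] := nonlocal_solution_data heta hb hubar1 hnu eps0 (hu_eps eps he).
have [mW WL1 _ _ _] := local_solution_data hb hnu hu_nu.
(* The bound holds at every time of [0, T], so the exceptional set is just the complement, null for
   the restricted measure. *)
apply/ess_supP; exists (~` `[0, T]%classic); split.
- by apply: measurableC; exact: measurable_itv.
- by rewrite /= /mrestr setICl measure0.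
move=> t nt tT; apply: nt => /=; move: tT; rewrite /= in_itv /= => tT.
have /andP[t0 _] := tT.
have mu_ : measurable_fun setT (u_eps eps t).
  by rewrite (_ : u_eps eps t = fun y => ext (u_eps eps) (t, y));
    [exact: measurable_slice|apply/funext => y; rewrite ext_ge0].
have mw_ : measurable_fun setT (u_nu t).
  by rewrite (_ : u_nu t = fun y => ext u_nu (t, y));
    [exact: measurable_slice|apply/funext => y; rewrite ext_ge0].
rewrite -mE; apply: Lnorm_interpolation => //.
- exact: ltW.
- exact: ltW.
- exact: measurable_funB.
- exact: Hm.
apply: (@le_trans _ _ (L1norm (u_eps eps t) + L1norm (u_nu t))%E).
  by apply: L1normD_le => //; [exact: measurable_funB|move=> y; exact: ler_normB].
apply: (@le_trans _ _ (L1norm ubar + N%:E)%E); first by apply: leeD; [exact: UL|exact: HN].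
by rewrite -(fineK ubf) -EFinD lee_fin /N' lerDl.
Unshelve. all: by end_near.
Qed.
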